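(* Let $\mathcal D$ be a $10$-deck with $s_{\mathcal D}(P_2)>0$. If the $8$-deck of $\mathcal D$ is of Class I, then $\mathcal D$ is of Class I; if the $8$-deck of $\mathcal D$ is of Class II, then $\mathcal D$ is of Class II. Otherwise (that is, if the $8$-deck of $\mathcal D$ is of Class III), $\mathcal D$ is of Class II if at least one of the following holds: (a) $s_{\mathcal D}(C_3\oplus C_3)=0$ and $s_{\mathcal D}(C_3\oplus C_7)>0$; (b) $s_{\mathcal D}(C_3\oplus C_3)=s_{\mathcal D}(C_3\cup C_3)=0$ and $s_{\mathcal D}(C_3\cup C_7)>0$; (c) $s_{\mathcal D}(C_3\oplus C_3)=s_{\mathcal D}(C_3\oplus P_2\oplus C_3)=0$ and $4\,s_{\mathcal D}(C_3\oplus P_4\oplus C_3)\,s_{\mathcal D}(C_5\oplus C_5)<s_{\mathcal D}(C_3\oplus P_2\oplus C_5)^2$; and if none of (a), (b), (c) holds, then $\mathcal D$ is of Class I if $s_{\mathcal D}(C_{10})>0$ and of Class III if $s_{\mathcal D}(C_{10})=0$.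
   Context: All graphs are finite and simple; $\|G\|$ is the number of edges of $G$. $C_n$ is the $n$-vertex cycle and $P_n$ is the path with $n$ edges. $G\cup H$ is the disjoint union. For cycles $C_k,C_\ell$, $C_k\oplus C_\ell$ is obtained from $C_k\cup C_\ell$ by identifying one vertex of $C_k$ with one vertex of $C_\ell$, and $C_k\oplus P_n\oplus C_\ell$ is obtained from $C_k\cup P_n\cup C_\ell$ by identifying one vertex of $C_k$ with one end-vertex of $P_n$ and one vertex of $C_\ell$ with the other end-vertex of $P_n$. Decks: an $\ell$-deck is a (finite) multiset of $\ell$-edge graphs (isolated vertices are disregarded). For a graph $G$, $G[\ell]$ is the multiset of all $\ell$-edge subgraphs of $G$, one for each $\ell$-element subset of $E(G)$. For $\ell'\le\ell$, the $\ell'$-deck of an $\ell$-deck $\mathcal D$ is the multiset union of $H[\ell']$ over all $H\in\mathcal D$ (with multiplicities). For an $\ell$-deck $\mathcal D$ and a graph $H$ with $\|H\|\le\ell$, $s_{\mathcal D}(H)$ is the total number (with multiplicity) of $\|H\|$-edge subgraphs of the graphs in $\mathcal D$ that are isomorphic to $H$. Kernels: a kernel is a bounded measurable symmetric function $U:[0,1]^2\to\mathbb R$; it is non-zero if it is not equal to $0$ almost everywhere. For a graph $H$, $t(H,U)=\int_{[0,1]^{V(H)}}\prod_{uv\in E(H)}U(x_u,x_v)\,dx_{V(H)}$. For an $\ell$-deck $\mathcal D$ and an even positive integer $\ell'\le\ell$, put $c^{\mathcal D}_{U,\ell'}=\sum_{H\in\mathcal D}\sum_{H'\in H[\ell']}t(H',U)$.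 Classes: let $\ell$ be even. An $\ell$-deck $\mathcal D$ is of Class I if for every non-zero kernel $U$, not all of the coefficients $c^{\mathcal D}_{U,2},c^{\mathcal D}_{U,4},\ldots,c^{\mathcal D}_{U,\ell}$ are zero and the first non-zero one among them is positive; Class II if there is a non-zero kernel $U$ such that not all of $c^{\mathcal D}_{U,2},\ldots,c^{\mathcal D}_{U,\ell}$ are zero and the first non-zero one is negative; Class III if there is a non-zero kernel $U$ for which all of $c^{\mathcal D}_{U,2},\ldots,c^{\mathcal D}_{U,\ell}$ are zero, and for every kernel $U$ either all of these coefficients are zero or the first non-zero one is positive. *)

(* Defs.v *)
From HB Require Import structures.
From mathcomp Require Import all_boot all_order all_algebra.

Set Implicit Arguments.
Unset Strict Implicit.
Unset Printing Implicit Defensive.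

Section Graphs.
Local Open Scope nat_scope.
Local Open Scope set_scope.

Record graph := Graph {
  nverts : nat;
  edges : {set {set 'I_nverts}};
  edges2 : [forall e in edges, #|e| == 2] }.

Lemma mkgraph_subproof n (A : {set {set 'I_n}}) :
  [forall e in [set e in A | #|e| == 2], #|e| == 2].
Proof. by apply/forall_inP => e; rewrite inE => /andP[]. Qed.

(* Members of A that are not pairs of distinct vertices are dropped. *)
Definition mkgraph n (A : {set {set 'I_n}}) : graph :=
  Graph (mkgraph_subproof A).

Definition nedges (G : graph) : nat := #|edges G|.

Definition adj (G : graph) (u v : 'I_(nverts G)) : bool :=
  [set u; v] \in edges G.

Definition nonisolated (G : graph) : {set 'I_(nverts G)} :=
  [set u | [exists v, adj u v]].

(* Isolated vertices are disregarded: only the non-isolated vertices have to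
   be matched. *)
Definition iso (G H : graph) : bool :=
  [exists f : {ffun {u | u \in nonisolated G} -> {v | v \in nonisolated H}},
    [&& injectiveb f, [forall v, v \in codom f] &
        [forall u1, forall u2,
           adj (val u1) (val u2) == adj (val (f u1)) (val (f u2))]]].

Definition subgraph (G : graph) (A : {set {set 'I_(nverts G)}}) : graph :=
  mkgraph A.

(* A finite multiset of graphs is represented by a sequence. *)
Definition subgraphs (l : nat) (G : graph) : seq graph :=
  [seq subgraph A | A <- enum [set A : {set {set 'I_(nverts G)}}
                                 | (A \subset edges G) && (#|A| == l)]].

Definition is_deck (l : nat) (D : seq graph) : bool :=
  all (fun G => nedges G == l) D.

Definition subdeck (l : nat) (D : seq graph) : seq graph :=
  flatten [seq subgraphs l G | G <- D].

(* s_D(H) *)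
Definition subgraph_count (D : seq graph) (H : graph) : nat :=
  \sum_(G <- D) count (iso H) (subgraphs (nedges H) G).

(* n.-1.+1 is n for n > 0 and makes the vertex 0 available for every n; this
   is the cycle C_n only for n >= 3. *)
Definition Cycle (n : nat) : graph :=
  mkgraph [set [set i; ordS i] | i : 'I_n.-1.+1].

(* n is the number of edges. *)
Definition Path (n : nat) : graph :=
  mkgraph [set [set widen_ord (leqnSn n) i; lift ord0 i] | i : 'I_n].

Definition gunion (G H : graph) : graph :=
  @mkgraph (nverts G + nverts H)
    ([set [set lshift (nverts H) w | w in (e : {set _})] | e in edges G] :|:
     [set [set rshift (nverts G) w | w in (e : {set _})] | e in edges H]).

(* Identification of v with u: the edges at v are moved to u, and v is left
   behind as an isolated vertex. *)
Definition identify (G : graph) (u v : 'I_(nverts G)) : graph :=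
  mkgraph [set [set if w == v then u else w | w in (e : {set _})]
             | e in edges G].

(* The vertices of H other than v keep their names rshift _ _, and all those of
   G their names lshift _ _. *)
Definition glue (G : graph) (u : 'I_(nverts G)) (H : graph)
    (v : 'I_(nverts H)) : graph :=
  @identify (gunion G H) (lshift (nverts H) u) (rshift (nverts G) v).

(* C_k (+) C_l, one vertex of each cycle being identified. *)
Definition CC (k l : nat) : graph :=
  @glue (Cycle k) ord0 (Cycle l) ord0.

(* C_k (+) P_n (+) C_l for n > 0; the end-vertices of P_n are 0 and n. *)
Definition CPC (k n l : nat) : graph :=
  @glue (@glue (Cycle k) ord0 (Path n) ord0)
    (rshift (nverts (Cycle k)) (ord_max : 'I_n.+1)) (Cycle l) ord0.

End Graphs.

From mathcomp Require Import all_classical all_reals all_analysis.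
Import Order.TTheory GRing.Theory Num.Theory.
Import numFieldNormedType.Exports.

Section ConsMeasure.
Local Open Scope classical_set_scope.
Local Open Scope ring_scope.
Context d (T : measurableType d) (R : realType) (n : nat).
Variables (m1 : {sigma_finite_measure set T -> \bar R})
  (m2 : {sigma_finite_measure set (n.-tuple T) -> \bar R}).
Local Open Scope ereal_scope.

Definition cons_pair (p : T * n.-tuple T) : n.+1.-tuple T :=
  [the n.+1.-tuple T of p.1 :: p.2].

Lemma measurable_cons_pair : measurable_fun [set: _] cons_pair.
Proof. exact: (measurable_cons measurable_fst measurable_snd). Qed.

HB.instance Definition _ :=
  isMeasurableFun.Build _ _ _ _ cons_pair measurable_cons_pair.

Definition cons_measure : set (n.+1.-tuple T) -> \bar R :=
  pushforward (m1 \x m2) cons_pair.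

Let cons_measure0 : cons_measure set0 = 0.
Proof. exact: measure0. Qed.

Let cons_measure_ge0 A : 0 <= cons_measure A.
Proof. exact: measure_ge0. Qed.

Let cons_measure_sigma_additive : semi_sigma_additive cons_measure.
Proof. exact: measure_semi_sigma_additive. Qed.

HB.instance Definition _ := isMeasure.Build _ _ _ cons_measure
  cons_measure0 cons_measure_ge0 cons_measure_sigma_additive.

Let cons_measure_sigma_finite : sigma_finite setT cons_measure.
Proof.
have /sigma_finiteP[F [TF ndF Foo]] := sigma_finiteT m1.
have /sigma_finiteP[G [TG ndG Goo]] := sigma_finiteT m2.
pose uncons (x : n.+1.-tuple T) : T * n.-tuple T :=
  (thead x, [tuple of behead x]).
have muncons : measurable_fun setT uncons.
  apply: measurable_fun_pair; first exact: measurable_tnth.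
  exact: measurable_behead.
have consK p : uncons (cons_pair p) = p.
  by case: p => a x; congr pair; apply: val_inj.
exists (fun i => uncons @^-1` (F i `*` G i)) => [|i].
  rewrite -preimage_bigcup; apply/esym; rewrite -[RHS](preimage_setT uncons).
  congr (_ @^-1` _); rewrite -setXTT TF TG predeqE => -[x y]; split.
    by move=> [k _ []/= ? ?]; split; exists k.
  move=> [/= [k _ Fkx] [l _ Gly]]; exists (maxn k l) => //; split.
  - by move: x Fkx; exact/subsetPset/ndF/leq_maxl.
  - by move: y Gly; exact/subsetPset/ndG/leq_maxr.
have [mF Fioo] := Foo i; have [mG Gioo] := Goo i; split.
  by rewrite -[X in measurable X]setTI; apply: muncons => //; exact: measurableX.
rewrite /cons_measure /pushforward -comp_preimage.
rewrite (_ : uncons \o cons_pair = id); last exact/funext.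
by rewrite preimage_id product_measure1E// lte_mul_pinfty// ge0_fin_numE.
Qed.

HB.instance Definition _ := Measure_isSigmaFinite.Build _ _ _ cons_measure
  cons_measure_sigma_finite.

End ConsMeasure.

Local Open Scope ring_scope.

(* n-dimensional Lebesgue measure as an iterated product measure. *)
Fixpoint lebesgue_tuple (R : realType) (n : nat) :
    {sigma_finite_measure set (n.-tuple (measurableTypeR R)) -> \bar R} :=
  match n with
  | 0 => \d_([tuple] : 0.-tuple (measurableTypeR R))
  | n'.+1 => cons_measure (@lebesgue_measure R) (lebesgue_tuple R n')
  end.

Section Kernels.
Context (R : realType).
Local Open Scope classical_set_scope.
Local Open Scope ring_scope.
Implicit Type U : measurableTypeR R * measurableTypeR R -> measurableTypeR R.

Definition unit_square : set (measurableTypeR R * measurableTypeR R) :=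
  `[0, 1]%classic `*` `[0, 1]%classic.

Definition unit_cube (n : nat) : set (n.-tuple (measurableTypeR R)) :=
  [set x | forall i, tnth x i \in `[0, 1]].

(* Measurability is with respect to the Borel sets; only the values of U on the
   unit square matter. *)
Definition is_kernel U : Prop :=
  [/\ measurable_fun unit_square U,
      exists M : R, forall z, unit_square z -> `|U z| <= M &
      forall x y, unit_square (x, y) -> U (x, y) = U (y, x)].

Definition nonzero U : Prop :=
  ~ {ae (@lebesgue_measure R \x @lebesgue_measure R)%E,
      forall z, unit_square z -> U z = 0}.

(* t(H, U): each edge uv contributes one factor, indexed by the pair with u < v. *)
Definition hom_density (H : graph) U : R :=
  \int[lebesgue_tuple R (nverts H)]_(x in @unit_cube (nverts H))
    \prod_(p : 'I_(nverts H) * 'I_(nverts H)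
            | (p.1 < p.2)%N && adj p.1 p.2)
      U (tnth x p.1, tnth x p.2).

(* c^D_{U, l'} *)
Definition coeff (D : seq graph) U (l' : nat) : R :=
  \sum_(H <- D) \sum_(H' <- subgraphs l' H) hom_density H' U.

Definition evens (l : nat) : pred nat :=
  fun k => [&& (0 < k)%N, (k <= l)%N & ~~ odd k].

Definition all_zero (l : nat) (D : seq graph) U : Prop :=
  forall k, evens l k -> coeff D U k = 0.

Definition first_nonzero (l : nat) (D : seq graph) U (k : nat) : Prop :=
  [/\ evens l k, coeff D U k <> 0 &
      forall j, evens l j -> (j < k)%N -> coeff D U j = 0].

Definition first_positive (l : nat) (D : seq graph) U : Prop :=
  exists2 k, first_nonzero l D U k & 0 < coeff D U k.

Definition first_negative (l : nat) (D : seq graph) U : Prop :=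
  exists2 k, first_nonzero l D U k & coeff D U k < 0.

End Kernels.

Section Classes.
Context (R : realType) (l : nat) (D : seq graph).
Local Notation kern :=
  (measurableTypeR R * measurableTypeR R -> measurableTypeR R)%type.

Definition class_I : Prop :=
  forall U : kern, is_kernel U -> nonzero U -> first_positive l D U.

Definition class_II : Prop :=
  exists U : kern, [/\ is_kernel U, nonzero U & first_negative l D U].

Definition class_III : Prop :=
  (exists U : kern, [/\ is_kernel U, nonzero U & all_zero l D U]) /\
  (forall U : kern, is_kernel U -> all_zero l D U \/ first_positive l D U).

End Classes.

Arguments class_I : clear implicits.
Arguments class_II : clear implicits.
Arguments class_III : clear implicits.

(* Main.v *)
Require Import Defs.
From HB Require Import structures.
From mathcomp Require Import all_boot all_order all_algebra.
From mathcomp Require Import reals.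
From mathcomp Require Import zify.

Set Implicit Arguments.
Unset Strict Implicit.
Unset Printing Implicit Defensive.

(** Every coefficient of the 8-deck is a positive binomial multiple of the
corresponding coefficient of D, because each k-edge subgraph of a 10-edge graph
lies in the same number of 8-edge subgraphs.  So the first nonzero coefficient
among the first four has the same sign for both decks, which settles Classes I
and II; only a Class III 8-deck needs work.

For a kernel V write deg for its degree function, tau_k(s) for the density of
closed walks of length k at s, and V^n for its n-th power as an integral
operator.  The second coefficient is a combination of the squares of deg and of
its mean, with a positive weight on the former since P_2 occurs.  So it is
positive unless deg vanishes almost everywhere, and then every graph with a
vertex of degree one has density zero.  From then on only subgraphs of minimum
degree two count.  A nonzero kernel has t(C_(2k), V) > 0 for k >= 2
(mean_tau_gt0): the mean of tau_(2k) is the square norm of V^k, and by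
Cauchy-Schwarz its vanishing descends to k = 2, then to all integrals of V over
measurable sets.  Hence in a Class III 8-deck a kernel with all coefficients
zero excludes C_4, then C_6 and finally C_8 (classIII_n4, classIII_n6,
classIII_n8).

Once C_4, C_6, C_8 are absent, the graphs of minimum degree two with at most 10
edges and an even number of edges form a short list: two odd cycles, disjoint,
sharing a vertex or joined by a path, three graphs T_1, T_2, T_3 made of three
triangles and an edge, and C_10.  A computation that grows graphs edge by edge and is checked
inside the logic finds them (finalsP, classifiedP).  Contracting the paths, the
density of each of them becomes a pairing: C_k o C_l gives the mean of
tau_k tau_l, the disjoint union gives the product of means, the dumbbell
C_k o P_n o C_l gives the pairing of tau_k with V^n tau_l (dens_CC, dens_CuC,
dens_CPC).  This yields the coefficients 4, 6, 8, 10 in closed form (coeff_4,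
coeff_6, coeff_8, coeff_10).

If none of (a), (b), (c) holds, the first nonzero coefficient is positive
(combine_6, combine_8, combine_10).  Once the coefficient 6 vanishes, tau_3 is
zero or C_3 o C_3 is absent, and the mean of tau_3 is zero or C_3 u C_3 is
absent.  In the first alternatives the terms with tau_3 or its mean disappear;
in the second ones so do the counts of the graphs concerned, because (a) and (b)
fail and, for C_3 o C_5 and C_3 u C_5, because the 8-deck is of Class III.  What
remains is a quadratic form in V^2 tau_3 and tau_5.  It is nonnegative because
(c) fails, or because V tau_3 = 0 if C_3 o P_2 o C_3 occurs and the coefficient
8 vanishes.  The coefficient 10 is therefore at least the C_10 term, and this
decides between Classes I and III.

The converse needs kernels on which the bad term wins (classII_a, classII_b,
classII_c, and classIII_n35, classIII_nu35 for the 8-deck).  Take eigenvalues 2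
and -1 with multiplicities N and mN: the power sum N (2^k + m (-1)^k) is
negative for k = 3 and can be positive or zero for larger odd k.  Eigenfunctions
built from independent signs make tau_k a constant, or a constant times a sign
function h, as the case requires; an extra eigenvalue mu on h, balanced by -mu,
tunes the dumbbells in case (c).  The bad term is quadratic in N and the
C_8 or C_10 term only linear, so a large N makes the coefficient negative. *)

(** * Edge lists and the search for embeddings *)

Section Codes.
Local Open Scope nat_scope.

(** A graph without isolated vertices is handled through a list of its edges on
natural numbers; such lists can be computed with, unlike sets over ordinals. *)
Definition ecode : Type := seq (nat * nat).
Implicit Types (l S : ecode) (u v m : nat).

Definition verts l : seq nat := undup (map fst l ++ map snd l).
Definition wf l : bool := uniq l && all (fun p => p.1 < p.2) l.
Definition flip (p : nat * nat) := (p.2, p.1).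

(** The host is an arbitrary relation, so that the same notion serves for graphs
and for other codes. *)
Definition emb l (V : eqType) (e : rel V) : Prop :=
  exists rho : nat -> V, {in verts l &, injective rho} /\
    (forall p, p \in l -> e (rho p.1) (rho p.2)).

Definition cadj l : rel nat := fun u v => ((u, v) \in l) || ((v, u) \in l).

Lemma verts1 l p : p \in l -> p.1 \in verts l.
Proof. by move=> pl; rewrite mem_undup mem_cat map_f. Qed.

Lemma verts2 l p : p \in l -> p.2 \in verts l.
Proof. by move=> pl; rewrite mem_undup mem_cat [in X in _ || X]map_f ?orbT. Qed.

Lemma vertsP l v : reflect (exists2 p, p \in l & (v == p.1) || (v == p.2)) (v \in verts l).
Proof.
apply: (iffP idP) => [|[p pl]]; last first.
  by case/orP => /eqP->; [exact: verts1|exact: verts2].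
rewrite mem_undup mem_cat => /orP[] /mapP[p pl ->]; exists p => //; rewrite eqxx ?orbT//.
Qed.

Lemma verts_cons p l v :
  (v \in verts (p :: l)) = [|| v == p.1, v == p.2 | v \in verts l].
Proof.
apply/vertsP/idP => [[q]|].
  rewrite inE => /predU1P[->|ql]; first by case/orP => ->; rewrite ?orbT.
  by move=> vq; apply/orP; right; apply/orP; right; apply/vertsP; exists q.
case/or3P => [h|h|/vertsP[q ql h]].
- by exists p; rewrite ?mem_head ?h.
- by exists p; rewrite ?mem_head ?h ?orbT.
- by exists q; rewrite ?inE ?ql ?orbT.
Qed.

Lemma emb_trans l1 l2 (V : eqType) (e : rel V) : symmetric e ->
  emb l1 (cadj l2) -> emb l2 e -> emb l1 e.
Proof.
move=> se [r1 [i1 h1]] [r2 [i2 h2]].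
have im a : a \in verts l1 -> r1 a \in verts l2.
  move=> /vertsP[p /h1 h]; case/orP: h => h; case/orP => /eqP->.
  - exact: verts1 h.
  - exact: verts2 h.
  - exact: verts2 h.
  - exact: verts1 h.
exists (r2 \o r1); split.
  by move=> a b al bl /= /i2 h; apply: i1 => //; apply: h; exact: im.
by move=> p /h1 /orP[] /h2 //=; rewrite se.
Qed.

Definition assignment := seq (nat * nat).
Definition consistent (a : nat * nat) (s : assignment) : bool :=
  all (fun b => (a.1 == b.1) == (a.2 == b.2)) s.

(** The list function has, with an early exit under eager evaluation, so that the
searches do not explore branches after a success. *)
Fixpoint anyb T (a : pred T) (s : seq T) : bool :=
  if s is x :: s' then if a x then true else anyb a s' else false.

Lemma anybE T (a : pred T) s : anyb a s = has a s.
Proof. by elim: s => //= x s ->; case: (a x). Qed.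

Fixpoint search (l2 : ecode) (l1 : ecode) (s : assignment) : bool :=
  if l1 is (u, v) :: l1' then
    anyb (fun q : nat * nat =>
      if consistent (u, q.1) s then
        let s' := (u, q.1) :: s in
        if consistent (v, q.2) s' then search l2 l1' ((v, q.2) :: s') else false
      else false) l2
  else true.

Definition embedsb l1 l2 : bool := search (l2 ++ map flip l2) l1 [::].

Lemma mem_sym_code l a b : ((a, b) \in l ++ map flip l) = cadj l a b.
Proof.
rewrite mem_cat /cadj; congr (_ || _); apply/mapP/idP => [[[c d] h [-> ->]]//|h].
by exists (b, a).
Qed.

(** The search can follow any given embedding rho: the assignment built so far
is kept inside the graph of rho, so no consistency test fails. *)
Lemma search_complete l1 l2 (rho : nat -> nat) (W : seq nat) s :
  {in W &, injective rho} -> {subset verts l1 <= W} ->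
  {subset map fst s <= W} -> (forall p, p \in s -> p.2 = rho p.1) ->
  (forall p, p \in l1 -> cadj l2 (rho p.1) (rho p.2)) ->
  search (l2 ++ map flip l2) l1 s.
Proof.
move=> iW; elim: l1 s => //= -[u v] l1 IH s sW sf hs hl.
have uW : u \in W by apply: sW; exact: (verts1 (mem_head (u, v) l1)).
have vW : v \in W by apply: sW; exact: (verts2 (mem_head (u, v) l1)).
have cons a s' : a \in W -> {subset map fst s' <= W} -> (forall p, p \in s' -> p.2 = rho p.1) ->
    consistent (a, rho a) s'.
  move=> aW sW' hs'; apply/allP => b bs /=; rewrite hs'//.
  have [->|ab] := eqVneq a b.1; first by rewrite !eqxx.
  apply/eqP/esym; apply: contra_neqF ab => /eqP; apply: iW => //; exact/sW'/map_f.
rewrite anybE; apply/hasP; exists (rho u, rho v); first by rewrite mem_sym_code; exact: (hl (u, v)) (mem_head _ _).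
rewrite /= cons//=.
have sW1 : {subset map fst ((u, rho u) :: s) <= W}.
  by move=> a; rewrite inE => /predU1P[->//|]; exact: sf.
have hs1 p : p \in (u, rho u) :: s -> p.2 = rho p.1.
  by rewrite inE => /predU1P[->//|]; exact: hs.
have := cons v _ vW sW1 hs1; rewrite /= => ->.
apply: IH.
- by move=> a al; apply: sW; rewrite verts_cons al !orbT.
- by move=> a; rewrite inE => /predU1P[->//|]; exact: sW1.
- by move=> p; rewrite inE => /predU1P[->//|]; exact: hs1.
- by move=> p pl; apply: hl; rewrite inE pl orbT.
Qed.

Lemma emb_embedsb l1 l2 : emb l1 (cadj l2) -> embedsb l1 l2.
Proof.
move=> [rho [irho hrho]].
exact: (@search_complete l1 l2 rho (verts l1)).
Qed.

Definition coherent (s : assignment) : Prop :=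
  forall a b, a \in s -> b \in s -> (a.1 == b.1) = (a.2 == b.2).

Lemma coherent_cons a s : coherent s -> consistent a s -> coherent (a :: s).
Proof.
move=> cs /allP ca b c; rewrite !inE => /predU1P[->|bs] /predU1P[->|cs'].
- by rewrite !eqxx.
- exact: (eqP (ca c cs')).
- by rewrite eq_sym [RHS]eq_sym; exact: (eqP (ca b bs)).
- exact: cs.
Qed.

(** A successful search only produces a coherent assignment; embedsb_emb
extracts an injection from it. *)
Lemma search_sound E l1 s : search E l1 s -> coherent s ->
  exists s', [/\ coherent s', {subset s <= s'} &
    forall p, p \in l1 -> exists a b, [/\ (p.1, a) \in s', (p.2, b) \in s' & (a, b) \in E]].
Proof.
elim: l1 s => [|[u v] l1 IH] s /=; first by move=> _ cs; exists s; split => // p; rewrite in_nil.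
rewrite anybE => /hasP[[a b] qE]; case: ifP => // c1; case: ifP => // c2 h cs.
have [s' [cs' ss' hs']] := IH _ h (coherent_cons (coherent_cons cs c1) c2).
exists s'; split => //; first by move=> p ps; apply: ss'; rewrite !inE ps !orbT.
move=> p; rewrite inE => /predU1P[->|]; last exact: hs'.
by exists a, b; split => //; apply: ss'; rewrite !inE eqxx ?orbT.
Qed.

Lemma embedsb_emb l1 l2 : embedsb l1 l2 -> emb l1 (cadj l2).
Proof.
move=> /search_sound[//|s [cs _ hs]].
pose rho u := (nth (0, 0) s (find (fun p => p.1 == u) s)).2.
have rhoE u a : (u, a) \in s -> rho u = a.
  move=> uas; have hu : has (fun p => p.1 == u) s by apply/hasP; exists (u, a) => //=.
  have := nth_find (0, 0) hu; rewrite /rho; set q := nth _ _ _ => qu.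
  have qs : q \in s by apply: mem_nth; rewrite -has_find.
  by apply/eqP; rewrite -(cs q (u, a) qs uas).
have ex u : u \in verts l1 -> exists a, (u, a) \in s.
  by move=> /vertsP[p /hs[a [b [h1 h2 _]]]] /orP[] /eqP->; [exists a|exists b].
exists rho; split.
  move=> u v /ex[a ua] /ex[b vb]; rewrite (rhoE _ _ ua) (rhoE _ _ vb) => ab.
  by apply/eqP; rewrite (cs _ _ ua vb) /= ab.
move=> p /hs[a [b [h1 h2 h]]]; rewrite (rhoE _ _ h1) (rhoE _ _ h2).
by rewrite -mem_sym_code.
Qed.

Definition lookup (s : assignment) u : option nat :=
  ohead [seq a.2 | a <- s & a.1 == u].

Definition neighbours l a : seq nat :=
  [seq q.2 | q <- l & q.1 == a] ++ [seq q.1 | q <- l & q.2 == a].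

Fixpoint firstsome T U (f : T -> option U) (s : seq T) : option U :=
  if s is x :: s' then if f x is Some y then Some y else firstsome f s' else None.

(** Depth-first extension of a partial map, one vertex at a time, the image of w
being chosen among the neighbours of an already placed neighbour of w.  Nothing
is proved about it: its results are certified by witnesses. *)
Fixpoint extend l1 l2 (ws : seq nat) (s : assignment) : option assignment :=
  if ws is w :: ws' then
    let bs := pmap (lookup s) (neighbours l1 w) in
    firstsome (fun b =>
      if b \in [seq a.2 | a <- s] then None else
      if all (fun c => b \in neighbours l2 c) bs then extend l1 l2 ws' ((w, b) :: s)
      else None)
      (if bs is c :: _ then neighbours l2 c else verts l2)
  else Some s.

(** Checks an assignment independently of the way it was found, so that only
this test has to be proved correct. *)
Definition witnesses l1 l2 (s : assignment) : bool :=
  all (fun a => consistent a s) s &&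
  all (fun p => if lookup s p.1 is Some a then
                  if lookup s p.2 is Some b then cadj l2 a b else false
                else false) l1.

Lemma lookupP s u a : lookup s u = Some a -> (u, a) \in s.
Proof.
rewrite /lookup; case E : [seq a <- s | a.1 == u] => [//|[x y] r] [<-].
have : (x, y) \in [seq a <- s | a.1 == u] by rewrite E mem_head.
by rewrite mem_filter /= => /andP[/eqP->].
Qed.

Lemma witnesses_emb l1 l2 s : witnesses l1 l2 s -> emb l1 (cadj l2).
Proof.
move=> /andP[/allP cs /allP hs].
have {}cs : coherent s.
  by move=> a b /cs/allP h bs; exact: (eqP (h b bs)).
have lk p : p \in l1 -> exists a b,
    [/\ lookup s p.1 = Some a, lookup s p.2 = Some b & cadj l2 a b].
  move=> /hs; case: (lookup s p.1) => // a; case: (lookup s p.2) => // b h.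
  by exists a, b.
exists (fun u => odflt 0 (lookup s u)); split.
  have vx u : u \in verts l1 -> exists a, lookup s u = Some a.
    by move=> /vertsP[p /lk[a [b [h1 h2 _]]]] /orP[] /eqP->; [exists a|exists b].
  move=> u v /vx[a ua] /vx[b vb]; rewrite ua vb /= => ab.
  have := cs _ _ (lookupP ua) (lookupP vb).
  by rewrite /= ab eqxx => /eqP.
by move=> p /lk[a [b [-> -> h]]].
Qed.

(** The cycle, with the closing edge first: pruned starts the search for it from
the edge just added to a graph. *)
Definition cyc n : ecode := (0, n.-1) :: [seq (i, i.+1) | i <- iota 0 n.-1].
Definition order l : nat := foldr (fun p m => maxn (maxn p.1.+1 p.2.+1) m) 0 l.
Definition norm u v : nat * nat := if u < v then (u, v) else (v, u).
Definition degree l v : nat := count (fun p => (p.1 == v) || (p.2 == v)) l.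
Definition leaf l : option nat := ohead [seq v <- verts l | degree l v == 1].

(** A new edge may be attached where a minimum-degree-two supergraph is bound to
have one: at a leaf if there is a leaf, otherwise anywhere.  Up to renaming, new
vertices are the first unused numbers. *)
Definition candidates l : seq (nat * nat) :=
  let m := order l in
  [seq p <- if leaf l is Some v then [seq norm v i | i <- iota 0 m.+1 & i != v]
            else rcons [seq (i, j) | j <- iota 0 m.+1, i <- iota 0 j] (m, m.+1)
  | p \notin l].

(** An even cycle shorter than k through the last edge of l; the other ones were
excluded at earlier levels. *)
Definition pruned k l : bool :=
  let: (a, b) := last (0, 0) l in
  anyb (fun c => if c < k then
    if extend (cyc c) l (iota 1 c.-2) [:: (c.-1, b); (0, a)] is Some s
    then witnesses (cyc c) l s else false else false) [:: 4; 6; 8].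

Definition degrees l : seq nat := sort leq [seq degree l v | v <- verts l].

Definition same l l' : bool :=
  if extend l l' (iota 0 (order l)) [::] is Some s then witnesses l l' s else false.

(** The degree sequence stored with a code spares most of the searches. *)
Fixpoint dedup (Q : seq ecode) (acc : seq (seq nat * ecode)) : seq ecode :=
  if Q is l :: Q' then
    let d := degrees l in
    if anyb (fun a => if d == a.1 then same a.2 l else false) acc
    then dedup Q' acc else dedup Q' ((d, l) :: acc)
  else [seq a.2 | a <- acc].

Definition extensions (Q : seq ecode) : seq ecode :=
  flatten [seq [seq rcons l p | p <- candidates l] | l <- Q].

Definition next k (Q : seq ecode) : seq ecode :=
  dedup [seq l <- extensions Q | ~~ pruned k l] [::].

Definition level k j : seq ecode := iter j (next k) [:: [:: (0, 1)]].

(** Codes with k edges and no leaf reached by adding edges one by one, a code being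
dropped when a shorter even cycle is found in it.  Duplicates are harmless at the
last level. *)
Definition finals k : seq ecode :=
  [seq l <- extensions (level k k.-2) | if leaf l == None then ~~ pruned k l else false].
End Codes.

(** * Generating the graphs of minimum degree two *)

Section GraphFacts.
Local Open Scope nat_scope.
Variable H : graph.
Local Notation V := 'I_(nverts H).
Implicit Types (a b : V).

Lemma adj_sym : symmetric (@adj H).
Proof. by move=> a b; rewrite /adj setUC. Qed.

Lemma adj_neq a b : adj a b -> a != b.
Proof.
move=> ab; have := forall_inP (edges2 H) _ ab.
by apply: contraTneq => ->; rewrite setUid cards1.
Qed.

Lemma edgesP (e : {set V}) : e \in edges H -> exists a b, e = [set a; b] /\ adj a b.
Proof.
move=> eH; have := forall_inP (edges2 H) _ eH => /cards2P[a [b [ab E]]].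
by exists a, b; rewrite /adj -E.
Qed.

Lemma set2_inj (T : finType) (a b c d : T) : [set a; b] = [set c; d] ->
  (a = c /\ b = d) \/ (a = d /\ b = c).
Proof.
move=> E.
have ha : a \in [set c; d] by rewrite -E set21.
have hb : b \in [set c; d] by rewrite -E set22.
have hc : c \in [set a; b] by rewrite E set21.
have hd : d \in [set a; b] by rewrite E set22.
move: ha hb hc hd; rewrite !inE.
case/orP => /eqP h1; case/orP => /eqP h2; case/orP => /eqP h3; case/orP => /eqP h4;
  subst; auto.
Qed.

Definition image_edges (rho : nat -> V) (l : ecode) : seq {set V} :=
  [seq [set rho p.1; rho p.2] | p <- l].

Lemma image_edges_inj (rho : nat -> V) l : wf l -> {in verts l &, injective rho} ->
  {in l &, injective (fun p : nat * nat => [set rho p.1; rho p.2])}.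
Proof.
move=> /andP[_ /allP ol] irho [u v] [x y] uv xy /=.
have [u1 v1] := (verts1 uv, verts2 uv); have [x1 y1] := (verts1 xy, verts2 xy).
move=> /set2_inj[[/irho h1 /irho h2]|[/irho h1 /irho h2]].
  by rewrite (h1 u1 x1) (h2 v1 y1).
have := ol _ uv; have := ol _ xy; rewrite /= (h1 u1 y1) (h2 v1 x1) => h3 h4.
by have := ltn_trans h3 h4; rewrite ltnn.
Qed.

Lemma image_edges_uniq (rho : nat -> V) l : wf l -> {in verts l &, injective rho} ->
  uniq (image_edges rho l).
Proof.
by move=> wl irho; rewrite (map_inj_in_uniq (image_edges_inj wl irho)); case/andP: wl.
Qed.

Lemma image_edges_sub (rho : nat -> V) l :
  (forall p, p \in l -> adj (rho p.1) (rho p.2)) -> {subset image_edges rho l <= edges H}.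
Proof. by move=> h _ /mapP[p pl ->]; exact: h. Qed.

Lemma image_edges_all (rho : nat -> V) l : wf l -> {in verts l &, injective rho} ->
  (forall p, p \in l -> adj (rho p.1) (rho p.2)) -> nedges H = size l ->
  forall e, e \in edges H -> e \in image_edges rho l.
Proof.
move=> wl irho hrho sl e eH.
have ui := image_edges_uniq wl irho.
have si := image_edges_sub hrho.
have : image_edges rho l =i edges H.
  apply: subset_cardP; last by apply/subsetP.
  by rewrite (card_uniqP ui) size_map -sl.
by move=> ->.
Qed.

Lemma order_lt l u : u \in verts l -> u < order l.
Proof.
elim: l => // p l IH; rewrite verts_cons /= !leq_max.
by case/or3P => [/eqP->|/eqP->|/IH->]; rewrite ?leqnn ?orbT.
Qed.

Lemma norm_lt u v : u != v -> (norm u v).1 < (norm u v).2.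
Proof. by rewrite /norm neq_ltn; case: ltnP. Qed.

Lemma candidates_lt l p : p \in candidates l -> p.1 < p.2.
Proof.
rewrite mem_filter => /andP[_]; case: (leaf l) => [v|].
  by move=> /mapP[i]; rewrite mem_filter => /andP[iv _] ->; apply: norm_lt; rewrite eq_sym.
rewrite mem_rcons inE => /predU1P[->//|] /allpairsPdep[j [i [_]]].
by rewrite mem_iota => /andP[_ ij] ->.
Qed.

Lemma candidates_wf l p : wf l -> p \in candidates l -> wf (rcons l p).
Proof.
move=> /andP[ul ol] pl; rewrite /wf rcons_uniq ul all_rcons ol (candidates_lt pl) andbT.
by move: pl; rewrite mem_filter => /andP[->].
Qed.

Lemma verts_rcons l p v :
  (v \in verts (rcons l p)) = [|| v == p.1, v == p.2 | v \in verts l].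
Proof.
rewrite -verts_cons; apply/vertsP/vertsP => -[q]; rewrite ?mem_rcons => ql h;
by exists q => //; rewrite ?mem_rcons.
Qed.

(** Adding an edge keeps the map injective when each end of the edge is an old
vertex or lies outside the image of the old ones. *)
Lemma emb_rcons l (rho : nat -> V) u v :
  {in verts l &, injective rho} -> (forall p, p \in l -> adj (rho p.1) (rho p.2)) ->
  adj (rho u) (rho v) ->
  (u \in verts l \/ forall w, w \in verts l -> rho w <> rho u) ->
  (v \in verts l \/ forall w, w \in verts l -> rho w <> rho v) ->
  emb (rcons l (norm u v)) (@adj H).
Proof.
move=> irho hrho uv hu hv; exists rho; split; last first.
  move=> p; rewrite mem_rcons inE => /predU1P[->|/hrho//].
  by rewrite /norm; case: ifP => _ //=; rewrite adj_sym.
have ruv := adj_neq uv.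
have E w : (w \in verts (rcons l (norm u v))) = [|| w == u, w == v | w \in verts l].
  by rewrite verts_rcons /norm; case: ifP => _ //=; rewrite orbCA.
have cu w : w \in verts l -> rho w = rho u -> w = u.
  by case: hu => [ul wl|h /h//]; exact: irho.
have cv w : w \in verts l -> rho w = rho v -> w = v.
  by case: hv => [vl wl|h /h//]; exact: irho.
move=> x y; rewrite !E => /or3P[/eqP->|/eqP->|xl] /or3P[/eqP->|/eqP->|yl] // h.
- by rewrite h eqxx in ruv.
- by rewrite (cu _ yl).
- by rewrite h eqxx in ruv.
- by rewrite (cv _ yl).
- exact: cu.
- exact: cv.
- exact: irho.
Qed.

Lemma not_image l (rho : nat -> V) u v :
  [set rho u; rho v] \notin image_edges rho l -> norm u v \notin l.
Proof.
apply: contra => uvl; apply/mapP; exists (norm u v) => //.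
by rewrite /norm; case: ifP => _ //=; rewrite setUC.
Qed.

(** Minimum degree two, isolated vertices being disregarded. *)
Definition noleaf : Prop := forall a b, adj a b -> exists2 c, adj a c & c != b.

(** In a host without leaf, the single known edge at a leaf of the code is not
the only edge of the host there: some further edge leaves its image. *)
Lemma leaf_edge l (rho : nat -> V) v : noleaf ->
  {in verts l &, injective rho} -> (forall p, p \in l -> adj (rho p.1) (rho p.2)) ->
  leaf l = Some v ->
  v \in verts l /\ exists2 w, adj (rho v) w & [set rho v; w] \notin image_edges rho l.
Proof.
move=> nl irho hrho hv.
have : v \in [seq v <- verts l | degree l v == 1].
  by move: hv; rewrite /leaf; case: (seq.filter _ _) => //= x s [->]; rewrite mem_head.
rewrite mem_filter => /andP[/eqP dv vl]; split => //.
move: dv; rewrite /degree -size_filter.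
set F := seq.filter _ l; case EF : F => [|q [|]]// _.
have inF p : p \in l -> (p.1 == v) || (p.2 == v) -> p = q.
  move=> pl pv; have : p \in F by rewrite mem_filter pv pl.
  by rewrite EF inE => /eqP.
have : q \in F by rewrite EF mem_head.
rewrite mem_filter => /andP[qv ql].
pose x := if q.1 == v then q.2 else q.1.
have vx : adj (rho v) (rho x).
  rewrite /x; move: (hrho _ ql) qv; case: eqP => [-> //|_ h /= /eqP <-].
  by rewrite adj_sym.
have qE : [set rho q.1; rho q.2] = [set rho v; rho x].
  rewrite /x; move: qv; case: eqP => [-> //|_ /= /eqP <-].
  by rewrite setUC.
have [w vw wx] := nl _ _ vx; exists w => //.
apply/negP => /mapP[p pl /set2_inj[[h1 h2]|[h1 h2]]].
  have /esym pv := irho _ _ vl (verts1 pl) h1.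
  have pq : p = q by apply: inF; rewrite ?pv ?eqxx.
  have : [set rho v; w] = [set rho v; rho x] by rewrite -qE -pq h1 h2.
  by move=> /set2_inj[[_ E]|[E1 E2]]; move: wx; rewrite ?E ?E2 ?E1 eqxx.
have /esym pv := irho _ _ vl (verts2 pl) h1.
have pq : p = q by apply: inF; rewrite ?pv ?eqxx ?orbT.
have : [set rho v; w] = [set rho v; rho x] by rewrite -qE -pq h1 h2 setUC.
by move=> /set2_inj[[_ E]|[E1 E2]]; move: wx; rewrite ?E ?E2 ?E1 eqxx.
Qed.

(** A partial copy of the graph can be enlarged by one of the candidate edges.
An end of the new edge that lies outside the copy receives a fresh number. *)
Lemma exists_candidate l : noleaf -> emb l (@adj H) -> size l < nedges H ->
  exists2 p, p \in candidates l & emb (rcons l p) (@adj H).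
Proof.
move=> nl [rho [irho hrho]] sl; pose m := order l.
have fresh w : w \in verts l -> (w < m) by exact: order_lt.
have mS : (m \in verts l) = false by apply/negP => /fresh; rewrite ltnn.
have mS1 : (m.+1 \in verts l) = false by apply/negP => /fresh; lia.
have old a : a \in [seq rho w | w <- verts l] \/ forall w, w \in verts l -> rho w <> a.
  case: (boolP (a \in [seq rho w | w <- verts l])) => [|h]; first by left.
  by right => w wl wa; move/negP: h; apply; rewrite -wa map_f.
pose upd (r : nat -> V) (i : nat) (c : V) := fun j => if j == i then c else r j.
have uE c x : x \in verts l -> upd rho m c x = rho x.
  by move=> xl; rewrite /upd; case: eqP => // xm; rewrite -xm xl in mS.
have new_end i d : i \in verts l -> adj (rho i) d -> (forall w, w \in verts l -> rho w <> d) ->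
    emb (rcons l (norm i m)) (@adj H).
  move=> il id hd; apply: (@emb_rcons l (upd rho m d)).
  - by move=> x y xl yl; rewrite !uE//; exact: irho.
  - by move=> p pl; rewrite !uE ?hrho ?verts1 ?verts2.
  - by rewrite uE// /upd eqxx.
  - by left.
  - by right => x xl; rewrite uE// /upd eqxx; exact: hd.
case hv : (leaf l) => [v|].
  have [vl [w vw nw]] := leaf_edge nl irho hrho hv.
  have inC i : i < m.+1 -> i != v -> norm v i \notin l -> norm v i \in candidates l.
    by move=> im iv nin; rewrite mem_filter nin hv map_f// mem_filter iv mem_iota.
  have [/mapP[i il wi]|ho] := old w.
    have iv : i != v by apply: contraTneq (adj_neq vw) => <-; rewrite wi eqxx.
    exists (norm v i).
      by apply: inC => //; [exact: ltnW (fresh _ il)|apply: (@not_image l rho); rewrite -wi].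
    by apply: (@emb_rcons l rho) => //; [rewrite -wi|left|left].
  have vm : m != v by apply: contraFneq mS => ->.
  exists (norm v m); last exact: (new_end v w vl vw ho).
  apply: inC => //; apply: contraFN mS => h; apply/vertsP; exists (norm v m) => //.
  by rewrite /norm; case: ifP; rewrite eqxx ?orbT.
have [e eH eN] : exists2 e, e \in edges H & e \notin image_edges rho l.
  apply/exists_inP; apply: contraTT sl; rewrite negb_exists_in -leqNgt => /forall_inP h.
  rewrite -(size_map (fun p => [set rho p.1; rho p.2])).
  apply: leq_trans (card_size _); apply: subset_leq_card; apply/subsetP => e /h.
  by rewrite negbK.
have [a [b [E ab]]] := edgesP eH; rewrite {}E in eN.
have inC i j : i < j -> j <= m -> (i, j) \notin l -> (i, j) \in candidates l.
  move=> ij jm nin; rewrite mem_filter nin hv mem_rcons inE; apply/orP; right.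
  by apply/allpairsPdep; exists j, i; rewrite !mem_iota; split.
have inM : (m, m.+1) \in candidates l.
  rewrite mem_filter hv mem_rcons mem_head andbT.
  by apply/negP => /verts1; rewrite mS.
have one c d i : adj c d -> (forall w, w \in verts l -> rho w <> d) -> i \in verts l -> c = rho i ->
    exists2 p, p \in candidates l & emb (rcons l p) (@adj H).
  move=> cd hd il ci; have im := fresh _ il; exists (norm i m); last first.
    by rewrite ci in cd; exact: (new_end _ _ il cd hd).
  rewrite /norm im; apply: inC => //.
  by apply/negP => /verts2; rewrite mS.
have [/mapP[i il ai]|ha] := old a; have [/mapP[j jl bj]|hb] := old b.
- exists (norm i j); last first.
    by apply: (@emb_rcons l rho) => //; [rewrite -ai -bj|left|left].
  have ij : i != j by apply: contraTneq (adj_neq ab) => ij; rewrite ai bj ij eqxx.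
  have := @not_image l rho i j; rewrite -ai -bj => /(_ eN).
  rewrite /norm; move: ij; rewrite neq_ltn; case: ltnP => /= [ij _|_ ji] h; apply: inC => //.
    exact: ltnW (fresh _ jl).
  exact: ltnW (fresh _ il).
- exact: (one a b i).
- by apply: (one b a j) => //; rewrite adj_sym.
- exists (m, m.+1) => //; have -> : (m, m.+1) = norm m m.+1 by rewrite /norm ltnSn.
  have uE2 x : x \in verts l -> upd (upd rho m a) m.+1 b x = rho x.
    move=> xl; rewrite {1}/upd; case: eqP => [xm|_]; last exact: uE.
    by rewrite -xm xl in mS1.
  have um : upd (upd rho m a) m.+1 b m = a by rewrite /upd eqn_leq ltnn andbF eqxx.
  have um1 : upd (upd rho m a) m.+1 b m.+1 = b by rewrite /upd eqxx.
  apply: (@emb_rcons l (upd (upd rho m a) m.+1 b)).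
  - by move=> x y xl yl; rewrite !uE2//; exact: irho.
  - by move=> p pl; rewrite !uE2 ?hrho ?verts1 ?verts2.
  - by rewrite um um1.
  - by right => x xl; rewrite uE2// um; exact: ha.
  - by right => x xl; rewrite uE2// um1; exact: hb.
Qed.

Lemma pruned_emb k l : pruned k l -> emb l (@adj H) ->
  exists2 c, c \in [seq c <- [:: 4; 6; 8] | c < k] & emb (cyc c) (@adj H).
Proof.
rewrite /pruned; case: (last _ _) => a b; rewrite anybE => /hasP[c c468].
case: ifP => // ck; case: (extend _ _ _ _) => // s /witnesses_emb h1 h2.
exists c; first by rewrite mem_filter ck.
exact: emb_trans adj_sym h1 h2.
Qed.

Lemma dedup_sub Q acc l : l \in dedup Q acc -> l \in Q ++ [seq q.2 | q <- acc].
Proof.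
elim: Q acc => //= x Q IH acc; case: ifP => _ /IH; rewrite inE !mem_cat.
  by move=> ->; rewrite orbT.
by rewrite /= inE; case/or3P => ->; rewrite ?orbT.
Qed.

Lemma dedup_acc Q acc l : l \in [seq q.2 | q <- acc] -> l \in dedup Q acc.
Proof.
elim: Q acc => //= x Q IH acc h; case: ifP => _; apply: IH => //.
by rewrite inE h orbT.
Qed.

(** Dropping codes that contain a kept one loses no graph, since the kept code
embeds wherever the dropped one does. *)
Lemma dedup_emb Q acc l : l \in Q -> emb l (@adj H) ->
  exists2 l', l' \in dedup Q acc & emb l' (@adj H).
Proof.
elim: Q acc => //= x Q IH acc; rewrite inE => /predU1P[->|lQ] h; last first.
  by case: ifP => _; exact: IH.
case: ifP => [|_]; last by exists x => //; apply: dedup_acc; rewrite mem_head.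
rewrite anybE => /hasP[[d l'] l'acc /=]; case: ifP => // _; rewrite /same.
case: (extend _ _ _ _) => // s /witnesses_emb h1.
exists l'; last exact: emb_trans adj_sym h1 h.
by apply: dedup_acc; apply/mapP; exists (d, l').
Qed.

Lemma extensionP Q l : noleaf -> l \in Q -> emb l (@adj H) -> wf l -> size l < nedges H ->
  exists l', [/\ l' \in extensions Q, emb l' (@adj H), wf l' & size l' = (size l).+1].
Proof.
move=> nl lQ hl wl sl; have [p pl hp] := exists_candidate nl hl sl.
exists (rcons l p); split => //; [|exact: candidates_wf|by rewrite size_rcons].
by apply/flatten_mapP; exists l => //; apply/mapP; exists p.
Qed.

Definition has_even_cycle k : Prop :=
  exists2 c, c \in [seq c <- [:: 4; 6; 8] | c < k] & emb (cyc c) (@adj H).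

Lemma extensions_wf Q n l : (forall l, l \in Q -> wf l /\ size l = n) ->
  l \in extensions Q -> wf l /\ size l = n.+1.
Proof.
move=> hQ /flatten_mapP[l1 /hQ[w1 s1] /mapP[p pl ->]].
by split; [exact: candidates_wf|rewrite size_rcons s1].
Qed.

Lemma level_wf k j l : l \in level k j -> wf l /\ size l = j.+1.
Proof.
elim: j l => [l|j IH l /dedup_sub]; first by rewrite inE => /eqP->.
by rewrite cats0 mem_filter => /andP[_]; exact: extensions_wf.
Qed.

(** A graph of minimum degree two is rebuilt edge by edge inside the levels,
unless a partial copy already contains a short even cycle. *)
Lemma levelP k j : noleaf -> nedges H = k -> j < k ->
  has_even_cycle k \/ exists2 l, l \in level k j & emb l (@adj H).
Proof.
move=> nl kH; elim: j => [|j IH] jk.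
  right; have /card_gt0P[e eH] : 0 < #|edges H| by rewrite -/(nedges H) kH.
  have [a [b [_ ab]]] := edgesP eH; exists [:: (0, 1)]; first by rewrite mem_head.
  exists (fun i => if i == 0 then a else b); split; last by move=> p; rewrite inE => /eqP->.
  move=> x y; rewrite !mem_undup !inE => /orP[] /eqP-> /orP[] /eqP-> //= h.
    by have := adj_neq ab; rewrite h eqxx.
  by have := adj_neq ab; rewrite h eqxx.
have [|[l lL hl]] := IH (ltnW jk); first by left.
have [wl sl] := level_wf lL.
have [|l1 [l1E h1 w1 s1]] := extensionP nl lL hl wl; first by rewrite sl kH.
case: (boolP (pruned k l1)) => [/pruned_emb/(_ h1)|np]; first by left.
right; apply: (dedup_emb _ _ h1).
by rewrite mem_filter np.
Qed.

(** The last edge leaves no leaf in the code: all edges of the host are then used,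
so leaf_edge would give one edge too many. *)
Lemma finalsP k : noleaf -> nedges H = k -> 1 < k ->
  has_even_cycle k \/ exists2 l, l \in finals k & emb l (@adj H).
Proof.
have jk : 1 < k -> k.-2 < k by lia.
move=> nl kH k1; have [|[l lL hl]] := levelP nl kH (jk k1); first by left.
have [wl sl] := level_wf lL.
have [|l1 [l1E h1 w1 s1]] := extensionP nl lL hl wl; first by rewrite sl kH; lia.
case: (boolP (pruned k l1)) => [/pruned_emb/(_ h1)|np]; first by left.
right; exists l1 => //; rewrite mem_filter l1E andbT.
have -> : leaf l1 = None; last by [].
case hv : (leaf l1) => [v|//]; have [rho [irho hrho]] := h1.
have [_ [w vw]] := leaf_edge nl irho hrho hv.
by rewrite (image_edges_all w1 irho hrho)//; rewrite s1 sl kH; lia.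
Qed.

End GraphFacts.

(** * Graphs represented by edge lists *)

Section Isomorphism.
Local Open Scope nat_scope.

Lemma nonisolatedP (G : graph) (u : 'I_(nverts G)) :
  reflect (exists v, adj u v) (u \in nonisolated G).
Proof. by rewrite inE; exact: existsP. Qed.

Lemma adj_nonisolated (G : graph) (u v : 'I_(nverts G)) : adj u v -> u \in nonisolated G.
Proof. by move=> uv; apply/nonisolatedP; exists v. Qed.

Section Represented.
Variables (G : graph) (l : ecode) (rho : nat -> 'I_(nverts G)).
Hypotheses (wl : wf l) (irho : {in verts l &, injective rho})
  (hrho : forall p, p \in l -> adj (rho p.1) (rho p.2)) (sl : nedges G = size l).

(** With as many edges as the code, the host has no edge outside the image. *)
Lemma adj_image u v : adj u v ->
  exists a b, [/\ a \in verts l, b \in verts l, cadj l a b & u = rho a /\ v = rho b].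
Proof.
move=> uv; have /mapP[p pl /set2_inj[[-> ->]|[-> ->]]] := image_edges_all wl irho hrho sl uv.
  by exists p.1, p.2; split; rewrite ?verts1 ?verts2// /cadj -surjective_pairing pl.
by exists p.2, p.1; split; rewrite ?verts1 ?verts2// /cadj -surjective_pairing pl orbT.
Qed.

Lemma cadj_adj a b : cadj l a b -> adj (rho a) (rho b).
Proof. by case/orP => /hrho //=; rewrite adj_sym. Qed.

Lemma verts_cadj a : a \in verts l -> exists b, cadj l a b.
Proof.
move=> /vertsP[p pl] /orP[] /eqP->.
  by exists p.2; rewrite /cadj -surjective_pairing pl.
by exists p.1; rewrite /cadj -surjective_pairing pl orbT.
Qed.

Lemma adj_rho a b : a \in verts l -> b \in verts l -> adj (rho a) (rho b) = cadj l a b.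
Proof.
move=> al bl; apply/idP/idP; last exact: cadj_adj.
by move=> /adj_image[c [d [cl dl cd [/irho h1 /irho h2]]]]; rewrite h1// h2.
Qed.

Definition pre u : nat := nth 0 (verts l) (find (fun a => rho a == u) (verts l)).

Lemma preP u : u \in nonisolated G -> pre u \in verts l /\ rho (pre u) = u.
Proof.
move=> /nonisolatedP[v /adj_image[a [_ [al _ _ [ua _]]]]].
have hu : has (fun a => rho a == u) (verts l) by apply/hasP; exists a => //; rewrite ua.
split; first by rewrite mem_nth// -has_find.
exact/eqP/(nth_find 0 hu).
Qed.

Lemma rho_nonisolated a : a \in verts l -> rho a \in nonisolated G.
Proof. by move=> /verts_cadj[b /cadj_adj]; exact: adj_nonisolated. Qed.

End Represented.

(** The code describes the graph up to isolated vertices: it embeds, and the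
edge counts agree. *)
Definition represents l (G : graph) : Prop := emb l (@adj G) /\ nedges G = size l.

Lemma represents_iso l G H : wf l -> represents l G -> represents l H -> iso G H.
Proof.
move=> wl [[r1 [i1 h1]] s1] [[r2 [i2 h2]] s2].
have P1 := preP wl i1 h1 s1; have P2 := preP wl i2 h2 s2.
have fP (u : {u | u \in nonisolated G}) : r2 (pre l r1 (val u)) \in nonisolated H.
  by apply: (rho_nonisolated h2); case: (P1 _ (valP u)).
pose g u : {v : 'I_(nverts H) | v \in nonisolated H} :=
  exist (fun v => v \in nonisolated H) _ (fP u).
apply/existsP; exists [ffun u => g u]; apply/and3P; split.
- apply/injectiveP => u v; rewrite !ffunE => /(congr1 val) /= E.
  have [pu ru] := P1 _ (valP u); have [pv rv] := P1 _ (valP v).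
  by apply: val_inj; rewrite -ru -rv (i2 _ _ pu pv E).
- apply/forallP => v; have [pv rv] := P2 _ (valP v).
  have uP := rho_nonisolated h1 pv.
  have [pu ru] := P1 _ uP.
  apply/codomP; exists (exist (fun u => u \in nonisolated G) _ uP); rewrite ffunE; apply: val_inj => /=.
  by rewrite -[LHS]rv (i1 _ _ pu pv ru).
- apply/forallP => u; apply/forallP => v; rewrite !ffunE /=.
  have [pu ru] := P1 _ (valP u); have [pv rv] := P1 _ (valP v).
  by rewrite -{1}ru -{1}rv (adj_rho wl i1 h1 s1)// (adj_rho wl i2 h2 s2).
Qed.

Lemma iso_emb l G H : l != [::] -> iso G H -> emb l (@adj G) -> emb l (@adj H).
Proof.
case: l => // p0 l0 _; set l := p0 :: l0.
move=> /existsP[f /and3P[/injectiveP fi _ /forallP fa]] [rho [irho hrho]].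
have rP a : a \in verts l -> rho a \in nonisolated G.
  move=> al; have [b ab] := verts_cadj al; exact: adj_nonisolated (cadj_adj hrho ab).
have p0l : p0.1 \in verts l by apply: verts1; rewrite mem_head.
pose d := exist (fun u => u \in nonisolated G) _ (rP _ p0l).
exists (fun a => val (f (insubd d (rho a)))); split.
  move=> a b al bl /val_inj/fi E; apply: irho => //.
  by have := congr1 val E; rewrite !val_insubd !rP.
move=> p pl; have /forallP/(_ (insubd d (rho p.2)))/eqP := fa (insubd d (rho p.1)).
by rewrite !val_insubd !rP ?verts1 ?verts2// => <-; exact: hrho.
Qed.

Lemma wf_subset_adj (G : graph) (A : {set {set 'I_(nverts G)}}) : A \subset edges G ->
  edges (subgraph A) = A.
Proof.
move=> AG; apply/setP => e; rewrite inE; case: (boolP (e \in A)) => //= eA.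
exact: (forall_inP (edges2 G) _ (subsetP AG _ eA)).
Qed.

Lemma subgraphsP k (G H : graph) : List.In H (subgraphs k G) ->
  exists A : {set {set 'I_(nverts G)}}, [/\ A \subset edges G, #|A| = k & H = subgraph A].
Proof.
rewrite /subgraphs; set s := enum _.
have : {subset s <= [set A : {set {set 'I_(nverts G)}} | (A \subset edges G) && (#|A| == k)]}.
  by move=> A; rewrite mem_enum.
elim: s => //= A s IH sub [<-|h].
  by have := sub A (mem_head _ _); rewrite inE => /andP[AG /eqP Ak]; exists A.
by apply: IH h => B Bs; apply: sub; rewrite inE Bs orbT.
Qed.

Lemma subgraphs_in k (G : graph) (A : {set {set 'I_(nverts G)}}) :
  A \subset edges G -> #|A| = k -> List.In (subgraph A) (subgraphs k G).
Proof.
move=> AG Ak; rewrite /subgraphs; set s := enum _.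
have : A \in s by rewrite mem_enum inE AG Ak eqxx.
by elim: s => //= B s IH; rewrite inE => /predU1P[->|/IH h]; [left|right].
Qed.

Lemma subgraph_nedges k G H : List.In H (subgraphs k G) -> nedges H = k.
Proof.
by move=> /subgraphsP[A [AG Ak ->]]; rewrite /nedges wf_subset_adj.
Qed.

Lemma emb_subgraph l k G H : List.In H (subgraphs k G) -> emb l (@adj H) -> emb l (@adj G).
Proof.
move=> /subgraphsP[A [AG Ak ->]] [rho [irho hrho]]; exists rho; split => // p /hrho.
rewrite /adj wf_subset_adj// => h; exact: (subsetP AG).
Qed.

Lemma emb_exists_subgraph l G : wf l -> emb l (@adj G) ->
  exists2 H, List.In H (subgraphs (size l) G) & emb l (@adj H).
Proof.
move=> wl [rho [irho hrho]].
pose A : {set {set 'I_(nverts G)}} := [set e in image_edges rho l].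
have AG : A \subset edges G.
  by apply/subsetP => e; rewrite inE; exact: image_edges_sub hrho e.
exists (subgraph A).
  apply: subgraphs_in => //; rewrite cardsE (card_uniqP (image_edges_uniq wl irho)).
  by rewrite size_map.
exists rho; split => // p pl; rewrite /adj wf_subset_adj// inE.
by apply/mapP; exists p.
Qed.
End Isomorphism.

(** * Edge lists of cycles, paths, unions and identifications *)

Section NamedGraphs.
Local Open Scope nat_scope.

(** An explicit list of the edges, on the numbers of the vertices themselves.
Loops and repetitions are allowed, which makes the codes of cycles, unions and
identifications plain formulas. *)
Definition coded (G : graph) (l : ecode) : Prop :=
  forall u v : 'I_(nverts G), adj u v = (u != v) && cadj l u v.

Lemma in_mkgraph n (A : {set {set 'I_n}}) (u v : 'I_n) :
  @adj (mkgraph A) u v = (u != v) && ([set u; v] \in A).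
Proof. by rewrite /adj inE andbC cards2; case: (u == v). Qed.

Lemma coded_Cycle n : coded (Cycle n) [seq (i, i.+1 %% n.-1.+1) | i <- iota 0 n.-1.+1].
Proof.
move=> u v; rewrite in_mkgraph; congr (_ && _).
apply/imsetP/idP => [[i _ /set2_inj[[-> ->]|[-> ->]]]|].
- by apply/orP; left; apply/mapP; exists (val i); rewrite ?mem_iota /= ?add0n ?ltn_ord.
- by apply/orP; right; apply/mapP; exists (val i); rewrite ?mem_iota /= ?add0n ?ltn_ord.
case/orP => /mapP[i]; rewrite mem_iota => /andP[_ hi] [ui vi].
  by exists u => //; congr [set _; _]; apply: val_inj; rewrite /= vi ui.
by exists v => //; rewrite setUC; congr [set _; _]; apply: val_inj; rewrite /= vi ui.
Qed.

Lemma coded_Path n : coded (Path n) [seq (i, i.+1) | i <- iota 0 n].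
Proof.
move=> u v; rewrite in_mkgraph; congr (_ && _).
apply/imsetP/idP => [[i _ /set2_inj[[-> ->]|[-> ->]]]|].
- by apply/orP; left; apply/mapP; exists (val i); rewrite ?mem_iota /= ?add0n ?ltn_ord // /bump add1n.
- by apply/orP; right; apply/mapP; exists (val i); rewrite ?mem_iota /= ?add0n ?ltn_ord // /bump add1n.
case/orP => /mapP[i]; rewrite mem_iota => /andP[_ hi] [ui vi].
  by exists (Ordinal (hi : i < n)) => //; congr [set _; _]; apply: val_inj.
by exists (Ordinal (hi : i < n)) => //; rewrite setUC; congr [set _; _]; apply: val_inj.
Qed.

Definition shift n (l : ecode) : ecode := [seq (p.1 + n, p.2 + n) | p <- l].

Definition below n (l : ecode) : bool := all (fun p => (p.1 < n) && (p.2 < n)) l.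

Lemma coded_edge G l (u v : 'I_(nverts G)) : coded G l ->
  ([set u; v] \in edges G) = (u != v) && cadj l u v.
Proof. by move=> <-. Qed.

Lemma imset_edge (T T' : finType) (f : T -> T') (A : {set {set T}}) (u v : T') :
  (forall e, e \in A -> #|e| = 2) ->
  ([set u; v] \in [set [set f w | w in (e : {set T})] | e in A]) <->
  exists a b, [/\ [set a; b] \in A, u = f a & v = f b].
Proof.
move=> A2; split.
  move=> /imsetP[e eA E]; have /eqP/cards2P[a [b [ab eE]]] := A2 _ eA.
  move: E; rewrite eE imsetU1 imset_set1 => /set2_inj[[-> ->]|[-> ->]].
    by exists a, b; rewrite -eE.
  by exists b, a; rewrite setUC -eE.
by move=> [a [b [eA -> ->]]]; apply/imsetP; exists [set a; b]; rewrite ?imsetU1 ?imset_set1.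
Qed.

Lemma edge2 G e : e \in edges G -> #|e| = 2.
Proof. by move=> eG; apply/eqP; exact: (forall_inP (edges2 G)). Qed.

Lemma coded_gunion G H l m : coded G l -> coded H m -> below (nverts G) l ->
  below (nverts H) m -> coded (gunion G H) (l ++ shift (nverts G) m).
Proof.
move=> cG cH bl bm u v; rewrite in_mkgraph; case uv : (u == v) => //=.
have cadj_cat : cadj (l ++ shift (nverts G) m) u v =
    cadj l u v || cadj (shift (nverts G) m) u v.
  by rewrite /cadj !mem_cat orbACA.
rewrite cadj_cat inE; apply/idP/idP.
  case/orP => /(imset_edge _ _ _ (@edge2 _)) [a [b [ab ua vb]]].
    move: ab; rewrite (coded_edge _ _ cG) => /andP[_ h].
    by rewrite ua vb /= h.
  move: ab; rewrite (coded_edge _ _ cH) => /andP[_ h]; apply/orP; right.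
  rewrite ua vb /=; move: h; rewrite /cadj => /orP[] h; apply/orP; [left|right];
    by apply/mapP; eexists; [exact: h|rewrite /= ![nverts G + _]addnC].
have below2 n (k : ecode) a b : below n k -> cadj k a b -> a < n /\ b < n.
  by move=> /allP bk /orP[] /bk /andP[].
case/orP => [h|h]; apply/orP; [left|right]; apply/(imset_edge _ _ _ (@edge2 _)).
  have [un vn] := below2 _ _ _ _ bl h.
  exists (Ordinal un), (Ordinal vn); split; [|exact: val_inj|exact: val_inj].
  by rewrite (coded_edge _ _ cG) h andbT -val_eqE /= val_eqE uv.
have [a [b [h' ua vb]]] : exists a b, [/\ cadj m a b, nat_of_ord u = nverts G + a & nat_of_ord v = nverts G + b].
  case/orP: h => /mapP[[a b] hm [-> ->]] /=.
    by exists a, b; rewrite /cadj hm ![_ + nverts G]addnC.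
  by exists b, a; rewrite /cadj hm ![_ + nverts G]addnC orbT.
have [un vn] := below2 _ _ _ _ bm h'.
exists (Ordinal un), (Ordinal vn); split; [|exact: val_inj|exact: val_inj].
rewrite (coded_edge _ _ cH) h' andbT -val_eqE /=.
by apply: contraFneq uv => ab; rewrite -val_eqE /= ua vb ab.
Qed.

Definition subst (v u : nat) (l : ecode) : ecode :=
  let f w := if w == v then u else w in [seq (f p.1, f p.2) | p <- l & p.1 != p.2].

Lemma coded_identify G (u v : 'I_(nverts G)) l : coded G l -> below (nverts G) l ->
  coded (@identify G u v) (subst v u l).
Proof.
move=> cG bl a b; rewrite in_mkgraph; congr (_ && _).
pose f (w : 'I_(nverts G)) := if w == v then u else w.
have fE w : nat_of_ord (f w) = if nat_of_ord w == v then nat_of_ord u else w.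
  by rewrite /f -val_eqE /=; case: ifP.
apply/idP/idP.
  move=> /(imset_edge _ _ _ (@edge2 _)) [c [d [cd -> ->]]].
  move: cd; rewrite (coded_edge _ _ cG) => /andP[cd h].
  case/orP: h => h; apply/orP; [left|right]; apply/mapP.
    exists (nat_of_ord c, nat_of_ord d); last by rewrite /= -!fE.
    by rewrite mem_filter h andbT.
  exists (nat_of_ord d, nat_of_ord c); last by rewrite /= -!fE.
  by rewrite mem_filter h andbT eq_sym.
move=> h; apply/(imset_edge _ _ _ (@edge2 _)).
have [c [d [cd cdl ac bd]]] : exists c d, [/\ c != d, cadj l c d,
    nat_of_ord a = (if c == v then nat_of_ord u else c) &
    nat_of_ord b = (if d == v then nat_of_ord u else d)].
  case/orP: h => /mapP[[c d]]; rewrite mem_filter /= => /andP[cd hl] [-> ->].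
    by exists c, d; rewrite /cadj hl.
  by exists d, c; rewrite /cadj hl orbT eq_sym.
have [cn dn] : c < nverts G /\ d < nverts G.
  by move/allP: bl => bl; case/orP: cdl => /bl /andP[].
exists (Ordinal cn), (Ordinal dn); split.
- by rewrite (coded_edge _ _ cG) cdl andbT -val_eqE.
- by apply: val_inj; rewrite /= ac; exact/esym/(fE (Ordinal cn)).
- by apply: val_inj; rewrite /= bd; exact/esym/(fE (Ordinal dn)).
Qed.

End NamedGraphs.

(** * The types of graphs with at most ten edges *)

Section Tables.
Local Open Scope nat_scope.

(** Puts the edges in the form required by wf, dropping loops. *)
Definition normcode (l : ecode) : ecode := [seq norm p.1 p.2 | p <- l & p.1 != p.2].

Lemma normP l p : p \in normcode l -> (p.1 != p.2) /\ cadj l p.1 p.2.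
Proof.
move=> /mapP[[a b]]; rewrite mem_filter /= => /andP[ab h] ->.
by rewrite /norm; case: ifP => _ /=; rewrite /cadj h ?orbT; split => //; rewrite eq_sym.
Qed.

Lemma coded_represents G l : coded G l -> below (nverts G) l -> wf (normcode l) ->
  normcode l != [::] -> represents (normcode l) G.
Proof.
move=> cG /allP bl wl l0.
have bn p : p \in normcode l -> p.1 < nverts G /\ p.2 < nverts G.
  by move=> /normP[_ /orP[] /bl /andP[]].
have [d _] : exists d : 'I_(nverts G), True.
  case: (normcode l) l0 bn => // p s _ /(_ p (mem_head _ _))[h _].
  by exists (Ordinal h).
pose rho a := insubd d a.
have rE a : a \in verts (normcode l) -> val (rho a) = a.
  by move=> /vertsP[p /bn[h1 h2]] /orP[] /eqP->; rewrite val_insubd ?h1 ?h2.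
have irho : {in verts (normcode l) &, injective rho}.
  by move=> a b al bl' /(congr1 val); rewrite !rE.
have hrho p : p \in normcode l -> adj (rho p.1) (rho p.2).
  move=> pl; have [p12 cp] := normP pl.
  by rewrite cG -val_eqE /= !rE ?verts1 ?verts2// p12.
split; first by exists rho.
rewrite -(size_map (fun p => [set rho p.1; rho p.2])) -(card_uniqP (image_edges_uniq wl irho)).
apply: eq_card => e; apply/idP/idP => [eG|]; last exact: (image_edges_sub hrho).
have [a [b [-> ab]]] := edgesP eG.
have := ab; rewrite cG => /andP[nab cab].
have nl : norm a b \in normcode l.
  apply/mapP; case/orP: cab => h.
    by exists (nat_of_ord a, nat_of_ord b); rewrite // mem_filter h andbT.
  exists (nat_of_ord b, nat_of_ord a); first by rewrite mem_filter h andbT /= eq_sym.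
  rewrite /norm /=; case: (ltngtP a b) => // E.
  by move: nab; rewrite -val_eqE /= E eqxx.
apply/mapP; exists (norm a b) => //.
have ra : rho a = a by apply: val_inj; rewrite val_insubd ltn_ord.
have rb : rho b = b by apply: val_inj; rewrite val_insubd ltn_ord.
by rewrite /norm; case: ifP => _ /=; rewrite ra rb // setUC.
Qed.

Definition chain (vs : seq nat) : ecode := [seq norm p.1 p.2 | p <- zip vs (behead vs)].
(** A closed walk through the listed vertices. *)
Definition closed_chain (vs : seq nat) : ecode := chain (rcons vs (head 0 vs)).

(** Codes of C_k, C_k o C_l, C_k u C_l and C_k o P_n o C_l. *)
Definition lC k : ecode := closed_chain (iota 0 k).
Definition lCC k l : ecode := closed_chain (iota 0 k) ++ closed_chain (0 :: iota k l.-1).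
Definition lCuC k l : ecode := closed_chain (iota 0 k) ++ closed_chain (iota k l).
Definition lCPC k n l : ecode :=
  closed_chain (iota 0 k) ++ chain (0 :: iota k n) ++ closed_chain (iota (k + n).-1 l).
(** Three triangles and one more edge: two triangles joined by the edge and a
separate one for T_1, a triangle joined to a bowtie at its centre for T_2 and at
another vertex for T_3. *)
Definition lT1 : ecode := lCuC 3 3 ++ (3, 6) :: closed_chain [:: 6; 7; 8].
Definition lT2 : ecode := lCC 3 3 ++ (0, 5) :: closed_chain [:: 5; 6; 7].
Definition lT3 : ecode := lCC 3 3 ++ (1, 5) :: closed_chain [:: 5; 6; 7].

Definition types4 := [:: lC 4].
Definition types6 := [:: lCC 3 3; lCuC 3 3; lC 6].
Definition types8 := [:: lCPC 3 2 3; lCC 3 5; lCuC 3 5; lC 8].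
Definition types10 := [:: lT3; lT2; lT1; lCPC 3 4 3; lCPC 3 2 5; lCC 3 7; lCuC 3 7;
  lCC 5 5; lCuC 5 5; lC 10].

(** Comparing the degree sequences first avoids most of the searches. *)
Definition classified k types : bool :=
  all (fun l => let d := degrees l in
    anyb (fun t => if degrees t == d then same t l else false) types) (finals k).

(** Codes of the same size that do not embed in one another represent no common
graph; this one-sided test is enough for lists of a given size. *)
Fixpoint incomparable (types : seq ecode) : bool :=
  if types is t :: r then all (fun t' => ~~ embedsb t t') r && incomparable r else true.

(** Checked by computation: in the absence of shorter even cycles the list of
types is complete. *)
Lemma classified4 : classified 4 types4. Proof. by vm_compute. Qed.
Lemma classified6 : classified 6 types6. Proof. by vm_compute. Qed.
Lemma classified8 : classified 8 types8. Proof. by vm_compute. Qed.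
Lemma classified10 : classified 10 types10. Proof. by vm_compute. Qed.
Lemma incomparableP types t t' (H : graph) : incomparable types -> all wf types ->
  t \in types -> t' \in types -> represents t H -> represents t' H -> t = t'.
Proof.
have main a b : wf b -> represents a H -> represents b H -> emb a (cadj b).
  move=> wb [[r1 [i1 h1]] s1] [[r2 [i2 h2]] s2].
  have P2 := preP wb i2 h2 s2.
  have nr u : u \in verts a -> r1 u \in nonisolated H.
    by move=> /verts_cadj[w /(cadj_adj h1)]; exact: adj_nonisolated.
  exists (fun u => pre b r2 (r1 u)); split.
    move=> u v ua va E; apply: i1 => //.
    by rewrite -(P2 _ (nr _ ua)).2 -(P2 _ (nr _ va)).2 E.
  move=> p pa; have [p1 e1] := P2 _ (nr _ (verts1 pa)); have [p2 e2] := P2 _ (nr _ (verts2 pa)).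
  by rewrite -(adj_rho wb i2 h2 s2)// e1 e2; exact: h1.
elim: types => //= x r IH /andP[/allP nx ir] /andP[wx wr].
rewrite !inE => /predU1P[->|tr] /predU1P[->|tr'] // h h'.
- by have := nx _ tr'; rewrite (emb_embedsb (main _ _ (allP wr _ tr') h h')).
- by have := nx _ tr; rewrite (emb_embedsb (main _ _ (allP wr _ tr) h' h)).
- exact: IH.
Qed.

Lemma classifiedP k types (H : graph) : classified k types ->
  all (fun t => size t == k) types ->
  1 < k -> noleaf H -> nedges H = k ->
  has_even_cycle H k \/ exists2 t, t \in types & represents t H.
Proof.
move=> /allP cl /allP st k1 nl kH.
have [|[l lf hl]] := finalsP nl kH k1; first by left.
right; have := cl _ lf; rewrite /= anybE => /hasP[t tt].
case: ifP => // _; rewrite /same; case: (extend _ _ _ _) => // s /witnesses_emb h.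
exists t => //; split; last by rewrite kH (eqP (st _ tt)).
exact: emb_trans (@adj_sym H) h hl.
Qed.

(** The raw code of a construction and the chosen code of the same size are
matched by a certified search. *)
Lemma represents_coded G raw l : coded G raw -> below (nverts G) raw -> wf (normcode raw) ->
  normcode raw != [::] -> same l (normcode raw) -> size l == size (normcode raw) ->
  represents l G.
Proof.
move=> cG bl wl l0 sm /eqP sz; have [h s] := coded_represents cG bl wl l0.
split; last by rewrite s sz.
move: sm; rewrite /same; case: (extend _ _ _ _) => // s' /witnesses_emb h'.
exact: emb_trans (@adj_sym G) h' h.
Qed.

Definition rawC n : ecode := [seq (i, i.+1 %% n.-1.+1) | i <- iota 0 n.-1.+1].
Definition rawP n : ecode := [seq (i, i.+1) | i <- iota 0 n].

Lemma coded_glue G u H v l m : coded G l -> coded H m -> below (nverts G) l ->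
  below (nverts H) m ->
  coded (@glue G u H v) (subst (nverts G + v) u (l ++ shift (nverts G) m)).
Proof.
move=> cG cH bl bm.
apply: (@coded_identify (gunion G H)); first exact: coded_gunion.
rewrite /below all_cat; apply/andP; split; apply/allP => p.
  by move=> /(allP bl)/andP[h1 h2]; rewrite /= !ltn_addr.
by move=> /mapP[q /(allP bm)/andP[h1 h2] ->] /=; rewrite ![_ + nverts G]addnC !ltn_add2l h1.
Qed.

Lemma below_rawC n : below n.-1.+1 (rawC n).
Proof.
apply/allP => p /mapP[i]; rewrite mem_iota => /andP[_ hi] -> /=.
by rewrite -[X in i < X]add0n hi ltn_mod.
Qed.

Lemma below_rawP n : below n.+1 (rawP n).
Proof.
by apply/allP => p /mapP[i]; rewrite mem_iota => /andP[_ hi] -> /=; lia.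
Qed.

Lemma below_glue n m u v (l k : ecode) : u < n -> below n l -> below m k ->
  below (n + m) (subst (n + v) u (l ++ shift n k)).
Proof.
move=> un /allP bl /allP bk; apply/allP => p /mapP[q].
rewrite mem_filter mem_cat => /andP[_ hq] ->.
have [h1 h2] : q.1 < n + m /\ q.2 < n + m.
  case/orP: hq => [/bl/andP[h1 h2]|/mapP[q' /bk/andP[h1 h2] ->] /=].
    by rewrite !ltn_addr.
  by rewrite ![_ + n]addnC !ltn_add2l.
have un' : u < n + m by rewrite ltn_addr.
by rewrite /=; case: ifP => _; case: ifP => _; rewrite ?h1 ?h2 ?un'.
Qed.

Definition rawCC k l : ecode := subst (k.-1.+1 + 0) 0 (rawC k ++ shift k.-1.+1 (rawC l)).

Lemma coded_CC k l : coded (CC k l) (rawCC k l).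
Proof.
exact: (@coded_glue (Cycle k) ord0 (Cycle l) ord0 _ _ (@coded_Cycle k) (@coded_Cycle l)
  (below_rawC k) (below_rawC l)).
Qed.

Lemma below_rawCC k l : below (nverts (CC k l)) (rawCC k l).
Proof. exact: (@below_glue k.-1.+1 l.-1.+1 0 0 _ _ isT (below_rawC k) (below_rawC l)). Qed.

Definition rawCuC k l : ecode := rawC k ++ shift k.-1.+1 (rawC l).

Lemma coded_CuC k l : coded (gunion (Cycle k) (Cycle l)) (rawCuC k l).
Proof.
exact: (@coded_gunion (Cycle k) (Cycle l) _ _ (@coded_Cycle k) (@coded_Cycle l)
  (below_rawC k) (below_rawC l)).
Qed.

Lemma below_rawCuC k l : below (nverts (gunion (Cycle k) (Cycle l))) (rawCuC k l).
Proof.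
rewrite /below all_cat; apply/andP; split; apply/allP => p.
  by move=> /(allP (below_rawC k))/andP[h1 h2]; rewrite /= !ltn_addr.
move=> /mapP[q /(allP (below_rawC l))/andP[h1 h2] ->] /=.
by rewrite ![_ + k.-1.+1]addnC !ltn_add2l h1.
Qed.

Definition rawCPC k n l : ecode :=
  subst (k.-1.+1 + n.+1 + 0) (k.-1.+1 + n)
    (subst (k.-1.+1 + 0) 0 (rawC k ++ shift k.-1.+1 (rawP n))
     ++ shift (k.-1.+1 + n.+1) (rawC l)).

Lemma coded_CPC k n l : coded (CPC k n l) (rawCPC k n l).
Proof.
have h1 := @coded_glue (Cycle k) ord0 (Path n) ord0 _ _ (@coded_Cycle k) (@coded_Path n)
  (below_rawC k) (below_rawP n).
have h2 := @below_glue k.-1.+1 n.+1 0 0 _ _ isT (below_rawC k) (below_rawP n).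
exact: (@coded_glue (@glue (Cycle k) ord0 (Path n) ord0)
  (rshift (nverts (Cycle k)) (ord_max : 'I_n.+1)) (Cycle l) ord0 _ _ h1 (@coded_Cycle l) h2 (below_rawC l)).
Qed.

Lemma below_rawCPC k n l : below (nverts (CPC k n l)) (rawCPC k n l).
Proof.
have h2 := @below_glue k.-1.+1 n.+1 0 0 _ _ isT (below_rawC k) (below_rawP n).
by apply: (@below_glue (k.-1.+1 + n.+1) l.-1.+1 (k.-1.+1 + n) 0 _ _ _ h2 (below_rawC l));
  rewrite ltn_add2l.
Qed.

Lemma represents_C n : n \in [:: 4; 6; 8; 10] -> represents (lC n) (Cycle n).
Proof.
by rewrite !inE => /or4P[] /eqP->;
  apply: (represents_coded (@coded_Cycle _) (below_rawC _)); vm_compute.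
Qed.

Definition lP2 : ecode := [:: (0, 1); (1, 2)].
Definition lK2K2 : ecode := [:: (0, 1); (2, 3)].

Lemma represents_P2 : represents lP2 (Path 2).
Proof. by apply: (represents_coded (@coded_Path _) (below_rawP _)); vm_compute. Qed.

Lemma represents_CC k l : (k, l) \in [:: (3, 3); (3, 5); (3, 7); (5, 5)] ->
  represents (lCC k l) (CC k l).
Proof.
by rewrite !inE => /or4P[] /eqP[-> ->];
  apply: (represents_coded (@coded_CC _ _) (below_rawCC _ _)); vm_compute.
Qed.

Lemma represents_CuC k l : (k, l) \in [:: (3, 3); (3, 5); (3, 7); (5, 5)] ->
  represents (lCuC k l) (gunion (Cycle k) (Cycle l)).
Proof.
by rewrite !inE => /or4P[] /eqP[-> ->];
  apply: (represents_coded (@coded_CuC _ _) (below_rawCuC _ _)); vm_compute.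
Qed.

Lemma represents_CPC k n l : (k, n, l) \in [:: (3, 2, 3); (3, 2, 5); (3, 4, 3)] ->
  represents (lCPC k n l) (CPC k n l).
Proof.
by rewrite !inE => /or3P[] /eqP[-> -> ->];
  apply: (represents_coded (@coded_CPC _ _ _) (below_rawCPC _ _ _)); vm_compute.
Qed.

Lemma two_edges (H : graph) : nedges H = 2 -> represents lP2 H \/ represents lK2K2 H.
Proof.
move=> H2; have /eqP/cards2P[e1 [e2 [e12 E]]] := H2.
have e1H : e1 \in edges H by rewrite E set21.
have e2H : e2 \in edges H by rewrite E set22.
have ends x e : e \in edges H -> x \in e -> exists2 y, e = [set x; y] & adj x y.
  move=> eH; have [u [v [-> uv]]] := edgesP eH; rewrite !inE => /orP[] /eqP->.
    by exists v.
  by exists u; rewrite 1?setUC 1?adj_sym.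
case: (set_0Vmem (e1 :&: e2)) => [dis|[b bI]]; [right|left].
  have [a [b [e1E ab]]] := edgesP e1H; have [c [d [e2E cd]]] := edgesP e2H.
  have ne x y : x \in e1 -> y \in e2 -> x != y.
    move=> x1 y2; apply/eqP => xy; have := in_set0 x.
    by rewrite -dis inE x1 xy y2.
  have un : uniq [:: a; b; c; d].
    by rewrite /= !inE !negb_or (adj_neq ab) (adj_neq cd) !ne// ?e1E ?e2E ?set21 ?set22.
  split => //; exists (fun i => nth a [:: a; b; c; d] i).
  split; last by move=> p; rewrite !inE => /orP[] /eqP->.
  have lt z : z \in verts lK2K2 -> z < size [:: a; b; c; d].
    by rewrite !mem_undup !inE => /or4P[] /eqP->.
  by move=> x y /lt xl /lt yl /eqP; rewrite nth_uniq// => /eqP.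
move: bI; rewrite inE => /andP[/(ends _ _ e1H)[a e1E ba] /(ends _ _ e2H)[c e2E bc]].
have ac : a != c by apply: contraNneq e12 => h; rewrite e1E e2E h.
have un : uniq [:: a; b; c].
  by rewrite /= !inE !negb_or ac (adj_neq bc) eq_sym (adj_neq ba).
split => //; exists (fun i => nth a [:: a; b; c] i).
split; last by move=> p; rewrite !inE => /orP[] /eqP->; rewrite //= adj_sym.
have lt z : z \in verts lP2 -> z < size [:: a; b; c].
  by rewrite !mem_undup !inE => /or4P[] /eqP->.
by move=> x y /lt xl /lt yl /eqP; rewrite nth_uniq// => /eqP.
Qed.

End Tables.

(** * Counting intermediate subgraphs *)

Section Subdecks.
Local Open Scope nat_scope.

(** A set between A and E is the union of A and a subset of the difference. *)
Lemma card_between (T : finType) (A E : {set T}) k m : A \subset E -> #|A| = k ->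
  k <= m ->
  #|[set B : {set T} | [&& A \subset B, B \subset E & #|B| == m]]| = 'C(#|E| - k, m - k).
Proof.
move=> AE Ak km.
have -> : #|E| - k = #|E :\: A| by rewrite cardsD (setIidPr AE) Ak.
rewrite -(cards_draws (E :\: A)) -[RHS](card_in_imset (f := fun C => A :|: C)).
  apply: eq_card => B; rewrite !inE; apply/idP/imsetP.
    move=> /and3P[AB BE /eqP Bm]; exists (B :\: A); last by rewrite setDE setUIr setUCr setIT; apply/esym/setUidPr.
    by rewrite inE setSD//= cardsD (setIidPr AB) Bm Ak eqxx.
  move=> [C]; rewrite inE => /andP[CE /eqP Cm] ->.
  have dAC : [disjoint A & C].
    by rewrite disjoint_sym; move: CE; rewrite subsetD => /andP[].
  rewrite subsetUl subUset AE (subset_trans CE (subsetDl _ _)) /= cardsU.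
  by move: dAC; rewrite -setI_eq0 => /eqP->; rewrite cards0 subn0 Ak Cm subnKC.
move=> C1 C2; rewrite !inE !subsetD => /andP[/andP[_ d1] _] /andP[/andP[_ d2] _] E12.
have cap (C : {set T}) : [disjoint C & A] -> (A :|: C) :\: A = C.
  by move=> d; rewrite setDUl setDv set0U; apply/setDidPl.
by rewrite -(cap _ d1) -(cap _ d2) E12.
Qed.

End Subdecks.

From mathcomp Require Import all_classical all_reals all_analysis.
From mathcomp Require Import measurable_realfun measure.
From mathcomp Require Import ring lra.
Import Order.TTheory GRing.Theory Num.Theory.
Import numFieldNormedType.Exports.

(** * Averages of bounded measurable functions *)

Section Integration.
Local Open Scope classical_set_scope.
Local Open Scope ring_scope.

Section BoundedMeasurable.
Context d (T : measurableType d) (R : realType).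
Implicit Types f g : T -> R.

(** Bounded measurable functions are integrable for every probability and closed
under products and averaging, so no integrability condition is left to check
later on. *)
Definition bddmeas f : Prop :=
  measurable_fun [set: T] f /\ exists M, forall x, `|f x| <= M.

Lemma bddmeas_integrable (mu : {measure set T -> \bar R}) (D : set T) f :
  measurable D -> (mu D < +oo)%E -> bddmeas f -> mu.-integrable D (EFin \o f).
Proof.
move=> mD muoo [mf [M fM]].
have mfD : measurable_fun D (EFin \o f) by apply/measurable_EFinP; exact: measurable_funTS.
apply/integrableP; split => //.
apply: (@le_lt_trans _ _ (\int[mu]_(x in D) (cst `|M|%:E x))%E).
  apply: ge0_le_integral => //; first exact: measurableT_comp.
  by move=> x _ /=; rewrite lee_fin (le_trans (fM x))// ler_norm.
by rewrite integral_cst// lte_mul_pinfty.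
Qed.

Lemma bddmeas_cst c : bddmeas (fun=> c).
Proof. by split => //; exists `|c|. Qed.

Lemma bddmeasD f g : bddmeas f -> bddmeas g -> bddmeas (fun x => f x + g x).
Proof.
move=> [mf [M fM]] [mg [N gN]]; split; first exact: measurable_funD.
exists (M + N) => x; rewrite (le_trans (ler_normD _ _))//.
by rewrite lerD.
Qed.

Lemma bddmeasM f g : bddmeas f -> bddmeas g -> bddmeas (fun x => f x * g x).
Proof.
move=> [mf [M fM]] [mg [N gN]]; split; first exact: measurable_funM.
by exists (M * N) => x; rewrite normrM ler_pM.
Qed.

End BoundedMeasurable.

Lemma bddmeas_comp d d' (T : measurableType d) (S : measurableType d')
    (R : realType) (h : S -> T) (f : T -> R) :
  measurable_fun [set: S] h -> bddmeas f -> bddmeas (f \o h).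
Proof.
move=> mh [mf [M fM]]; split; first exact: measurableT_comp.
by exists M => x; exact: fM.
Qed.

Section Expectation.
Context d (T : measurableType d) (R : realType) (P : probability T R).
Implicit Types f g : T -> R.

Definition mean f : R := \int[P]_s f s.

Lemma prob_integrable f : bddmeas f -> P.-integrable setT (EFin \o f).
Proof. by apply: bddmeas_integrable; rewrite //= probability_setT ltry. Qed.

Lemma meanD f g : bddmeas f -> bddmeas g ->
  mean (fun s => f s + g s) = mean f + mean g.
Proof.
by move=> bf bg; apply: RintegralD => //; exact: prob_integrable.
Qed.

Lemma meanZ c f : bddmeas f -> mean (fun s => c * f s) = c * mean f.
Proof. by move=> bf; apply: RintegralZl => //; exact: prob_integrable. Qed.

Lemma mean_cst c : mean (fun=> c) = c.
Proof. by rewrite /mean Rintegral_cst//= probability_setT mulr1. Qed.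

Lemma mean_ge0 f : (forall x, 0 <= f x) -> 0 <= mean f.
Proof. by move=> f0; apply: Rintegral_ge0. Qed.

Lemma EFin_mean f : bddmeas f -> (mean f)%:E = (\int[P]_s (f s)%:E)%E.
Proof.
move=> bf; rewrite /mean /Rintegral fineK//.
exact: integrable_fin_num (prob_integrable bf).
Qed.

Lemma mean_bound f M : (forall x, `|f x| <= M) -> bddmeas f -> `|mean f| <= M.
Proof.
move=> fM bf; apply: le_trans (le_normr_Rintegral _ _) _ => //.
  exact: prob_integrable.
rewrite -[leRHS](mean_cst M); apply: le_Rintegral => //.
- apply: (@prob_integrable (fun x => `|f x|)).
  case: bf => mf [N fN]; split; first exact: measurableT_comp.
  by exists N => x; rewrite normr_id.
- exact: finite_measure_integrable_cst.
Qed.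

End Expectation.

Section Fubini1.
Context d (T : measurableType d) (R : realType) (P : probability T R).

Lemma bddmeas_mean d' (S : measurableType d') (f : S * T -> R) :
  bddmeas f -> bddmeas (fun s => mean P (fun t => f (s, t))).
Proof.
move=> bf; have [mf [M fM]] := bf.
have bfs s : bddmeas (fun t => f (s, t)).
  by apply: (bddmeas_comp _ bf); exact: measurable_pair1.
split; last by exists M => s; apply: mean_bound.
apply/measurable_EFinP.
rewrite (_ : _ \o _ = fun s => (\int[P]_t (f (s, t))%:E)%E); last first.
  by apply/funext => s /=; rewrite EFin_mean.
have mp : measurable_fun setT ((EFin \o f) ^\+)%E.
  by apply: measurable_funepos; exact/measurable_EFinP.
have mn : measurable_fun setT ((EFin \o f) ^\-)%E.
  by apply: measurable_funeneg; exact/measurable_EFinP.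
rewrite (_ : (fun s => _) = ((fun s => \int[P]_t (EFin \o f)^\+ (s, t))
   \- (fun s => \int[P]_t (EFin \o f)^\- (s, t)))%E); last first.
  apply/funext => s; rewrite [LHS]integralE.
  congr (_ - _)%E; apply: eq_integral => t _.
    by rewrite !funeposE.
  by rewrite !funenegE.
apply: emeasurable_funB.
  by apply: measurable_fun_fubini_tonelli_F.
by apply: measurable_fun_fubini_tonelli_F.
Qed.

End Fubini1.

Section Fubini2.
Context d (T : measurableType d) (R : realType) (P : probability T R).

Lemma bddmeas_mean2 d' (S : measurableType d') (Q : probability S R)
    (f : S * T -> R) :
  bddmeas f -> bddmeas (fun t => mean Q (fun s => f (s, t))).
Proof.
move=> bf; apply: (@bddmeas_mean _ _ _ Q _ _ (fun z : T * S => f (z.2, z.1))).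
apply: (bddmeas_comp (h := fun z : T * S => (z.2, z.1)) _ bf).
by apply/measurable_fun_pair => /=; [exact: measurable_snd|exact: measurable_fst].
Qed.

Lemma prod_integrable d' (S : measurableType d') (Q : probability S R)
    (f : S * T -> R) : bddmeas f -> (Q \x P)%E.-integrable setT (EFin \o f).
Proof.
apply: bddmeas_integrable => //.
have E : (Q \x P)%E (setT `*` setT) = 1%E.
  by rewrite product_measure1E//= !probability_setT mule1.
by apply: (@le_lt_trans _ _ 1%E); rewrite ?ltry// -E setXTT.
Qed.

Lemma mean_fubini d' (S : measurableType d') (Q : probability S R)
    (f : S * T -> R) :
  bddmeas f -> mean Q (fun s => mean P (fun t => f (s, t))) =
               mean P (fun t => mean Q (fun s => f (s, t))).
Proof.
move=> bf; apply: EFin_inj; rewrite !EFin_mean.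
- under eq_integral => s _.
    rewrite EFin_mean; last exact: (bddmeas_comp (measurable_pair1 s) bf).
    over.
  under [RHS]eq_integral => t _.
    rewrite EFin_mean; last exact: (bddmeas_comp (measurable_pair2 t) bf).
    over.
  apply: (@Fubini _ _ _ _ _ Q P (EFin \o f)).
  exact: prod_integrable.
- exact: bddmeas_mean2.
- exact: bddmeas_mean.
Qed.

End Fubini2.

Section Coordinates.
Context d (T : measurableType d) (R : realType) (P : probability T R).
Implicit Types (x : nat -> T) (f g : (nat -> T) -> R).

Definition upd x i s : nat -> T := fun j => if j == i then s else x j.

(** Boundedness and measurability are tested along measurable families of points.
This avoids a measure on an infinite
product and is stable under averaging one coordinate. *)
Definition good f : Prop := forall d' (S : measurableType d') (phi : S -> nat -> T),
  (forall i, measurable_fun [set: S] (phi ^~ i)) -> bddmeas (f \o phi).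

(** Averaging over one coordinate; a homomorphism density is the result of
averaging over all vertices, in any order. *)
Definition avg i f : (nat -> T) -> R := fun x => mean P (fun s => f (upd x i s)).

Definition avgs (vs : seq nat) f := foldr avg f vs.

Lemma good_cst c : good (fun=> c).
Proof. by move=> d' S phi mphi; exact: bddmeas_cst. Qed.

Lemma goodD f g : good f -> good g -> good (fun x => f x + g x).
Proof. by move=> gf gg d' S phi mphi; apply: bddmeasD; [exact: gf|exact: gg]. Qed.

Lemma goodM f g : good f -> good g -> good (fun x => f x * g x).
Proof. by move=> gf gg d' S phi mphi; apply: bddmeasM; [exact: gf|exact: gg]. Qed.

Lemma good_prod (I : Type) (r : seq I) (p : pred I) (F : I -> (nat -> T) -> R) :
  (forall i, good (F i)) -> good (fun x => \prod_(i <- r | p i) F i x).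
Proof.
move=> gF; elim: r => [|i r IH].
  by rewrite (_ : (fun x => _) = fun=> 1); [exact: good_cst|apply/funext => x; rewrite big_nil].
rewrite (_ : (fun x => _) = fun x => (if p i then F i x else 1) * \prod_(i <- r | p i) F i x).
  by apply: goodM => //; case: (p i) => //; exact: good_cst.
by apply/funext => x; rewrite big_cons; case: ifP; rewrite ?mul1r.
Qed.

Lemma good_coord1 (h : T -> R) i : bddmeas h -> good (fun x => h (x i)).
Proof.
move=> bh d' S phi mphi; exact: (bddmeas_comp (mphi i) bh).
Qed.

Lemma good_coord2 (h : T * T -> R) i j : bddmeas h -> good (fun x => h (x i, x j)).
Proof.
move=> bh d' S phi mphi.
apply: (bddmeas_comp (h := fun s => (phi s i, phi s j)) _ bh).
exact/measurable_fun_pair.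
Qed.

Lemma good_reindex f (r : nat -> nat) : good f -> good (fun x => f (x \o r)).
Proof. by move=> gf d' S phi mphi; apply: (gf _ _ (fun s => phi s \o r)) => i; exact: mphi. Qed.

Lemma good_avg i f : good f -> good (avg i f).
Proof.
move=> gf d' S phi mphi.
apply: (@bddmeas_mean _ _ _ P _ _ (fun z : S * T => f (upd (phi z.1) i z.2))).
apply: (gf _ _ (fun z : S * T => upd (phi z.1) i z.2)) => j.
rewrite /upd; case: eqP => _; first exact: measurable_snd.
by apply: (measurableT_comp (mphi j)); exact: measurable_fst.
Qed.

Lemma good_avgs vs f : good f -> good (avgs vs f).
Proof. by move=> gf; elim: vs => //= v vs; exact: good_avg. Qed.

Lemma good_upd2 x i j f : good f -> bddmeas (fun z : T * T => f (upd (upd x i z.1) j z.2)).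
Proof.
move=> gf; apply: (gf _ _ (fun z : T * T => upd (upd x i z.1) j z.2)) => k.
rewrite /upd; case: eqP => _; first exact: measurable_snd.
by case: eqP => _; [exact: measurable_fst|exact: measurable_cst].
Qed.

Lemma good_upd x i f : good f -> bddmeas (fun s => f (upd x i s)).
Proof.
move=> gf; apply: (gf _ _ (fun s => upd x i s)) => k.
by rewrite /upd; case: eqP => _; [exact: measurable_id|exact: measurable_cst].
Qed.

Lemma updC x i j s t : i != j -> upd (upd x i s) j t = upd (upd x j t) i s.
Proof.
move=> ij; apply/funext => k; rewrite /upd.
by case: (k =P j) => [->|//]; rewrite eq_sym (negbTE ij).
Qed.

Lemma avgC i j f : good f -> avg i (avg j f) = avg j (avg i f).
Proof.
move=> gf; have [->//|ij] := eqVneq i j; apply/funext => x; rewrite /avg.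
rewrite (@mean_fubini _ _ _ P _ _ P (fun z : T * T => f (upd (upd x i z.1) j z.2))).
  by congr mean; apply/funext => t; congr mean; apply/funext => s /=; rewrite updC.
exact: good_upd2.
Qed.

Lemma perm_avgs vs ws f : good f -> perm_eq vs ws -> avgs vs f = avgs ws f.
Proof.
move=> gf; elim: vs ws => [|v vs IH] ws; first by rewrite perm_sym => /perm_nilP->.
move=> pvw; have vw : v \in ws by rewrite -(perm_mem pvw) mem_head.
case/splitPr: vw pvw => ws1 ws2 pvw.
have {}pvw : perm_eq vs (ws1 ++ ws2).
  by rewrite -(perm_cons v) (perm_trans pvw)// perm_catC/= perm_cons perm_catC.
rewrite /= (IH _ pvw) /avgs !foldr_cat /= -!/(avgs _ _).
elim: ws1 {pvw} => //= w ws1 <-.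
by rewrite avgC//; apply: good_avgs; apply: good_avgs.
Qed.

Definition indep i f : Prop := forall x s, f (upd x i s) = f x.

Lemma avgD i f g : good f -> good g ->
  avg i (fun x => f x + g x) = fun x => avg i f x + avg i g x.
Proof.
by move=> gf gg; apply/funext => x; rewrite /avg meanD//; exact: good_upd.
Qed.

Lemma avgMl i f g : indep i f -> good g ->
  avg i (fun x => f x * g x) = fun x => f x * avg i g x.
Proof.
move=> nf gg; apply/funext => x; rewrite /avg -meanZ; last exact: good_upd.
by congr mean; apply/funext => s; rewrite nf.
Qed.

Lemma avg_indep i f : indep i f -> avg i f = f.
Proof.
move=> nf; apply/funext => x; rewrite /avg -[RHS](mean_cst P).
by congr mean; apply/funext => s; rewrite nf.
Qed.

Lemma avgs_ge0 vs f : (forall x, 0 <= f x) -> forall x, 0 <= avgs vs f x.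
Proof. by move=> f0; elim: vs => //= v vs IH x; apply: mean_ge0. Qed.

Lemma avgsD vs f g : good f -> good g ->
  avgs vs (fun x => f x + g x) = fun x => avgs vs f x + avgs vs g x.
Proof.
by move=> gf gg; elim: vs => //= v vs ->; rewrite avgD//; exact: good_avgs.
Qed.

Lemma avgsZ vs c f : good f -> avgs vs (fun x => c * f x) = fun x => c * avgs vs f x.
Proof.
move=> gf; elim: vs => //= v vs ->.
by rewrite avgMl//; exact: good_avgs.
Qed.

Lemma avgs_indep vs f : (forall v, v \in vs -> indep v f) -> avgs vs f = f.
Proof.
elim: vs => //= v vs IH nf; rewrite IH => [|w wvs]; last first.
  by apply: nf; rewrite inE wvs orbT.
by apply: avg_indep; apply: nf; rewrite mem_head.
Qed.

(** The degenerate case of the Cauchy-Schwarz inequality for iterated averages,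
from the sign of the mean of (t f + g)^2 for all t. *)
Lemma avgs_cauchy vs f g x : good f -> good g ->
  avgs vs (fun x => f x ^+ 2) x = 0 -> avgs vs (fun x => f x * g x) x = 0.
Proof.
move=> gf gg f0; set b := avgs vs (fun x => f x * g x) x.
set c := avgs vs (fun x => g x ^+ 2) x.
have gf2 : good (fun x => f x ^+ 2) by exact: goodM.
have gg2 : good (fun x => g x ^+ 2) by exact: goodM.
have gfg := goodM gf gg.
have key t : 0 <= 2 * t * b + c.
  have := @avgs_ge0 vs (fun x => (t * f x + g x) ^+ 2) (fun=> sqr_ge0 _) x.
  rewrite (_ : (fun x => _) =
    (fun x => t ^+ 2 * f x ^+ 2 + (2 * t * (f x * g x) + g x ^+ 2))); last first.
    by apply/funext => y; ring.
  rewrite avgsD; [|by apply: goodM => //; exact: good_cst|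
    by apply: goodD => //; apply: goodM => //; exact: good_cst].
  rewrite avgsD//; last by apply: goodM => //; exact: good_cst.
  by rewrite !avgsZ// f0 mulr0 add0r.
apply: contrapT => /eqP b0.
(* this t makes 2 t b + c equal to -1 *)
have := key (- (c + 1) / (2 * b)).
rewrite (_ : 2 * _ * b = - (c + 1)); last by field.
lra.
Qed.

End Coordinates.
End Integration.

(** * Powers of a kernel and contraction of paths *)

Section WeightedEdges.
(** (u, v, k) stands for a path of k edges from u to v whose inner vertices have
been averaged out. *)
Definition wedge : Type := (nat * nat * nat)%type.
Implicit Types (v : nat) (e : wedge) (l : seq wedge).

Definition touch v e := (e.1.1 == v) || (e.1.2 == v).
Definition other v e := if e.1.1 == v then e.1.2 else e.1.1.

(** Averaging over a vertex of degree two joins the two paths that meet there.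
The test on the other ends excludes a closed path through v. *)
Definition contract v l : option (seq wedge) :=
  if seq.filter (touch v) l is [:: e1; e2] then
    if [&& other v e1 != v, other v e2 != v, 0 < e1.2 & 0 < e2.2]%N then
      Some ((other v e1, other v e2, e1.2 + e2.2)%N :: seq.filter (predC (touch v)) l)
    else None
  else None.

Fixpoint contracts (vs : seq nat) l : option (seq wedge) :=
  if vs is v :: vs' then
    if contract v l is Some l' then contracts vs' l' else None
  else Some l.

End WeightedEdges.

Section KernelPowers.
Local Open Scope classical_set_scope.
Local Open Scope ring_scope.
Context d (T : measurableType d) (R : realType) (P : probability T R).
Variable V : T * T -> R.
Hypothesis bV : bddmeas V.
Hypothesis symV : forall x y, V (x, y) = V (y, x).
Implicit Types (x : nat -> T).

(** The kernel of the k-th power of the integral operator of V, for k > 0. *)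
Definition kpow k : T * T -> R :=
  iter k.-1 (fun W z => mean P (fun s => V (z.1, s) * W (s, z.2))) V.

(** Density of closed walks of length k based at s. *)
Definition tau k (s : T) : R := kpow k (s, s).

Lemma kpowS k : kpow k.+2 = fun z => mean P (fun s => V (z.1, s) * kpow k.+1 (s, z.2)).
Proof. by []. Qed.

Lemma bdd_pair1 (f : T * T -> R) a : bddmeas f -> bddmeas (fun s => f (a, s)).
Proof. by apply: (bddmeas_comp (h := pair a)); exact: measurable_pair1. Qed.

Lemma bdd_pair2 (f : T * T -> R) a : bddmeas f -> bddmeas (fun s => f (s, a)).
Proof. by apply: (bddmeas_comp (h := pair^~ a)); exact: measurable_pair2. Qed.

Lemma bdd_fst (f : T -> R) : bddmeas f -> bddmeas (fun z : T * T => f z.1).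
Proof. by apply: (bddmeas_comp (h := fst)); exact: measurable_fst. Qed.

Lemma bdd_snd (f : T -> R) : bddmeas f -> bddmeas (fun z : T * T => f z.2).
Proof. by apply: (bddmeas_comp (h := snd)); exact: measurable_snd. Qed.

Lemma bdd_compose (f g : T * T -> R) : bddmeas f -> bddmeas g ->
  bddmeas (fun z => mean P (fun s => f (z.1, s) * g (s, z.2))).
Proof.
move=> bf bg.
apply: (@bddmeas_mean _ _ _ P _ _ (fun w : (T * T) * T => f (w.1.1, w.2) * g (w.2, w.1.2))).
have m11 : measurable_fun [set: (T * T) * T] (fun w => w.1.1).
  by apply: (measurableT_comp (f := fst)); [exact: measurable_fst|exact: measurable_fst].
have m12 : measurable_fun [set: (T * T) * T] (fun w => w.1.2).
  by apply: (measurableT_comp (f := snd)); [exact: measurable_snd|exact: measurable_fst].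
have m2 : measurable_fun [set: (T * T) * T] (fun w => w.2) by exact: measurable_snd.
apply: bddmeasM.
- apply: (bddmeas_comp (h := fun w : (T * T) * T => (w.1.1, w.2)) _ bf).
  exact/measurable_fun_pair.
- apply: (bddmeas_comp (h := fun w : (T * T) * T => (w.2, w.1.2)) _ bg).
  exact/measurable_fun_pair.
Qed.

Lemma bdd_kpow k : bddmeas (kpow k).
Proof.
rewrite /kpow; elim: k.-1 => //= n IH; exact: (bdd_compose bV IH).
Qed.

Lemma bdd_tau k : bddmeas (tau k).
Proof.
apply: (bddmeas_comp (h := fun s => (s, s)) _ (bdd_kpow k)).
by apply/measurable_fun_pair; exact: measurable_id.
Qed.

Lemma kpowD i j a b : (0 < i)%N -> (0 < j)%N ->
  kpow (i + j) (a, b) = mean P (fun s => kpow i (a, s) * kpow j (s, b)).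
Proof.
case: i => // i _; case: j => // j _; elim: i a => [//|i IH] a.
have -> : (i.+2 + j.+1 = (i + j.+1).+2)%N by lia.
rewrite kpowS /=.
transitivity (mean P (fun s => mean P (fun t =>
    V (a, s) * (kpow i.+1 (s, t) * kpow j.+1 (t, b))))).
  congr mean; apply/funext => s; rewrite -[(i + j.+1).+1]/(i.+1 + j.+1)%N IH -meanZ//.
  by apply: bddmeasM; [exact: bdd_pair1 (bdd_kpow _)|exact: bdd_pair2 (bdd_kpow _)].
rewrite (@mean_fubini _ _ _ P _ _ P
  (fun z : T * T => V (a, z.1) * (kpow i.+1 (z.1, z.2) * kpow j.+1 (z.2, b)))).
  congr mean; apply/funext => t /=; rewrite kpowS/=.
  rewrite [RHS]mulrC -meanZ; last first.
    by apply: bddmeasM; [exact: bdd_pair1 bV|exact: bdd_pair2 (bdd_kpow _)].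
  by congr mean; apply/funext => s; ring.
apply: bddmeasM; first exact: bdd_fst (bdd_pair1 a bV).
apply: bddmeasM; last exact: bdd_snd (bdd_pair2 b (bdd_kpow _)).
rewrite (_ : (fun z => _) = kpow i.+1); [exact: bdd_kpow|].
by apply/funext => -[].
Qed.

Lemma kpow_sym k a b : kpow k (a, b) = kpow k (b, a).
Proof.
case: k => [|k]; first exact: symV.
elim: k a b => [|k IH] a b; first exact: symV.
rewrite -{1}addn1 kpowD//= kpowS /=; congr mean; apply/funext => s.
by rewrite mulrC IH; congr (_ * _); exact: symV.
Qed.

Definition ew (e : wedge) x : R := kpow e.2 (x e.1.1, x e.1.2).
Definition wprod (l : seq wedge) x : R := \prod_(e <- l) ew e x.

Lemma good_ew e : good (ew e).
Proof. by apply: good_coord2; exact: bdd_kpow. Qed.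

Lemma good_wprod l : good (wprod l).
Proof. by apply: good_prod => e; exact: good_ew. Qed.

Lemma wprod_cons e l : wprod (e :: l) = fun x => ew e x * wprod l x.
Proof. by apply/funext => x; rewrite /wprod big_cons. Qed.

Lemma perm_wprod l l' : perm_eq l l' -> wprod l = wprod l'.
Proof. by move=> ll'; apply/funext => x; exact: perm_big. Qed.

Lemma indep_ew v e : ~~ touch v e -> indep v (ew e).
Proof.
rewrite /touch negb_or => /andP[e1 e2] x s.
by rewrite /ew /upd (negbTE e1) (negbTE e2).
Qed.

Lemma indep_wprod v l : all (predC (touch v)) l -> indep v (wprod l).
Proof.
elim: l => [|e l IH] /=; first by move=> _ x s; rewrite /wprod !big_nil.
move=> /andP[ve vl] x s; rewrite !wprod_cons IH//; congr (_ * _).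
exact: indep_ew.
Qed.

Lemma ew_other v e x : touch v e -> ew e x = kpow e.2 (x (other v e), x v).
Proof.
case: e => -[a b] k; rewrite /touch /other /ew /=.
by have [->/= _|_ /= /eqP->//] := eqVneq a v; rewrite kpow_sym.
Qed.

(** Composition of kernel powers, kpowD, at the contracted vertex. *)
Lemma contractP v l l' : contract v l = Some l' -> avg P v (wprod l) = wprod l'.
Proof.
rewrite /contract; case Ef : (seq.filter (touch v) l) => [|e1 [|e2 []]]//.
case: ifP => // /and4P -[n1 n2 k1 k2] [<-].
have t12 : touch v e1 && touch v e2.
  have: all (touch v) (seq.filter (touch v) l) by exact: filter_all.
  by rewrite Ef /= andbT.
have [t1 t2] := andP t12.
have pl : perm_eq l ([:: e1; e2] ++ seq.filter (predC (touch v)) l).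
  by rewrite -Ef perm_sym perm_filterC.
rewrite (perm_wprod pl) /=; set r := seq.filter _ _.
have nr : all (predC (touch v)) r by exact: filter_all.
rewrite !wprod_cons.
rewrite (_ : (fun x => _) = (fun x => wprod r x * (ew e1 x * ew e2 x))); last first.
  by apply/funext => x; ring.
rewrite avgMl; [|exact: indep_wprod|by apply: goodM; exact: good_ew].
apply/funext => x; rewrite mulrC; congr (_ * _).
rewrite /avg /ew /= kpowD//; congr mean; apply/funext => s.
rewrite -!/(ew _ _) (ew_other _ t1) (ew_other _ t2) /upd eqxx (negbTE n1) (negbTE n2).
by congr (_ * _); rewrite kpow_sym.
Qed.

Lemma contractsP vs l l' : contracts vs l = Some l' ->
  avgs P (rev vs) (wprod l) = wprod l'.
Proof.
elim: vs l => [l [<-]//|v vs IH] l /=.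
case Ec : (contract v l) => [l1|]// /IH <-.
rewrite rev_cons -cats1 /avgs foldr_cat /=.
by rewrite (contractP Ec).
Qed.

Lemma mean_sub i (f : T -> R) x : avg P i (fun y => f (y i)) x = mean P f.
Proof. by rewrite /avg; congr mean; apply/funext => s; rewrite /upd eqxx. Qed.

Lemma avgs_loop u k x : avgs P [:: u] (wprod [:: (u, u, k)]) x = mean P (tau k).
Proof.
rewrite -(mean_sub u (tau k) x); congr (avg P u _ x).
by apply/funext => y; rewrite /wprod big_seq1.
Qed.

Lemma avgs_loop2 u k l x :
  avgs P [:: u] (wprod [:: (u, u, k); (u, u, l)]) x = mean P (fun s => tau k s * tau l s).
Proof.
rewrite -(mean_sub u _ x); congr (avg P u _ x).
by apply/funext => y; rewrite /wprod !big_cons big_nil mulr1.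
Qed.

Lemma avgs_loop_loop u v k l x : u != v ->
  avgs P [:: u; v] (wprod [:: (u, u, k); (v, v, l)]) x = mean P (tau k) * mean P (tau l).
Proof.
move=> uv; rewrite /avgs/= /avg mulrC -meanZ; last exact: bdd_tau.
congr mean; apply/funext => s; rewrite mulrC -meanZ; last exact: bdd_tau.
congr mean; apply/funext => t.
by rewrite /wprod !big_cons big_nil mulr1 /ew /upd/= !eqxx (negbTE uv).
Qed.

(** The n-th power of the integral operator applied to f. *)
Definition kapp n (f : T -> R) (a : T) : R := mean P (fun s => kpow n (a, s) * f s).

Lemma bdd_kapp n f : bddmeas f -> bddmeas (kapp n f).
Proof.
move=> bf; apply: (@bddmeas_mean _ _ _ P _ _ (fun z => kpow n z * f z.2)).
by apply: bddmeasM; [exact: bdd_kpow|exact: bdd_snd].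
Qed.

Lemma avgs_dumbbell u v k n l x : u != v ->
  avgs P [:: u; v] (wprod [:: (u, u, k); (u, v, n); (v, v, l)]) x =
  mean P (fun s => tau k s * kapp n (tau l) s).
Proof.
move=> uv; rewrite /avgs/= /avg; congr mean; apply/funext => s.
rewrite -meanZ; last by apply: bddmeasM; [exact: bdd_pair1 (bdd_kpow _)|exact: bdd_tau].
congr mean; apply/funext => t.
by rewrite /wprod !big_cons big_nil mulr1 /ew /upd/= !eqxx (negbTE uv).
Qed.

Lemma kapp_adj n f g : bddmeas f -> bddmeas g ->
  mean P (fun s => f s * kapp n g s) = mean P (fun s => kapp n f s * g s).
Proof.
move=> bf bg.
transitivity (mean P (fun s => mean P (fun t => f s * (kpow n (s, t) * g t)))).
  congr mean; apply/funext => s; rewrite -meanZ//.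
  by apply: bddmeasM => //; exact: bdd_pair1 (bdd_kpow _).
rewrite (@mean_fubini _ _ _ P _ _ P (fun z => f z.1 * (kpow n (z.1, z.2) * g z.2))).
  congr mean; apply/funext => t; rewrite [RHS]mulrC -meanZ; last first.
    by apply: bddmeasM => //; exact: bdd_pair1 (bdd_kpow _).
  by congr mean; apply/funext => s /=; rewrite (kpow_sym n t s); ring.
apply: bddmeasM; first exact: bdd_fst.
apply: bddmeasM; last exact: bdd_snd.
by rewrite (_ : (fun z => _) = kpow n); [exact: bdd_kpow|apply/funext => -[]].
Qed.

Lemma kappD i j f : bddmeas f -> (0 < i)%N -> (0 < j)%N ->
  kapp (i + j) f = kapp i (kapp j f).
Proof.
move=> bf i0 j0; apply/funext => a; rewrite /kapp.
transitivity (mean P (fun t => mean P (fun s => kpow i (a, s) * (kpow j (s, t) * f t)))).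
  congr mean; apply/funext => t; rewrite kpowD// mulrC -meanZ; last first.
    by apply: bddmeasM; [exact: bdd_pair1 (bdd_kpow _)|exact: bdd_pair2 (bdd_kpow _)].
  by congr mean; apply/funext => s; ring.
rewrite -(@mean_fubini _ _ _ P _ _ P
    (fun z => kpow i (a, z.1) * (kpow j (z.1, z.2) * f z.2))).
  congr mean; apply/funext => s; rewrite -meanZ//.
  by apply: bddmeasM => //; exact: bdd_pair1 (bdd_kpow _).
apply: bddmeasM; first exact: bdd_fst (bdd_pair1 a (bdd_kpow _)).
apply: bddmeasM; last exact: bdd_snd.
by rewrite (_ : (fun z => _) = kpow j); [exact: bdd_kpow|apply/funext => -[]].
Qed.

(** The one-variable case of avgs_cauchy. *)
Lemma mean_cauchy (f g : T -> R) : bddmeas f -> bddmeas g ->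
  mean P (fun s => f s ^+ 2) = 0 -> mean P (fun s => f s * g s) = 0.
Proof.
move=> bf bg f0.
have [[t _]|T0] := pselect (exists t : T, True).
  have := @avgs_cauchy _ _ _ P [:: 0%N] (fun x => f (x 0%N)) (fun x => g (x 0%N)) (fun=> t).
  rewrite /avgs/= (mean_sub 0%N (fun s => f s ^+ 2)) (mean_sub 0%N (fun s => f s * g s)).
  by apply => //; exact: good_coord1.
rewrite (_ : (fun s => f s * g s) = (fun s => f s ^+ 2))//.
by apply/funext => s; case: T0; exists s.
Qed.

End KernelPowers.

(** * Homomorphism densities as iterated averages *)

Section UnitInterval.
Context (R : realType).
Local Open Scope classical_set_scope.
Local Open Scope ring_scope.
Local Notation T := (measurableTypeR R).
Local Notation leb := (@lebesgue_measure R).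

(** Lebesgue measure on the unit interval as a probability on the line. *)
Definition unif : probability T R := uniform_prob (@ltr01 R).

Lemma integral_unif (f : T -> R) : bddmeas f ->
  (\int[unif]_x (f x)%:E = \int[leb]_(x in `[0%R, 1%R]) (f x)%:E)%E.
Proof.
move=> [mf _].
have mF : measurable_fun [set: T] (EFin \o f) by exact/measurable_EFinP.
rewrite integralE [RHS]integralE; congr (_ - _)%E.
  rewrite integral_uniform ?subr0 ?invr1 ?mul1e//; exact: measurable_funepos.
by rewrite integral_uniform ?subr0 ?invr1 ?mul1e//; exact: measurable_funeneg.
Qed.

(** The integral over the unit cube as an iterated mean, following the recursive
definition of the measure on tuples. *)
Fixpoint itmean n : (n.-tuple T -> R) -> R :=
  match n return (n.-tuple T -> R) -> R with
  | 0 => fun F => F [tuple]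
  | m.+1 => fun F => mean unif (fun s => itmean (fun t => F (cons_pair (s, t))))
  end.

Lemma measurable_unit_cube n : measurable (@unit_cube R n).
Proof.
rewrite (_ : @unit_cube R n = \bigcap_(i in [set: 'I_n]) ((fun x => tnth x i) @^-1` `[0, 1])).
  apply: fin_bigcap_measurable => // i _.
  by rewrite -[X in measurable X]setTI; apply: measurable_tnth.
apply/seteqP; split => x /=; first by move=> h i _; exact: h.
by move=> h i; exact: h.
Qed.

Lemma cons_unit_cube n :
  @cons_pair _ T n @^-1` (@unit_cube R n.+1) = `[0, 1] `*` @unit_cube R n.
Proof.
apply/seteqP; split => -[s t] /=.
  move=> h; split; first by have := h ord0; rewrite (tnth_nth s).
  move=> i; have := h (lift ord0 i); by rewrite !(tnth_nth s).
move=> [hs ht] i; rewrite (tnth_nth s)/=.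
case: i => -[|i] //= hi; have := ht (Ordinal (hi : (i < n)%N)).
by rewrite (tnth_nth s).
Qed.

Lemma bdd_itmean n d (S : measurableType d) (F : S -> n.-tuple T -> R) :
  bddmeas (fun z : S * n.-tuple T => F z.1 z.2) -> bddmeas (fun s => itmean (F s)).
Proof.
elim: n d S F => [|n IH] d S F bF /=.
  apply: (bddmeas_comp (h := fun s => (s, [tuple] : 0.-tuple T)) _ bF).
  by apply/measurable_fun_pair => //; exact: measurable_id.
apply: (bddmeas_mean unif (f := fun z : S * T => itmean (fun t => F z.1 (cons_pair (z.2, t))))).
apply: (IH _ _ (fun z : S * T => fun t => F z.1 (cons_pair (z.2, t)))).
apply: (bddmeas_comp (h := fun w : (S * T) * n.-tuple T => (w.1.1, cons_pair (w.1.2, w.2))) _ bF).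
have m1 : measurable_fun [set: (S * T) * n.-tuple T] (fst : _ -> S * T) by exact: measurable_fst.
apply/measurable_fun_pair; first by apply: measurableT_comp m1; exact: measurable_fst.
apply: measurableT_comp; first exact: measurable_cons_pair.
apply/measurable_fun_pair; first by apply: measurableT_comp m1; exact: measurable_snd.
exact: measurable_snd.
Qed.

(** Induction on the dimension by Fubini.  Integrability is proved at the same
time because Fubini needs it at the next step. *)
Lemma integral_cube n (F : n.-tuple T -> R) : bddmeas F ->
  (lebesgue_tuple R n).-integrable (@unit_cube R n) (EFin \o F) /\
  (\int[lebesgue_tuple R n]_(x in @unit_cube R n) (F x)%:E = (itmean F)%:E)%E.
Proof.
elim: n F => [|n IH] F bF.
  have mF : measurable_fun [set: 0.-tuple T] (EFin \o F).
    by apply/measurable_EFinP; case: bF.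
  have cT : @unit_cube R 0 = setT by apply/seteqP; split => // x _ [].
  have mu1 : (@dirac _ (0.-tuple T) [tuple] R setT = 1)%E by rewrite diracT.
  rewrite cT; split.
    by apply: bddmeas_integrable => //=; rewrite mu1 ltry.
  rewrite /= integral_dirac//.
  by rewrite diracT mul1e.
have [i1 e1] := IH (fun=> 1) (bddmeas_cst _ _).
have cube1 : lebesgue_tuple R n (@unit_cube R n) = 1%E.
  rewrite -[LHS]mul1e -(integral_cst _ (@measurable_unit_cube n)).
  rewrite [LHS]e1; congr EFin; clear; elim: n => //= n IHn.
  by rewrite (_ : (fun s => _) = fun=> 1) ?mean_cst//; apply/funext => s; exact: IHn.
have [mF [M FM]] := bF.
set C := @cons_pair _ T n @^-1` (@unit_cube R n.+1).
have mC : measurable C.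
  by rewrite -[C]setTI; apply: measurable_cons_pair => //; exact: measurable_unit_cube.
pose F' := F \o @cons_pair _ T n.
have bF' : bddmeas F' by apply: (bddmeas_comp _ bF); exact: measurable_cons_pair.
have iF' : ((leb \x lebesgue_tuple R n)%E).-integrable C (EFin \o F').
  apply: (bddmeas_integrable mC _ bF').
  rewrite /C cons_unit_cube.
  rewrite [X in (X < _)%E](@product_measure1E _ _ _ _ _ leb (lebesgue_tuple R n))//; last first.
    exact: measurable_unit_cube.
  by rewrite [X in (_ * X)%E]cube1 mule1 /= lebesgue_measure_itv/= lte_fin ltr01 -EFinB ltry.
split.
  rewrite /=; apply: integrable_pushforward => //.
  - exact/measurable_EFinP.
  - exact: measurable_unit_cube.
transitivity (\int[(leb \x lebesgue_tuple R n)%E]_(x in C) (F' x)%:E)%E.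
  rewrite /= /cons_measure integral_pushforward//.
  - exact/measurable_EFinP.
  - exact: measurable_unit_cube.
rewrite integral_mkcond -integral12_prod_meas1; last by rewrite -integrable_mkcond.
rewrite /fubini_F /=.
rewrite EFin_mean; last first.
  apply: (bdd_itmean (F := fun s t => F (cons_pair (s, t)))).
  apply: (bddmeas_comp _ bF).
  rewrite (_ : (fun z => _) = @cons_pair _ T n); first exact: measurable_cons_pair.
  by apply/funext => -[].
rewrite integral_unif; last first.
  apply: (bdd_itmean (F := fun s t => F (cons_pair (s, t)))).
  apply: (bddmeas_comp _ bF).
  rewrite (_ : (fun z => _) = @cons_pair _ T n); first exact: measurable_cons_pair.
  by apply/funext => -[].
rewrite [RHS]integral_mkcond; apply: eq_integral => s _.
rewrite patchE; case: ifPn => hs.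
  have bFs : bddmeas (fun t => F (cons_pair (s, t))).
    apply: (bddmeas_comp (h := fun t => cons_pair (s, t)) _ bF).
    by apply: measurableT_comp (measurable_pair1 s); exact: measurable_cons_pair.
  have [_ <-] := IH _ bFs.
  rewrite [RHS]integral_mkcond; apply: eq_integral => t _.
  rewrite !patchE /C cons_unit_cube.
  have -> : ((s, t) \in `[0, 1] `*` @unit_cube R n) = (t \in @unit_cube R n).
    rewrite in_setX/=; move: hs; by rewrite inE => hs; rewrite mem_setE hs.
  by [].
rewrite integral0_eq// => t _; rewrite patchE /C cons_unit_cube in_setX/= (negbTE hs).
by [].
Qed.

(** Makes the recursion over tuples match the averages over consecutive
coordinates. *)
Definition ovr k n (x : nat -> T) (t : n.-tuple T) : nat -> T :=
  fun i => if (k <= i < k + n)%N then nth (x i) t (i - k) else x i.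

Lemma good_ovr k n x (f : (nat -> T) -> R) : good f -> bddmeas (fun t => f (@ovr k n x t)).
Proof.
move=> gf; apply: (gf _ _ (fun t => @ovr k n x t)) => i.
have [h|h] := boolP (k <= i < k + n)%N.
  have hn : (i - k < n)%N by lia.
  rewrite (_ : (fun t => _) = fun t : n.-tuple T => tnth t (Ordinal hn)).
    exact: measurable_tnth.
  by apply/funext => t; rewrite /ovr h (tnth_nth (x i)).
rewrite (_ : (fun t => _) = fun=> x i); first exact: measurable_cst.
by apply/funext => t; rewrite /ovr (negbTE h).
Qed.

Lemma itmean_avgs k n x (f : (nat -> T) -> R) : good f ->
  itmean (fun t => f (@ovr k n x t)) = avgs unif (iota k n) f x.
Proof.
move=> gf; elim: n k x => [|n IH] k x /=.
  congr f; apply/funext => i; rewrite /ovr addn0.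
  by case: ifP => //; lia.
rewrite /avg; congr mean; apply/funext => s; rewrite -IH.
congr itmean; apply/funext => t; congr f; apply/funext => i; rewrite /ovr /upd.
have [->|ik] := eqVneq i k; first by rewrite leqnn subnn ltnn /=; case: ifP => //; lia.
case: ifP => h1; case: ifP => h2 //; try lia.
rewrite (_ : i - k = (i - k.+1).+1)%N; last by lia.
by apply: set_nth_default; rewrite size_tuple; lia.
Qed.

Definition edgeprod (H : graph) (V : T * T -> R) (x : nat -> T) : R :=
  \prod_(p : 'I_(nverts H) * 'I_(nverts H) | (p.1 < p.2)%N && adj p.1 p.2)
     V (x p.1, x p.2).

Lemma good_edgeprod H V : bddmeas V -> good (edgeprod H V).
Proof. by move=> bV; apply: good_prod => p; exact: good_coord2. Qed.

(** The density as an iterated average over the vertices, for a symmetric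
extension V of the kernel to the plane. *)
Lemma hom_density_avgs H (U V : T * T -> R) x :
  bddmeas V -> (forall z, @unit_square R z -> U z = V z) ->
  hom_density H U = avgs unif (iota 0 (nverts H)) (edgeprod H V) x.
Proof.
move=> bV UV; rewrite /hom_density /Rintegral.
rewrite -itmean_avgs; last exact: good_edgeprod.
have [_ E0] := integral_cube (@good_ovr 0 (nverts H) x _ (good_edgeprod H bV)).
rewrite -[RHS]/(fine (_)%:E) -E0.
congr fine; apply: eq_integral => t; rewrite inE => ht; congr EFin.
rewrite /edgeprod; apply: eq_bigr => p _.
have E i : @ovr 0 (nverts H) x t (i : 'I_(nverts H)) = tnth t i.
  by rewrite /ovr add0n ltn_ord subn0 (tnth_nth (x i)).
by rewrite !E UV//; split; [exact: ht|exact: ht].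
Qed.

(** Extension by zero: a bounded measurable function on the whole plane can be
evaluated anywhere without a domain condition. *)
Lemma kernel_extend (U : T * T -> T) : @is_kernel R U ->
  exists V : T * T -> R, [/\ bddmeas V, forall x y, V (x, y) = V (y, x) &
    forall z, @unit_square R z -> U z = V z].
Proof.
move=> [mU [M UM] Us].
have msq : measurable (@unit_square R) by exact: measurableX.
exists (U \_ (@unit_square R)); split.
- split; first exact/(measurable_restrictT _ msq).
  exists `|M| => z; rewrite patchE; case: ifPn; last by rewrite normr0.
  by rewrite inE => /UM h; rewrite (le_trans h)// ler_norm.
- move=> x y; rewrite !patchE.
  have -> : ((x, y) \in unit_square (R:=R)) = ((y, x) \in unit_square (R:=R)).
    by rewrite /unit_square !in_setX andbC.
  by case: ifPn => //; rewrite inE => /Us.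
- by move=> z Uz; rewrite patchE mem_set.
Qed.

End UnitInterval.

(** * Positivity of the densities of even cycles *)

Section Nondegeneracy.
Local Open Scope classical_set_scope.
Local Open Scope ring_scope.
Context d (T : measurableType d) (R : realType) (P : probability T R).

Definition mean2 (F : T * T -> R) : R := mean P (fun x => mean P (fun y => F (x, y))).

Lemma mean2_cauchy (F G : T * T -> R) : bddmeas F -> bddmeas G ->
  mean2 (fun z => F z ^+ 2) = 0 -> mean2 (fun z => F z * G z) = 0.
Proof.
move=> bF bG F0.
have [[t _]|T0] := pselect (exists t : T, True); last first.
  rewrite (_ : (fun z => F z * G z) = (fun z => F z ^+ 2))//.
  by apply/funext => -[s s2]; case: T0; exists s.
have h (H : T * T -> R) : avgs P [:: 0; 1]%N (fun x => H (x 0%N, x 1%N)) (fun=> t) = mean2 H.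
  by rewrite /avgs/= /avg.
rewrite -h; apply: (@avgs_cauchy _ _ _ P _ (fun x => F (x 0%N, x 1%N)) (fun x => G (x 0%N, x 1%N))).
- exact: good_coord2.
- exact: good_coord2.
- by rewrite -F0 -h.
Qed.

Lemma EFin_mean2 (F : T * T -> R) : bddmeas F ->
  (mean2 F)%:E = (\int[(P \x P)%E]_z (F z)%:E)%E.
Proof.
move=> bF; rewrite /mean2 EFin_mean; last exact: (bddmeas_mean P bF).
under eq_integral => x _ do rewrite (EFin_mean P (bdd_pair1 x bF)).
rewrite (_ : (\int[(P \x P)%E]_z (F z)%:E)%E = (\int[(P \x P)%E]_z (EFin \o F) z)%E)//.
rewrite -integral12_prod_meas1//.
exact: prod_integrable.
Qed.

Lemma mean2D (F G : T * T -> R) : bddmeas F -> bddmeas G ->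
  mean2 (fun z => F z + G z) = mean2 F + mean2 G.
Proof.
move=> bF bG; rewrite /mean2 -meanD; [|exact: bddmeas_mean bF|exact: bddmeas_mean bG].
by congr mean; apply/funext => x; rewrite meanD//; exact: bdd_pair1.
Qed.

Variable V : T * T -> R.
Hypothesis bV : bddmeas V.
Hypothesis symV : forall x y, V (x, y) = V (y, x).

Lemma mean_tauD i j : (0 < i)%N -> (0 < j)%N ->
  mean P (tau P V (i + j)) = mean2 (fun z => kpow P V i z * kpow P V j z).
Proof.
move=> i0 j0; rewrite /mean2; congr mean; apply/funext => s; rewrite /tau kpowD//.
by congr mean; apply/funext => t; congr (_ * _); rewrite kpow_sym.
Qed.

Lemma mean_tau_even k : (0 < k)%N ->
  mean P (tau P V (k + k)) = mean2 (fun z => kpow P V k z ^+ 2).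
Proof.
by move=> k0; rewrite mean_tauD//; congr mean2; apply/funext => z; rewrite expr2.
Qed.

Lemma mean_tau_even_ge0 k : (0 < k)%N -> 0 <= mean P (tau P V (k + k)).
Proof.
by move=> k0; rewrite mean_tau_even//; apply: mean_ge0 => s; apply: mean_ge0 => t; exact: sqr_ge0.
Qed.

(** The vanishing of the density of C_(2k+2) says that V^(k+1) is zero in mean
square; pairing it with V^(k-1) gives the density of C_(2k). *)
Lemma mean_tau_down k : (2 <= k)%N -> mean P (tau P V (k + k)) = 0 -> mean P (tau P V (2 + 2)) = 0.
Proof.
elim: k => // k IH; rewrite leq_eqVlt => /predU1P[<-//|k2] h.
apply: IH => //.
have -> : (k + k = k.+1 + k.-1)%N by lia.
rewrite mean_tauD//; last by lia.
by apply: mean2_cauchy; [exact: bdd_kpow|exact: bdd_kpow|rewrite -mean_tau_even].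
Qed.

Lemma bddmeas_indic d' (S : measurableType d') (A : set S) : measurable A ->
  bddmeas (\1_A : S -> R).
Proof.
move=> mA; split; first exact: measurable_indic.
by exists 1 => x; rewrite indicE; case: (_ \in _); rewrite ?normr1 ?normr0.
Qed.

Hypothesis C4_0 : mean P (tau P V (2 + 2)) = 0.

(** The integral of V over a rectangle is the pairing of V B with A, and the
square norm of V B is the pairing of V^2 with the product of B and B, which
vanishes with t(C_4, V). *)
Lemma rect_0 (A B : T -> R) : bddmeas A -> bddmeas B ->
  mean2 (fun z => V z * (A z.1 * B z.2)) = 0.
Proof.
move=> bA bB.
transitivity (mean P (fun x => kapp P V 1 B x * A x)).
  rewrite /mean2; congr mean; apply/funext => x; rewrite mulrC -meanZ; last first.
    by apply: bddmeasM => //; exact: bdd_pair1 (bdd_kpow _ _ _).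
  by congr mean; apply/funext => y /=; rewrite /kpow/=; ring.
apply: mean_cauchy => //; first exact: bdd_kapp.
transitivity (mean P (fun x => kapp P V 1 B x * kapp P V 1 B x)); first by [].
rewrite -kapp_adj//; last exact: bdd_kapp.
rewrite -kappD//.
transitivity (mean2 (fun z => kpow P V 2 z * (B z.1 * B z.2))).
  rewrite /mean2; congr mean; apply/funext => x; rewrite -meanZ; last first.
    by apply: bddmeasM => //; exact: bdd_pair1 (bdd_kpow _ _ _).
  by congr mean; apply/funext => y /=; ring.
apply: mean2_cauchy; first exact: bdd_kpow.
  by apply: bddmeasM; [exact: bdd_fst|exact: bdd_snd].
by rewrite -mean_tau_even.
Qed.

(** The sets over which V integrates to zero form a Dynkin class containing the
rectangles. *)
Lemma mean2_indic_0 (C : set (T * T)) : measurable C -> mean2 (fun z => V z * \1_C z) = 0.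
Proof.
have bV1 (D : set (T * T)) : measurable D -> bddmeas (fun z => V z * \1_D z).
  by move=> mD; apply: bddmeasM => //; exact: bddmeas_indic.
have VT : mean2 V = 0.
  rewrite -[RHS](rect_0 (bddmeas_cst T 1) (bddmeas_cst T 1)); congr mean2.
  by apply/funext => z; rewrite !mulr1.
have i0 (D : set (T * T)) : measurable D ->
    mean2 (fun z => V z * \1_D z) = 0 <-> (\int[(P \x P)%E]_(z in D) (V z)%:E = 0)%E.
  move=> mD.
  have -> : (\int[(P \x P)%E]_(z in D) (V z)%:E)%E = (mean2 (fun z => V z * \1_D z))%:E.
    rewrite EFin_mean2; last exact: bV1.
    rewrite integral_mkcond; apply: eq_integral => z _.
    by rewrite patchE indicE; case: ifP => _; rewrite ?mulr1 ?mulr0.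
  by split => [->//|[]].
move=> mC; move: (mC); rewrite measurable_prod_measurableType.
pose G : set (set (T * T)) := [set A `*` B | A in measurable & B in measurable].
apply: (@dynkin_induction _ (T * T)%type G (fun C => mean2 (fun z => V z * \1_C z) = 0)).
- exact: measurable_prod_measurableType.
- move=> _ _ [A mA [B mB <-]] [A' mA' [B' mB' <-]]; exists (A `&` A'); first exact: measurableI.
  by exists (B `&` B'); [exact: measurableI|rewrite setXI].
- rewrite -[RHS]VT; congr mean2; apply/funext => z.
  by rewrite indicE in_setT mulr1.
- move=> _ [A mA [B mB <-]] /=.
  rewrite -[RHS](rect_0 (bddmeas_indic mA) (bddmeas_indic mB)); congr mean2.
  apply/funext => -[x y]; congr (_ * _).
  by rewrite /= !indicE in_setX/= -natrM mulnb.
- move=> S mS S0.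
  have h : mean2 (fun z => V z * \1_(~` S) z + V z * \1_S z) = 0.
    rewrite -[RHS]VT; congr mean2; apply/funext => z.
    rewrite -mulrDr -[RHS]mulr1; congr (_ * _); rewrite !indicE in_setC.
    by case: (_ \in _); rewrite ?addr0 ?add0r.
  have bS := bV1 _ mS; have bS' := bV1 _ (measurableC mS).
  by move: h; rewrite (mean2D bS' bS) S0 addr0.
- move=> F mF tF F0; apply/i0; first exact: bigcupT_measurable.
  rewrite integral_bigcup//.
    by apply: eseries0 => k _ _; exact: (i0 (F k) (mF k)).1 (F0 k).
  by apply: integrableS (prod_integrable P P bV) => //; exact: bigcupT_measurable.
Qed.

End Nondegeneracy.

Section NonzeroKernels.
Context (R : realType).
Local Open Scope classical_set_scope.
Local Open Scope ring_scope.
Local Notation T := (measurableTypeR R).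
Local Notation leb := (@lebesgue_measure R).
Local Notation unif := (@unif R).

Lemma measurable_unit_square : measurable (@unit_square R).
Proof. exact: measurableX. Qed.

Lemma unit_square_finite : ((leb \x leb)%E (@unit_square R) < +oo)%E.
Proof.
rewrite /unit_square [X in (X < _)%E](@product_measure1E _ _ _ _ _ leb leb)//.
by rewrite /= lebesgue_measure_itv/= lte_fin ltr01 -EFinB -EFinM ltry.
Qed.

Lemma integrable_square (F : T * T -> R) : bddmeas F ->
  ((leb \x leb)%E).-integrable (@unit_square R) (EFin \o F).
Proof.
exact: (bddmeas_integrable measurable_unit_square unit_square_finite).
Qed.

Lemma mean2_leb (F : T * T -> R) : bddmeas F ->
  (mean2 unif F)%:E = (\int[(leb \x leb)%E]_(z in @unit_square R) (F z)%:E)%E.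
Proof.
move=> bF; rewrite integral_mkcond -integral12_prod_meas1; last first.
  by rewrite -integrable_mkcond; [exact: integrable_square|exact: measurable_unit_square].
rewrite /mean2 EFin_mean; last exact: bddmeas_mean bF.
rewrite integral_unif; last exact: bddmeas_mean bF.
rewrite integral_mkcond; apply: eq_integral => x _; rewrite patchE /fubini_F.
case: ifPn => hx.
  rewrite EFin_mean; last exact: bdd_pair1 bF.
  rewrite integral_unif; last exact: bdd_pair1 bF.
  rewrite [LHS]integral_mkcond; apply: eq_integral => y _; rewrite !patchE.
  by rewrite /unit_square in_setX/= hx.
by rewrite integral0_eq// => y _; rewrite patchE /unit_square in_setX/= (negbTE hx).
Qed.

(** A function whose integrals over all measurable sets vanish is zero almost
everywhere. *)
Lemma ae_zero (V : T * T -> R) : bddmeas V -> (forall x y, V (x, y) = V (y, x)) ->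
  mean unif (tau unif V (2 + 2)) = 0 ->
  {ae (leb \x leb)%E, forall z, @unit_square R z -> V z = 0}.
Proof.
move=> bV sV h.
have : ae_eq (leb \x leb)%E (@unit_square R) (EFin \o V) (cst 0%E).
  apply: integral_ae_eq => //.
  - exact: measurable_unit_square.
  - exact: integrable_square.
  - move=> E Esq mE; rewrite integral0.
    rewrite -[RHS](congr1 EFin (mean2_indic_0 bV sV h mE)) mean2_leb; last first.
      by apply: bddmeasM => //; exact: bddmeas_indic.
    rewrite integral_mkcond [RHS]integral_mkcond; apply: eq_integral => z _.
    rewrite !patchE indicE; case: ifPn => zE.
      rewrite mulr1 ifT//; move: zE; rewrite !inE; exact: Esq.
    by rewrite mulr0; case: ifP.
by apply: filterS => z /= hz /hz[].
Qed.

Lemma zero_ae (U V : T * T -> R) : bddmeas V ->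
  (forall z, @unit_square R z -> U z = V z) ->
  {ae (leb \x leb)%E, forall z, @unit_square R z -> U z = 0} ->
  mean2 unif (fun z => V z ^+ 2) = 0.
Proof.
move=> bV UV h; have bV2 : bddmeas (fun z => V z ^+ 2) by exact: bddmeasM.
apply: EFin_inj; rewrite mean2_leb//.
rewrite (ae_eq_integral (cst 0%E)) ?integral0//.
- exact: measurable_unit_square.
- by apply/measurable_EFinP; apply: measurable_funTS; case: bV2.
- by apply: filterS h => z /= hz zsq; rewrite -UV// hz// expr0n.
Qed.

End NonzeroKernels.

(** * Densities of edge lists *)

Section CodeDensity.
Context (R : realType).
Local Open Scope ring_scope.
Local Notation T := (measurableTypeR R).
Local Notation unif := (@unif R).
Variable V : T * T -> R.
Hypothesis bV : bddmeas V.
Hypothesis symV : forall x y, V (x, y) = V (y, x).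

(** Each edge is a path of length one. *)
Definition weigh (l : ecode) : seq wedge := [seq (p, 1%N) | p <- l].

Definition dens (l : ecode) : R := avgs unif (verts l) (wprod unif V (weigh l)) (fun=> 0).

Lemma avgs_cat vs ws (f : (nat -> T) -> R) :
  avgs unif (vs ++ ws) f = avgs unif vs (avgs unif ws f).
Proof. exact: foldr_cat. Qed.

Lemma avgs_rename (r : nat -> nat) vs (f : (nat -> T) -> R) : injective r ->
  avgs unif (map r vs) (fun x => f (x \o r)) = fun x => avgs unif vs f (x \o r).
Proof.
move=> ir; elim: vs => //= v vs ->; apply/funext => x; rewrite /avg; congr mean.
apply/funext => s; congr (avgs _ _ _ _); apply/funext => w.
by rewrite /upd /= (inj_eq ir).
Qed.

Lemma wprod_weigh l x : wprod unif V (weigh l) x = \prod_(p <- l) V (x p.1, x p.2).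
Proof. by rewrite /wprod big_map. Qed.

(** The factors of the density are indexed by the pairs u < v of adjacent
vertices, and these correspond to the edges of the code. *)
Lemma edgeprod_represents (H : graph) l (rho : nat -> 'I_(nverts H)) x :
  wf l -> {in verts l &, injective rho} -> (forall p, p \in l -> adj (rho p.1) (rho p.2)) ->
  nedges H = size l ->
  edgeprod H V x = \prod_(p <- l) V (x (rho p.1), x (rho p.2)).
Proof.
move=> wl irho hrho sl.
pose g (p : nat * nat) := if (rho p.1 < rho p.2)%N then (rho p.1, rho p.2) else (rho p.2, rho p.1).
have gE p : p \in l -> [set (g p).1; (g p).2] = [set rho p.1; rho p.2] /\ ((g p).1 < (g p).2)%N.
  move=> pl; have n := adj_neq (hrho p pl); rewrite /g.
  case: ifPn => [h|]; first by split.
  rewrite -leqNgt leq_eqVlt => /orP[/eqP/val_inj E|h] /=; last by rewrite finset.setUC.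
  by rewrite E eqxx in n.
have ig : {in l &, injective g}.
  move=> p q pl ql E; apply: (image_edges_inj wl irho) => //.
  by have [<- _] := gE p pl; have [<- _] := gE q ql; rewrite E.
rewrite /edgeprod -[LHS]big_filter [LHS](perm_big [seq g p | p <- l]); last first.
  apply: uniq_perm.
  - by rewrite filter_uniq// index_enum_uniq.
  - by rewrite map_inj_in_uniq//; case/andP: wl.
  move=> [a b]; rewrite mem_filter mem_index_enum andbT /=; apply/andP/mapP.
    move=> [ab adjab]; have /mapP[p pl E] := image_edges_all wl irho hrho sl adjab.
    exists p => //; have [e1 o1] := gE p pl.
    move: e1 o1; rewrite -E; case: (g p) => c d /= /set2_inj[[-> ->]//|[-> ->] h].
    by have := ltn_trans ab h; rewrite ltnn.
  move=> [p pl E]; have [e1 o1] := gE p pl; move: e1 o1; rewrite -E /= => e1 o1.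
  by split => //; rewrite /adj e1; exact: hrho.
rewrite big_map; apply: eq_bigr => p _.
by rewrite /g; case: ifP => //= _; rewrite symV.
Qed.

(** After renaming the vertices of H along the embedding, the vertices that the
code does not meet do not occur in the product and average out. *)
Lemma hom_density_represents (U : T * T -> T) l (H : graph) :
  (forall z, @unit_square R z -> U z = V z) -> wf l -> represents l H ->
  hom_density H U = dens l.
Proof.
move=> UV wl [[rho [irho hrho]] sl].
rewrite (hom_density_avgs H (fun=> 0) bV UV).
(* numbers outside the code are sent beyond n to keep r injective *)
pose n := nverts H; pose r i := if i \in verts l then nat_of_ord (rho i) else (i + n)%N.
have ir : injective r.
  move=> i j; rewrite /r; case: ifP => il; case: ifP => jl.
  - by move=> /val_inj; exact: irho.
  - by have := ltn_ord (rho i); rewrite -/n; lia.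
  - by have := ltn_ord (rho j); rewrite -/n; lia.
  - by move=> /addIn.
have -> : edgeprod H V = fun x => wprod unif V (weigh l) (x \o r).
  apply/funext => x; rewrite (edgeprod_represents x wl irho hrho sl) wprod_weigh.
  rewrite big_seq [RHS]big_seq; apply: eq_bigr => p pl /=.
  by rewrite /r verts1// verts2.
have uv : uniq (map r (verts l)) by rewrite map_inj_uniq// undup_uniq.
pose rest := [seq i <- iota 0 n | i \notin map r (verts l)].
have pr : perm_eq (iota 0 n) (map r (verts l) ++ rest).
  apply: uniq_perm; first exact: iota_uniq.
    rewrite cat_uniq uv filter_uniq ?iota_uniq// andbT; apply/hasPn => i.
    by rewrite mem_filter => /andP[].
  move=> i; rewrite mem_cat mem_filter; case: (boolP (i \in map r _)) => //= /mapP[j jl ->].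
  by rewrite mem_iota /= add0n /r jl ltn_ord.
rewrite (perm_avgs _ _ pr); last by apply: good_reindex; exact: good_wprod.
rewrite avgs_cat (_ : avgs unif rest _ = fun x => wprod unif V (weigh l) (x \o r)).
  by rewrite avgs_rename.
apply: avgs_indep => v; rewrite mem_filter => /andP[vn _] x s; rewrite !wprod_weigh.
have vE i : i \in verts l -> (upd x v s \o r) i = (x \o r) i.
  by move=> il; rewrite /upd /=; case: eqP => // E; move: vn; rewrite -E map_f.
by rewrite big_seq [RHS]big_seq; apply: eq_bigr => p pl; rewrite !vE ?verts1 ?verts2.
Qed.

Definition deg (s : T) : R := mean unif (fun t => V (t, s)).

Lemma bdd_deg : bddmeas deg.
Proof. exact: bddmeas_mean2 bV. Qed.

(** Averaging over the leaf a first turns the factor of its edge into deg, which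
is zero in mean square; Cauchy-Schwarz kills the product with the rest. *)
Lemma hom_density_leaf (U : T * T -> T) (H : graph) :
  (forall z, @unit_square R z -> U z = V z) ->
  mean unif (fun s => deg s ^+ 2) = 0 -> ~ noleaf H -> hom_density H U = 0.
Proof.
move=> UV d0 nl.
have [a [b [ab hab]]] : exists a b : 'I_(nverts H), adj a b /\ forall c, adj a c -> c = b.
  apply: contrapT => h; apply: nl => a b ab; apply: contrapT => h2; apply: h.
  by exists a, b; split => // c ac; apply: contrapT => /eqP cb; apply: h2; exists c.
have nab := adj_neq ab.
rewrite (hom_density_avgs H (fun=> 0) bV UV).
pose p0 := if (a < b)%N then (a, b) else (b, a).
pose rst x := \prod_(p : 'I_(nverts H) * 'I_(nverts H) |
   ((p.1 < p.2)%N && adj p.1 p.2) && (p != p0)) V (x (nat_of_ord p.1), x (nat_of_ord p.2)).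
have p0c : (p0.1 < p0.2)%N && adj p0.1 p0.2.
  rewrite /p0; case: ifPn => [/= ->//|].
  rewrite -leqNgt leq_eqVlt => /orP[/eqP/val_inj E|h] /=; last by rewrite h adj_sym.
  by rewrite E eqxx in nab.
have -> : edgeprod H V = fun x => rst x * V (x a, x b).
  apply/funext => x; rewrite /edgeprod (bigD1 p0)//= mulrC; congr (_ * _).
  by rewrite /p0; case: ifP => //= _; rewrite symV.
have grst : good rst by apply: good_prod => p; exact: good_coord2.
have irst : indep a rst.
  move=> x s; apply: eq_bigr => -[c d] /= /andP[/andP[cd acd] np].
  have ca : c != a.
    apply: contraNneq np => E; move: acd cd; rewrite E => /hab -> cd.
    by rewrite /p0 cd.
  have da : d != a.
    apply: contraNneq np => E; move: acd cd; rewrite E adj_sym => /hab -> cd.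
    by rewrite /p0 ltnNge (ltnW cd).
  by rewrite /upd !val_eqE (negbTE ca) (negbTE da).
have an : nat_of_ord a \in iota 0 (nverts H) by rewrite mem_iota add0n ltn_ord.
have bn : nat_of_ord b \in rem (nat_of_ord a) (iota 0 (nverts H)).
  by rewrite mem_rem_uniq ?iota_uniq// !inE val_eqE eq_sym nab mem_iota add0n ltn_ord.
set vs := rem _ _ in bn.
have gV : good (fun x : nat -> T => V (x a, x b)) by exact: good_coord2.
rewrite (@perm_avgs _ _ _ _ _ (vs ++ [:: nat_of_ord a])); last first.
- by rewrite (permPl (perm_to_rem an)) -cat1s perm_catC.
- exact: goodM.
rewrite avgs_cat /= avgMl//.
have -> : avg unif a (fun x : nat -> T => V (x a, x b)) = fun x => deg (x b).
  apply/funext => x; rewrite /avg /deg; congr mean; apply/funext => s.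
  by rewrite /upd eqxx val_eqE eq_sym (negbTE nab).
rewrite (_ : (fun x => _) = (fun x : nat -> T => deg (x b) * rst x)); last by apply/funext => x; rewrite mulrC.
have gd : good (fun x : nat -> T => deg (x b)) by apply: good_coord1; exact: bdd_deg.
apply: avgs_cauchy => //.
have gd2 : good (fun x : nat -> T => deg (x b) ^+ 2) by exact: goodM.
rewrite (@perm_avgs _ _ _ _ _ (nat_of_ord b :: rem (nat_of_ord b) vs))//; last exact: perm_to_rem.
rewrite /= avgs_indep; first by rewrite (mean_sub unif _ (fun s => deg s ^+ 2)).
move=> v vv x s; rewrite /upd; case: eqP => // E; move: vv; rewrite -E mem_rem_uniq.
  by rewrite !inE eqxx.
by rewrite rem_uniq// iota_uniq.
Qed.

(** The vertices of degree two are averaged out first, in the order vs1. *)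
Lemma dens_contract vs1 vs2 l l' : contracts vs1 (weigh l) = Some l' ->
  perm_eq (verts l) (vs2 ++ rev vs1) -> dens l = avgs unif vs2 (wprod unif V l') (fun=> 0).
Proof.
move=> hc pl; rewrite /dens (perm_avgs _ _ pl); last exact: good_wprod.
by rewrite avgs_cat (contractsP unif bV symV hc).
Qed.

Local Notation tau := (tau unif V).
Local Notation mean := (mean unif).

Lemma dens_C k : k \in [:: 4; 6; 8; 10]%N -> dens (lC k) = mean (tau k).
Proof.
rewrite !inE => /or4P[] /eqP->.
- by rewrite (@dens_contract (iota 1 3) [:: 0%N] _ [:: (0, 0, 4)%N])// avgs_loop.
- by rewrite (@dens_contract (iota 1 5) [:: 0%N] _ [:: (0, 0, 6)%N])// avgs_loop.
- by rewrite (@dens_contract (iota 1 7) [:: 0%N] _ [:: (0, 0, 8)%N])// avgs_loop.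
- by rewrite (@dens_contract (iota 1 9) [:: 0%N] _ [:: (0, 0, 10)%N])// avgs_loop.
Qed.

Definition tri_code k l : Prop := (k, l) \in [:: (3, 3); (3, 5); (3, 7); (5, 5)]%N.

Lemma dens_CC k l : tri_code k l -> dens (lCC k l) = mean (fun s => tau k s * tau l s).
Proof.
rewrite /tri_code !inE => /or4P[] /eqP[-> ->].
- by rewrite (@dens_contract [:: 3; 4; 1; 2]%N [:: 0%N] _ [:: (0, 0, 3); (0, 0, 3)]%N)// avgs_loop2.
- by rewrite (@dens_contract (iota 3 4 ++ [:: 1; 2]%N) [:: 0%N] _ [:: (0, 0, 3); (0, 0, 5)]%N)// avgs_loop2.
- by rewrite (@dens_contract (iota 3 6 ++ [:: 1; 2]%N) [:: 0%N] _ [:: (0, 0, 3); (0, 0, 7)]%N)// avgs_loop2.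
- by rewrite (@dens_contract (iota 5 4 ++ iota 1 4) [:: 0%N] _ [:: (0, 0, 5); (0, 0, 5)]%N)// avgs_loop2.
Qed.

Lemma dens_CuC k l : tri_code k l -> dens (lCuC k l) = mean (tau k) * mean (tau l).
Proof.
rewrite /tri_code !inE => /or4P[] /eqP[-> ->].
- by rewrite (@dens_contract [:: 4; 5; 1; 2]%N [:: 0; 3]%N _ [:: (0, 0, 3); (3, 3, 3)]%N)// avgs_loop_loop.
- by rewrite (@dens_contract (iota 4 4 ++ [:: 1; 2]%N) [:: 0; 3]%N _ [:: (0, 0, 3); (3, 3, 5)]%N)// avgs_loop_loop.
- by rewrite (@dens_contract (iota 4 6 ++ [:: 1; 2]%N) [:: 0; 3]%N _ [:: (0, 0, 3); (3, 3, 7)]%N)// avgs_loop_loop.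
- by rewrite (@dens_contract (iota 6 4 ++ iota 1 4) [:: 0; 5]%N _ [:: (0, 0, 5); (5, 5, 5)]%N)// avgs_loop_loop.
Qed.

Lemma dens_CPC k n l : (k, n, l) \in [:: (3, 2, 3); (3, 2, 5); (3, 4, 3)]%N ->
  dens (lCPC k n l) = mean (fun s => tau k s * kapp unif V n (tau l) s).
Proof.
rewrite !inE => /or3P[] /eqP[-> -> ->].
- by rewrite (@dens_contract [:: 5; 6; 3; 1; 2]%N [:: 0; 4]%N _
    [:: (0, 0, 3); (0, 4, 2); (4, 4, 3)]%N)// avgs_dumbbell.
- by rewrite (@dens_contract (iota 5 4 ++ [:: 3; 1; 2])%N [:: 0; 4]%N _
    [:: (0, 0, 3); (0, 4, 2); (4, 4, 5)]%N)// avgs_dumbbell.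
- by rewrite (@dens_contract (iota 7 2 ++ [:: 3; 4; 5; 1; 2])%N [:: 0; 6]%N _
    [:: (0, 0, 3); (0, 6, 4); (6, 6, 3)]%N)// avgs_dumbbell.
Qed.

(** A triangle hanging at u contributes the factor tau_3(u), zero in mean
square. *)
Lemma avgs_pendant u vs l x : u \in vs -> uniq vs -> mean (fun s => tau 3 s ^+ 2) = 0 ->
  avgs unif vs (wprod unif V ((u, u, 3%N) :: l)) x = 0.
Proof.
move=> uvs uqvs t0; rewrite wprod_cons.
have gt : good (fun x : nat -> T => tau 3 (x u)) by apply: good_coord1; exact: bdd_tau.
apply: (avgs_cauchy gt (good_wprod unif bV l)).
have gt2 : good (fun x : nat -> T => tau 3 (x u) ^+ 2) by exact: goodM.
rewrite (perm_avgs _ gt2 (perm_to_rem uvs)) /= avgs_indep.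
  by rewrite (mean_sub unif _ (fun s => tau 3 s ^+ 2)).
move=> v vv y s; have uv : u != v.
  by apply: contraTneq vv => <-; rewrite mem_rem_uniq// !inE eqxx.
by rewrite /upd (negbTE uv).
Qed.

(** Here one of the triangles hangs at vertex 5, and the bowtie is attached to it
through a vertex of degree three. *)
Lemma dens_T3_0 : mean (fun s => tau 3 s ^+ 2) = 0 -> dens lT3 = 0.
Proof.
move=> t0; rewrite (@dens_contract [:: 3; 4; 6; 7; 2]%N [:: 0; 1; 5]%N _
  [:: (1, 0, 2); (5, 5, 3); (0, 0, 3); (0, 1, 1); (1, 5, 1)]%N)//.
rewrite (perm_wprod unif V (_ : perm_eq _
  [:: (5, 5, 3); (1, 0, 2); (0, 0, 3); (0, 1, 1); (1, 5, 1)]%N))//.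
exact: avgs_pendant.
Qed.

Lemma dens_T2_0 : mean (fun s => tau 3 s ^+ 2) = 0 -> dens lT2 = 0.
Proof.
move=> t0; rewrite (@dens_contract [:: 3; 4; 6; 7; 1; 2]%N [:: 0; 5]%N _
  [:: (0, 0, 3); (5, 5, 3); (0, 0, 3); (0, 5, 1)]%N)//.
exact: avgs_pendant.
Qed.

(** One of the three triangles is a component of its own and contributes the
factor t(C_3, V). *)
Lemma dens_T1_0 : mean (tau 3) = 0 -> dens lT1 = 0.
Proof.
move=> t0; rewrite (@dens_contract [:: 4; 5; 7; 8; 1; 2]%N [:: 3; 6; 0]%N _
  [:: (0, 0, 3); (6, 6, 3); (3, 3, 3); (3, 6, 1)]%N); [|by []|by []].
rewrite wprod_cons (_ : [:: 3; 6; 0]%N = [:: 3; 6]%N ++ [:: 0]%N); [|by []].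
rewrite avgs_cat /=.
rewrite (_ : (fun x => _) = (fun x => wprod unif V [:: (6, 6, 3); (3, 3, 3); (3, 6, 1)]%N x
    * tau 3 (x 0%N))); last by apply/funext => x; rewrite mulrC.
rewrite avgMl; [|exact: indep_wprod|by apply: good_coord1; exact: bdd_tau].
rewrite (_ : (fun x => _) = fun=> 0); last first.
  by apply/funext => x; rewrite (mean_sub unif _ (tau 3)) t0 mulr0.
by rewrite /avg !mean_cst.
Qed.

Lemma dens_P2 : dens lP2 = mean (fun s => deg s ^+ 2).
Proof.
rewrite /dens (_ : verts lP2 = [:: 0; 1; 2]%N)// (@perm_avgs _ _ _ _ _ [:: 1; 0; 2]%N)//; last exact: good_wprod.
rewrite /avgs/= /avg; congr (mean _); apply/funext => s.
transitivity (mean (fun t => V (t, s) * deg s)).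
  congr (mean _); apply/funext => t; rewrite /deg -meanZ; last exact: bdd_pair2 bV.
  congr (mean _); apply/funext => r; rewrite /wprod !big_cons big_nil mulr1 /ew /kpow /upd /=.
  by rewrite (symV s r).
rewrite expr2 {2}/deg -meanZ; last exact: bdd_pair2 bV.
by congr (mean _); apply/funext => t; rewrite mulrC.
Qed.

Lemma dens_K2K2_ge0 : 0 <= dens lK2K2.
Proof.
rewrite (_ : dens _ = mean deg ^+ 2) ?sqr_ge0//.
rewrite /dens (_ : verts lK2K2 = [:: 0; 2; 1; 3]%N)// (@perm_avgs _ _ _ _ _ [:: 1; 3; 0; 2]%N)//; last exact: good_wprod.
rewrite /avgs/= /avg expr2 -meanZ; last exact: bdd_deg.
congr (mean _); apply/funext => s; rewrite mulrC -meanZ; last exact: bdd_deg.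
congr (mean _); apply/funext => t; rewrite {1}/deg mulrC -meanZ; last exact: bdd_pair2 bV.
congr (mean _); apply/funext => r; rewrite mulrC /deg -meanZ; last exact: bdd_pair2 bV.
by congr (mean _); apply/funext => q; rewrite /wprod !big_cons big_nil mulr1 /ew /kpow /upd /=.
Qed.

End CodeDensity.

(** * Coefficients of a deck in closed form *)

Section Counting.
Local Open Scope nat_scope.
Implicit Types (D : seq graph) (l : ecode).

(** Counting through codes needs no reference graph, and embeddings of codes
transfer directly to counts. *)
Definition cnt D l : nat :=
  \sum_(G <- D) count (fun H => `[< represents l H >]) (subgraphs (size l) G).

Lemma eq_big_In (S : Type) (idx : S) (op : S -> S -> S) (I : Type) (r : seq I) (F F' : I -> S) :
  (forall x, List.In x r -> F x = F' x) ->
  \big[op/idx]_(x <- r) F x = \big[op/idx]_(x <- r) F' x.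
Proof.
elim: r => [|x r IH] h; first by rewrite !big_nil.
by rewrite !big_cons h; [rewrite IH// => y yr; apply: h; right|left].
Qed.

Lemma eq_count_In (I : Type) (r : seq I) (a b : pred I) :
  (forall x, List.In x r -> a x = b x) -> count a r = count b r.
Proof.
elim: r => //= x r IH h; rewrite h; last by left.
by rewrite IH// => y yr; apply: h; right.
Qed.

Lemma count_In_gt0 (I : Type) (r : seq I) (a : pred I) x : List.In x r -> a x -> 0 < count a r.
Proof.
elim: r => //= y r IH [->|/IH h] ax; first by rewrite ax.
by rewrite addn_gt0 h ?orbT.
Qed.

Lemma cnt_subgraph_count D l X : wf l -> l != [::] -> represents l X ->
  subgraph_count D X = cnt D l.
Proof.
move=> wl l0 rX; have [eX sX] := rX; rewrite /subgraph_count sX.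
apply: eq_big_In => G _; apply: eq_count_In => H HG.
apply/idP/asboolP => [XH|]; last exact: represents_iso.
by split; [exact: iso_emb XH eX|exact: subgraph_nedges HG].
Qed.

Lemma cnt_gt0 D G l : wf l -> List.In G D -> emb l (@adj G) -> 0 < cnt D l.
Proof.
move=> wl GD lG; have [H HG lH] := emb_exists_subgraph wl lG.
have : 0 < count (fun H => `[< represents l H >]) (subgraphs (size l) G).
  apply: (count_In_gt0 HG); apply/asboolP; split => //; exact: subgraph_nedges HG.
move: GD; rewrite /cnt; elim: D => //= G' D IH [->|/IH h] p.
  by rewrite big_cons addn_gt0 p.
by rewrite big_cons addn_gt0 h ?orbT.
Qed.

Lemma has_In (I : Type) (r : seq I) (a : pred I) : 0 < count a r -> exists x, List.In x r /\ a x.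
Proof.
elim: r => //= x r IH; case: (boolP (a x)) => [ax _|_ /IH[y [yr ay]]].
  by exists x; split => //; left.
by exists y; split => //; right.
Qed.

(** A subgraph of type l' contains one of type l. *)
Lemma cnt_emb D l l' : wf l -> embedsb l l' -> cnt D l = 0 -> cnt D l' = 0.
Proof.
move=> wl ll' l0; apply/eqP; rewrite -leqn0 leqNgt; apply/negP => h.
suff [G [GD hG]] : exists G, List.In G D /\ emb l' (@adj G).
  have := cnt_gt0 wl GD (emb_trans (@adj_sym G) (embedsb_emb ll') hG).
  by rewrite l0.
move: h; rewrite /cnt; elim: D {l0} => [|G D IH]; first by rewrite big_nil.
rewrite big_cons addn_gt0 => /orP[|/IH[G' [G'D h]]]; last by exists G'; split => //; right.
move=> /has_In[H [HG /asboolP[h _]]].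
by exists G; split; [left|exact: emb_subgraph HG h].
Qed.

End Counting.

Section Coefficients.
Context (R : realType).
Local Open Scope ring_scope.
Local Notation T := (measurableTypeR R).
Local Notation unif := (@unif R).
Variables (U V : T * T -> T).
Hypothesis bV : bddmeas (V : T * T -> R).
Hypothesis symV : forall x y, V (x, y) = V (y, x).
Hypothesis UV : forall z, @unit_square R z -> U z = V z.
Implicit Type D : seq graph.

Local Notation dens := (dens V).

(** Each k-edge subgraph is represented by at most one of the types, and has
density zero when it is represented by none. *)
Lemma coeff_types D k types : all (fun t => wf t && (size t == k)) types ->
  incomparable types ->
  (forall G H, List.In G D -> List.In H (subgraphs k G) ->
     (exists2 t, t \in types & represents t H) \/ hom_density H U = 0) ->
  uniq types ->
  coeff D U k = \sum_(t <- types) (cnt D t)%:R * dens t.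
Proof.
move=> /allP wt it hD ut.
have wts : all wf types by apply/allP => t /wt/andP[].
have val G H : List.In G D -> List.In H (subgraphs k G) ->
    hom_density H U = \sum_(t <- types) (`[< represents t H >] : nat)%:R * dens t.
  move=> GD HG; have [[t tt rt]|h0] := hD G H GD HG; last first.
    rewrite h0 big_seq big1// => t tt.
    case: (asboolP (represents t H)) => rt; last by rewrite mul0r.
    have /andP[wft _] := wt t tt.
    by rewrite mul1r -(hom_density_represents bV symV UV wft rt).
  have /andP[wft _] := wt t tt.
  rewrite (hom_density_represents bV symV UV wft rt) (bigD1_seq t)//= big_seq_cond big1.
    by rewrite addr0 (asboolT rt) mul1r.
  move=> t' /andP[tt' nt]; case: (asboolP (represents t' H)) => rt'; last by rewrite mul0r.
  by rewrite (incomparableP it wts tt' tt rt' rt) eqxx in nt.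
rewrite /coeff.
transitivity (\sum_(G <- D) \sum_(H <- subgraphs k G) \sum_(t <- types)
    (`[< represents t H >] : nat)%:R * dens t).
  by apply: eq_big_In => G GD; apply: eq_big_In => H HG; exact: val GD HG.
under eq_bigr => G _ do rewrite exchange_big.
rewrite exchange_big /=; apply: eq_big_seq => t tt.
have /andP[_ /eqP st] := wt t tt.
rewrite /cnt natr_sum mulr_suml; apply: eq_bigr => G _.
rewrite -mulr_suml st -sum1_count natr_sum; congr (_ * _).
by rewrite [RHS]big_mkcond/=; apply: eq_bigr => H _; case: `[< _ >].
Qed.

Lemma coeff_2 D : coeff D U 2 = (cnt D lP2)%:R * mean unif (fun s => deg V s ^+ 2)
  + (cnt D lK2K2)%:R * dens lK2K2.
Proof.
rewrite (@coeff_types D 2 [:: lP2; lK2K2])//; last first.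
  move=> G H _ HG; left; have [h|h] := two_edges (subgraph_nedges HG).
    by exists lP2; rewrite ?mem_head.
  by exists lK2K2; rewrite // !inE eqxx orbT.
by rewrite big_cons big_seq1 (dens_P2 bV symV).
Qed.

Hypothesis d0 : mean unif (fun s => deg V s ^+ 2) = 0.

(** A subgraph with a leaf has density zero, one with a shorter even cycle does
not occur, and the classification covers all the others. *)
Lemma coeff_classified D k types : classified k types ->
  all (fun t => wf t && (size t == k)) types -> incomparable types -> uniq types -> (1 < k)%N ->
  (forall c, c \in [seq c <- [:: 4; 6; 8] | c < k]%N -> cnt D (lC c) = 0%N) ->
  coeff D U k = \sum_(t <- types) (cnt D t)%:R * dens t.
Proof.
move=> cl wt it ut k1 ev; apply: coeff_types => // G H GD HG.
have [nl|nl] := pselect (noleaf H); last first.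
  right; exact: (@hom_density_leaf R V bV symV U H UV d0 nl).
have st : all (fun t => size t == k) types.
  by apply/allP => t /(allP wt)/andP[].
have [[c hc he]|] := classifiedP cl st k1 nl (subgraph_nedges HG); last by left.
have eG := emb_subgraph HG he.
have cc : embedsb (lC c) (cyc c) && wf (lC c).
  by move: hc; rewrite mem_filter !inE => /andP[_ /or3P[] /eqP->]; vm_compute.
have [c1 c2] := andP cc.
have := cnt_gt0 c2 GD (emb_trans (@adj_sym G) (embedsb_emb c1) eG).
by rewrite (ev _ hc).
Qed.

Lemma classified2 : classified 2 [::]. Proof. by vm_compute. Qed.

(** The empty list classifies the 2-edge graphs of minimum degree two. *)
Lemma coeff_2_0 D : coeff D U 2 = 0.
Proof. by rewrite (coeff_classified classified2)// big_nil. Qed.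

Local Notation N := (fun D l => (cnt D l)%:R : R).
Local Notation tau := (tau unif (V : T * T -> R)).
Local Notation mean := (mean unif).
Local Notation kapp := (kapp unif (V : T * T -> R)).

Lemma coeff_4 D : coeff D U 4 = N D (lC 4) * mean (tau 4).
Proof.
by rewrite (coeff_classified classified4)// big_seq1 (@dens_C _ _ bV symV 4%N).
Qed.

Lemma coeff_6 D : cnt D (lC 4) = 0%N -> coeff D U 6 =
  N D (lCC 3 3) * mean (fun s => tau 3 s * tau 3 s)
  + (N D (lCuC 3 3) * (mean (tau 3) * mean (tau 3)) + N D (lC 6) * mean (tau 6)).
Proof.
move=> h4; rewrite (coeff_classified classified6)//; last by move=> c; rewrite inE => /eqP->.
rewrite /types6 2!big_cons big_seq1.
rewrite (@dens_CC R V bV symV 3%N 3%N isT).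
rewrite (@dens_CuC R V bV symV 3%N 3%N isT).
rewrite (@dens_C R V bV symV 6%N isT).
exact: erefl.
Qed.

Lemma coeff_8 D : cnt D (lC 4) = 0%N -> cnt D (lC 6) = 0%N -> coeff D U 8 =
  N D (lCPC 3 2 3) * mean (fun s => tau 3 s * kapp 2 (tau 3) s)
  + (N D (lCC 3 5) * mean (fun s => tau 3 s * tau 5 s)
  + (N D (lCuC 3 5) * (mean (tau 3) * mean (tau 5)) + N D (lC 8) * mean (tau 8))).
Proof.
move=> h4 h6; rewrite (coeff_classified classified8)//; last first.
  by move=> c; rewrite !inE => /orP[] /eqP->.
rewrite /types8 3!big_cons big_seq1.
rewrite (@dens_CPC R V bV symV 3%N 2%N 3%N isT) (@dens_CC R V bV symV 3%N 5%N isT).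
rewrite (@dens_CuC R V bV symV 3%N 5%N isT) (@dens_C R V bV symV 8%N isT).
exact: erefl.
Qed.

Lemma coeff_10 D : cnt D (lC 4) = 0%N -> cnt D (lC 6) = 0%N -> cnt D (lC 8) = 0%N ->
  coeff D U 10 =
  N D lT3 * dens lT3 + (N D lT2 * dens lT2 + (N D lT1 * dens lT1
  + (N D (lCPC 3 4 3) * mean (fun s => tau 3 s * kapp 4 (tau 3) s)
  + (N D (lCPC 3 2 5) * mean (fun s => tau 3 s * kapp 2 (tau 5) s)
  + (N D (lCC 3 7) * mean (fun s => tau 3 s * tau 7 s)
  + (N D (lCuC 3 7) * (mean (tau 3) * mean (tau 7))
  + (N D (lCC 5 5) * mean (fun s => tau 5 s * tau 5 s)
  + (N D (lCuC 5 5) * (mean (tau 5) * mean (tau 5))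
  + N D (lC 10) * mean (tau 10))))))))).
Proof.
move=> h4 h6 h8; rewrite (coeff_classified classified10)//; last first.
  by move=> c; rewrite !inE => /or3P[] /eqP->.
rewrite /types10 9!big_cons big_seq1.
have E1 := @dens_CPC R V bV symV 3%N 4%N 3%N isT.
have E2 := @dens_CPC R V bV symV 3%N 2%N 5%N isT.
have E3 := @dens_CC R V bV symV 3%N 7%N isT.
have E4 := @dens_CuC R V bV symV 3%N 7%N isT.
have E5 := @dens_CC R V bV symV 5%N 5%N isT.
have E6 := @dens_CuC R V bV symV 5%N 5%N isT.
have E7 := @dens_C R V bV symV 10%N isT.
rewrite E1 E2 E3 E4 E5 E6 E7; exact: erefl.
Qed.

End Coefficients.

(** * Coefficients of a subdeck *)

Section SubdeckCoefficients.
Context (R : realType).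
Local Open Scope ring_scope.
Variable U : measurableTypeR R * measurableTypeR R -> measurableTypeR R.

Lemma sum_subgraphs k (G : graph) (F : graph -> R) :
  \sum_(H <- subgraphs k G) F H =
  \sum_(A : {set {set 'I_(nverts G)}} | (A \subset edges G) && (#|A| == k)) F (subgraph A).
Proof.
by rewrite /subgraphs big_map big_enum/=; apply: eq_bigl => A; rewrite inE.
Qed.

(** Double counting of the pairs of nested subgraphs with k and m edges. *)
Lemma coeff_subdeck n m k D : is_deck n D -> (k <= m)%N ->
  coeff (subdeck m D) U k = 'C(n - k, m - k)%:R * coeff D U k.
Proof.
move=> hD km; rewrite /coeff /subdeck big_flatten big_map mulr_sumr.
elim: D hD => [|G D IH]; first by rewrite !big_nil.
move=> /= /andP[/eqP nG hD]; rewrite !big_cons IH//; congr (_ + _).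
rewrite !sum_subgraphs mulr_sumr.
transitivity (\sum_(B : {set {set 'I_(nverts G)}} | (B \subset edges G) && (#|B| == m))
   \sum_(A : {set {set 'I_(nverts G)}} | (A \subset B) && (#|A| == k))
     hom_density (subgraph A) U).
  apply: eq_bigr => B /andP[BG _]; rewrite sum_subgraphs.
  by apply: eq_bigl => A; rewrite wf_subset_adj.
rewrite (exchange_big_dep (fun A : {set {set 'I_(nverts G)}} => (A \subset edges G) && (#|A| == k)))/=; last first.
  by move=> B A /andP[BG _] /andP[AB ->]; rewrite (fintype.subset_trans AB BG).
apply: eq_bigr => A /andP[AG /eqP Ak].
rewrite -nG -(card_between AG Ak km) sumr_const mulr_natl; congr (_ *+ _).
apply: eq_card => B; rewrite inE unfold_in /= Ak eqxx andbT andbC.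
by case: (A \subset B).
Qed.

Lemma coeff_sign D k : is_deck 10 D -> (k <= 8)%N ->
  exists2 c : R, 0 < c & coeff (subdeck 8 D) U k = c * coeff D U k.
Proof.
move=> hD k8; exists 'C(10 - k, 8 - k)%:R; last exact: coeff_subdeck hD k8.
by rewrite ltr0n bin_gt0; lia.
Qed.

End SubdeckCoefficients.

(** * Kernels with a prescribed spectrum *)

Section UniformMap.
Context (R : realType).
Local Open Scope classical_set_scope.
Local Open Scope ring_scope.
Local Notation T := (measurableTypeR R).
Local Notation unif := (@unif R).

Lemma bddmeas_sum d (S : measurableType d) (I : Type) (r : seq I) (F : I -> S -> R) :
  (forall i, bddmeas (F i)) -> bddmeas (fun x => \sum_(i <- r) F i x).
Proof.
move=> bF; elim: r => [|i r IH].
  by rewrite (_ : (fun x => _) = fun=> 0); [exact: bddmeas_cst|apply/funext => x; rewrite big_nil].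
rewrite (_ : (fun x => _) = fun x => F i x + \sum_(i <- r) F i x); first exact: bddmeasD.
by apply/funext => x; rewrite big_cons.
Qed.

Lemma mean_sum d (S : measurableType d) (P : probability S R) (I : Type) (r : seq I) (F : I -> S -> R) :
  (forall i, bddmeas (F i)) ->
  mean P (fun x => \sum_(i <- r) F i x) = \sum_(i <- r) mean P (F i).
Proof.
move=> bF; elim: r => [|i r IH].
  rewrite big_nil (_ : (fun x => _) = fun=> 0) ?mean_cst//.
  by apply/funext => x; rewrite big_nil.
rewrite big_cons -IH -meanD//; last exact: bddmeas_sum.
by congr mean; apply/funext => x; rewrite big_cons.
Qed.

Definition cell (n i : nat) : set T := `[(i%:R / n%:R : R), (i.+1%:R / n%:R : R)[.

Lemma cell_inj n i j x : (0 < n)%N -> cell n i x -> cell n j x -> i = j.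
Proof.
move=> n0; rewrite /cell /= !in_itv /= => /andP[a1 a2] /andP[b1 b2].
have n0R : (0 : R) < n%:R by rewrite ltr0n.
have h1 : (i < j.+1)%N.
  have := le_lt_trans a1 b2; rewrite ltr_pdivrMr// divfK ?gt_eqF//.
  by rewrite ltr_nat.
have h2 : (j < i.+1)%N.
  have := le_lt_trans b1 a2; rewrite ltr_pdivrMr// divfK ?gt_eqF//.
  by rewrite ltr_nat.
by apply/eqP; rewrite eqn_leq; move: h1 h2; rewrite !ltnS => -> ->.
Qed.

Lemma mean_cell n i : (i < n)%N -> mean unif (\1_(cell n i)) = n%:R^-1.
Proof.
move=> iltn; have mC : measurable (cell n i) by exact: measurable_itv.
have bC : bddmeas (\1_(cell n i) : T -> R) by exact: bddmeas_indic.
have n0R : (0 : R) < n%:R by rewrite ltr0n; case: n iltn {mC bC}.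
apply: EFin_inj; rewrite EFin_mean// integral_unif// integral_indic//.
rewrite setIidl; last first.
  move=> x; rewrite /cell /= !in_itv/= => /andP[a b]; apply/andP; split.
    by apply: le_trans a; rewrite divr_ge0.
  apply: ltW; apply: lt_le_trans b _.
  by rewrite ler_pdivrMr// mul1r ler_nat.
have E := @lebesgue_measure_itv R `[(i%:R / n%:R : R), (i.+1%:R / n%:R : R)[.
rewrite [LHS]E /= lte_fin ltr_pM2r ?invr_gt0// ltr_nat ltnSn.
by rewrite -EFinB -mulrBl -natrB// subSnn mul1r.
Qed.

(** Every uniform distribution on a nonempty finite set is realised by a map
on the unit interval, so kernels can be built from functions on that set. *)
Lemma uniform_map (Om : finType) (o : Om) : exists pi : T -> Om, forall g : Om -> R,
  bddmeas (fun x => g (pi x)) /\ mean unif (fun x => g (pi x)) = (\sum_w g w) / #|Om|%:R.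
Proof.
pose n := #|Om|; have n0 : (0 < n)%N by apply/card_gt0P; exists o.
pose pi (x : T) := if [pick i : 'I_n | x \in cell n i] is Some i then enum_val i else o.
exists pi => g.
have gE : (fun x => g (pi x)) =
    (fun x => g o + \sum_(i < n) (g (enum_val i) - g o) * \1_(cell n i) x).
  apply/funext => x; rewrite /pi; case: pickP => [i xi|h].
    rewrite (bigD1 i)//= indicE xi mulr1 big1 ?addr0 1?addrC ?subrK// => j ji.
    rewrite indicE; case: (boolP (x \in _)) => xj; last by rewrite mulr0.
    by move: ji; rewrite (ord_inj (cell_inj n0 (set_mem xj) (set_mem xi))) eqxx.
  by rewrite big1 ?addr0// => i _; rewrite indicE h mulr0.
have b1 i : bddmeas (fun x : T => (g (enum_val (i : 'I_n)) - g o) * \1_(cell n i) x).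
  by apply: bddmeasM; [exact: bddmeas_cst|apply: bddmeas_indic; exact: measurable_itv].
rewrite gE; split.
  by apply: bddmeasD; [exact: bddmeas_cst|exact: bddmeas_sum].
rewrite meanD; [|exact: bddmeas_cst|exact: bddmeas_sum].
rewrite mean_cst mean_sum//.
have -> : \sum_(i < n) mean unif (fun x : T => (g (enum_val i) - g o) * \1_(cell n i) x) =
    \sum_(i < n) (g (enum_val i) - g o) / n%:R.
  apply: eq_bigr => i _; rewrite meanZ ?mean_cell//.
  by apply: bddmeas_indic; exact: measurable_itv.
rewrite -mulr_suml sumrB sumr_const card_ord -[X in _ - X]mulr_natr.
rewrite mulrBl mulfK ?pnatr_eq0 -?lt0n// addrC subrK.
by congr (_ / _); rewrite [RHS](big_enum_val (A := Om)).
Qed.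

End UniformMap.

Section SpectralKernels.
Local Open Scope ring_scope.
Context d (T : measurableType d) (R : realType) (P : probability T R).
Variables (I : finType) (f : I -> T -> R) (n lam : I -> R).
Hypothesis bf : forall i, bddmeas (f i).
Hypothesis n0 : forall i, n i != 0.
Hypothesis orth : forall i j, mean P (fun s => f i s * f j s) = if i == j then n i else 0.

(** The kernel with eigenfunctions f i, of square norm n i, for the eigenvalues
lam i; its k-th power has the eigenvalues lam i ^+ k. *)
Definition spectral (k : nat) (z : T * T) : R :=
  \sum_i (lam i ^+ k / n i) * (f i z.1 * f i z.2).

Lemma bdd_spectral k : bddmeas (spectral k).
Proof.
apply: bddmeas_sum => i; apply: bddmeasM; first exact: bddmeas_cst.
by apply: bddmeasM; [exact: bdd_fst|exact: bdd_snd].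
Qed.

Lemma spectral_sym k x y : spectral k (x, y) = spectral k (y, x).
Proof. by apply: eq_bigr => i _ /=; rewrite [f i x * _]mulrC. Qed.

Lemma mean_spectral k x j : mean P (fun s => spectral k (x, s) * f j s) = lam j ^+ k * f j x.
Proof.
transitivity (mean P (fun s => \sum_i (lam i ^+ k / n i * f i x) * (f i s * f j s))).
  congr mean; apply/funext => s; rewrite mulr_suml; apply: eq_bigr => i _ /=; ring.
rewrite mean_sum; last first.
  by move=> i; apply: bddmeasM; [exact: bddmeas_cst|exact: bddmeasM].
under eq_bigr => i _ do rewrite (meanZ _ _ (bddmeasM (bf i) (bf j))) orth.
rewrite (bigD1 j)//= eqxx big1 => [|i /negbTE->]; last by rewrite mulr0.
by rewrite addr0 mulrAC divfK.
Qed.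

Lemma kpow_spectral k : kpow P (spectral 1) k.+1 = spectral k.+1.
Proof.
elim: k => [//|k IH]; rewrite kpowS IH; apply/funext => -[x y] /=.
transitivity (mean P (fun s => \sum_i (lam i ^+ k.+1 / n i * f i y) * (spectral 1 (x, s) * f i s))).
  congr mean; apply/funext => s; rewrite mulr_sumr; apply: eq_bigr => i _ /=; ring.
rewrite mean_sum; last first.
  move=> i; apply: bddmeasM; first exact: bddmeas_cst.
  by apply: bddmeasM => //; exact: bdd_pair1 (bdd_spectral 1).
apply: eq_bigr => i _; rewrite meanZ; last first.
  by apply: bddmeasM => //; exact: bdd_pair1 (bdd_spectral 1).
by rewrite mean_spectral /= expr1 [in RHS]exprS; ring.
Qed.

Lemma kapp_spectral k j : kapp P (spectral 1) k.+1 (f j) = fun x => lam j ^+ k.+1 * f j x.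
Proof. by apply/funext => x; rewrite /kapp kpow_spectral mean_spectral. Qed.

Lemma kapp_spectral0 k (g : T -> R) : bddmeas g -> (forall i, mean P (fun s => f i s * g s) = 0) ->
  kapp P (spectral 1) k.+1 g = fun=> 0.
Proof.
move=> bg g0; apply/funext => x; rewrite /kapp kpow_spectral.
transitivity (mean P (fun s => \sum_i (lam i ^+ k.+1 / n i * f i x) * (f i s * g s))).
  congr mean; apply/funext => s; rewrite mulr_suml; apply: eq_bigr => i _ /=; ring.
rewrite mean_sum; last by move=> i; apply: bddmeasM; [exact: bddmeas_cst|exact: bddmeasM].
by rewrite big1// => i _; rewrite meanZ ?g0 ?mulr0//; exact: bddmeasM.
Qed.

End SpectralKernels.

(** * Kernels built from random signs *)

Section SignFunctions.
Local Open Scope ring_scope.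
Context (R : realType) (M : nat).

Definition cube : finType := {ffun 'I_M -> bool}.
Implicit Types (w : cube) (g : cube -> R).

(** The coordinates of a uniform point of the cube are independent random signs. *)
Definition coord (i : 'I_M) w : R := (-1) ^+ (w i : nat).
Definition flipc (i : 'I_M) w : cube := [ffun j => if j == i then ~~ w j else w j].
Definition cavg g : R := (\sum_w g w) / #|cube|%:R.

Lemma flipcK i : involutive (flipc i).
Proof.
by move=> w; apply/ffunP => j; rewrite !ffunE; case: eqP => // _; rewrite negbK.
Qed.

Lemma coord_flip i j w : coord j (flipc i w) = (if j == i then -1 else 1) * coord j w.
Proof.
rewrite /coord ffunE; case: eqP => _; last by rewrite mul1r.
by case: (w j); rewrite /= ?expr0 ?expr1 ?mulrN1 ?opprK ?mulr1.
Qed.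

Lemma coord_sqr i w : coord i w * coord i w = 1.
Proof. by rewrite /coord -expr2 sqrr_sign. Qed.

(** Flipping one coordinate preserves the uniform distribution. *)
Lemma cavg_odd i g : (forall w, g (flipc i w) = - g w) -> cavg g = 0.
Proof.
move=> gi; rewrite /cavg (_ : \sum_w g w = 0) ?mul0r//.
have h : \sum_w g w = - \sum_w g w.
  rewrite [LHS](reindex_inj (inv_inj (flipcK i))) -sumrN.
  by apply: eq_bigr => w _; exact: gi.
by apply/eqP; move/eqP: h; rewrite -addr_eq0 -mulr2n mulrn_eq0.
Qed.

Lemma cavg_cst c : cavg (fun=> c) = c.
Proof.
rewrite /cavg sumr_const -[X in X / _]mulr_natr mulfK// pnatr_eq0 -lt0n.
by apply/card_gt0P; exists [ffun=> false].
Qed.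

Lemma cavgD g1 g2 : cavg (fun w => g1 w + g2 w) = cavg g1 + cavg g2.
Proof. by rewrite /cavg big_split/= mulrDl. Qed.

Lemma cavgZ c g : cavg (fun w => c * g w) = c * cavg g.
Proof. by rewrite /cavg -mulr_sumr mulrA. Qed.

Lemma cavg_coord i : cavg (coord i) = 0.
Proof. by apply: (@cavg_odd i) => w; rewrite coord_flip eqxx mulN1r. Qed.

End SignFunctions.

Section SignKernels.
Context (R : realType).
Local Open Scope ring_scope.
Local Notation T := (measurableTypeR R).
Local Notation unif := (@unif R).

(** A kernel built from a sign function h of mean zero.  On the half where
h = 1 it has eigenvalues with power sums A, on the half h = -1 the same ones
multiplied by eps, and besides h itself is an eigenfunction for mu, another sign
function one for - mu.  Constants are annihilated, so the degree is zero. *)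
Record sign_kernel (A : nat -> R) (eps mu : R) (V : T * T -> R) (h : T -> R) : Prop := {
  sk_bdd : bddmeas V;
  sk_sym : forall x y, V (x, y) = V (y, x);
  sk_bddh : bddmeas h;
  sk_sqr : forall x, h x * h x = 1;
  sk_mean : mean unif h = 0;
  sk_tau : forall k x, tau unif V k.+1 x =
    A k.+1 * ((1 + h x) + eps ^+ k.+1 * (1 - h x)) + (mu ^+ k.+1 + (- mu) ^+ k.+1);
  sk_kapp : forall k, kapp unif V k.+1 h = fun x => mu ^+ k.+1 * h x;
  sk_kapp1 : forall k c, kapp unif V k.+1 (fun=> c) = fun=> 0 }.

(** On a cube of random signs c0, c1, w_i, with h = c0, the eigenfunctions are
(1 + c0) w_i and (1 - c0) w_i, supported on the two halves, together with c0
and c1.  They are orthogonal because each product is odd in some coordinate or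
contains (1 + c0) (1 - c0) = 0. *)
Lemma sign_kernel_exists (m : nat) (lam0 : 'I_m -> R) (eps mu : R) :
  exists V h, sign_kernel (fun k => \sum_i lam0 i ^+ k) eps mu V h.
Proof.
pose Om := cube m.+2.
have [pi hpi] := uniform_map R ([ffun=> false] : Om).
have mpi (g : Om -> R) : mean unif (fun x => g (pi x)) = cavg g by case: (hpi g).
have bpi (g : Om -> R) : bddmeas (fun x : T => g (pi x)) by case: (hpi g).
pose c0 : 'I_m.+2 := ord0; pose c1 : 'I_m.+2 := lift ord0 ord0.
pose cw (i : 'I_m) : 'I_m.+2 := lift ord0 (lift ord0 i).
have c01 : (c0 == c1) = false by [].
have c10 : (c1 == c0) = false by [].
have c0w i : (c0 == cw i) = false by [].
have c1w i : (c1 == cw i) = false by [].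
have cww i j : (cw i == cw j) = (i == j).
  by rewrite /cw (inj_eq (@lift_inj _ _)) (inj_eq (@lift_inj _ _)).
pose I : finType := (('I_m * bool) + bool)%type.
pose sg (b : bool) : R := (-1) ^+ b.
pose fO (a : I) (w : Om) : R := match a with
  | inl (i, b) => (1 + sg b * coord R c0 w) * coord R (cw i) w
  | inr b => if b then coord R c0 w else coord R c1 w end.
pose n (a : I) : R := if a is inl _ then 2 else 1.
pose lam (a : I) : R := match a with
  | inl (i, b) => (if b then eps else 1) * lam0 i
  | inr b => if b then mu else - mu end.
pose f (a : I) (x : T) : R := fO a (pi x).
have fl := @coord_flip R m.+2.
have bf a : bddmeas (f a) by exact: bpi.
have n0 a : n a != 0 by case: a => a; rewrite /n ?oner_eq0// pnatr_eq0.
have orth a b : mean unif (fun s => f a s * f b s) = if a == b then n a else 0.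
  rewrite /f (mpi (fun w => fO a w * fO b w)).
  case: a => [[i a]|a]; case: b => [[j b]|b] /=.
  - have [ij|ij] := eqVneq i j; last first.
      rewrite (_ : _ == _ = false); last by apply/eqP => -[/eqP]; rewrite (negbTE ij).
      apply: (@cavg_odd _ _ (cw i)) => w; rewrite !fl !cww eqxx (eq_sym j) (negbTE ij) c0w; ring.
    rewrite -{j}ij; have [ab|ab] := eqVneq a b.
      rewrite -{b}ab eqxx.
      transitivity (cavg (fun w : Om => 2 + 2 * sg a * coord R c0 w)).
        congr cavg; apply/funext => w; have h1 := coord_sqr R c0 w; have h2 := coord_sqr R (cw i) w.
        have h3 : sg a * sg a = 1 by rewrite /sg -expr2 sqrr_sign.
        rewrite (_ : _ * _ = (1 + 2 * sg a * coord R c0 w + (sg a * sg a) * (coord R c0 w * coord R c0 w))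
           * (coord R (cw i) w * coord R (cw i) w)); last by ring.
        by rewrite h1 h2 h3; ring.
      by rewrite cavgD cavg_cst cavgZ cavg_coord mulr0 addr0.
    rewrite (_ : _ == _ = false); last by apply/eqP => -[/eqP]; rewrite (negbTE ab).
    rewrite -[RHS](@cavg_cst R m.+2 0); congr cavg; apply/funext => w.
    have h1 := coord_sqr R c0 w.
    have h4 : sg b = - sg a by case: a b ab => -[]// _; rewrite /sg /= ?expr1 ?expr0 ?opprK.
    have h3 : sg a * sg a = 1 by rewrite /sg -expr2 sqrr_sign.
    rewrite h4 (_ : _ * _ = (1 - (sg a * sg a) * (coord R c0 w * coord R c0 w))
           * (coord R (cw i) w * coord R (cw i) w)); last by ring.
    by rewrite h1 h3 mulr1 subrr mul0r.
  - apply: (@cavg_odd _ _ (cw i)) => w; rewrite !fl eqxx c0w c1w; case: b; ring.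
  - apply: (@cavg_odd _ _ (cw j)) => w; rewrite !fl eqxx c0w c1w; case: a; ring.
  - case: a b => -[] /=.
    + rewrite -[RHS](@cavg_cst R m.+2 1); congr cavg; apply/funext => w; exact: coord_sqr.
    + apply: (@cavg_odd _ _ c0) => w; rewrite !fl eqxx c10; ring.
    + apply: (@cavg_odd _ _ c0) => w; rewrite !fl eqxx c10; ring.
    + rewrite -[RHS](@cavg_cst R m.+2 1); congr cavg; apply/funext => w; exact: coord_sqr.
have f0 a c : mean unif (fun s => f a s * c) = 0.
  rewrite (mpi (fun w => fO a w * c)); case: a => [[i a]|[]] /=.
  - apply: (@cavg_odd _ _ (cw i)) => w; rewrite !fl eqxx c0w; ring.
  - apply: (@cavg_odd _ _ c0) => w; rewrite !fl eqxx; ring.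
  - apply: (@cavg_odd _ _ c1) => w; rewrite !fl eqxx; ring.
exists (spectral f n lam 1), (f (inr true)); split.
- exact: bdd_spectral.
- exact: spectral_sym.
- exact: bf.
- by move=> x; exact: coord_sqr.
- by rewrite -[RHS](f0 (inr true) 1); congr mean; apply/funext => x; rewrite mulr1.
- move=> k x; rewrite /tau kpow_spectral// /spectral big_sumType big_bool /=.
  have h0 := coord_sqr R c0 (pi x); have h1 := coord_sqr R c1 (pi x).
  rewrite /f /= h0 h1 !divr1 !mulr1; congr (_ + _).
  pose F i b := ((if b then eps else 1) * lam0 i) ^+ k.+1 / 2 *
    (fO (inl (i, b)) (pi x) * fO (inl (i, b)) (pi x)).
  rewrite (eq_bigr (fun p => F p.1 p.2)); last by case.
  rewrite -(pair_bigA _ F) mulr_suml; apply: eq_bigr => i _.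
  rewrite big_bool /F /= /sg expr0 expr1 mul1r.
  have hw := coord_sqr R (cw i) (pi x); set c := coord R c0 _ in h0 *.
  set w := coord R (cw i) _ in hw *.
  rewrite exprMn.
  rewrite (_ : (1 + -1 * c) * w * ((1 + -1 * c) * w) = (1 - 2 * c + c * c) * (w * w)); last by ring.
  rewrite (_ : (1 + 1 * c) * w * ((1 + 1 * c) * w) = (1 + 2 * c + c * c) * (w * w)); last by ring.
  by rewrite h0 hw; field.
- by move=> k; rewrite kapp_spectral.
- by move=> k c; apply: kapp_spectral0 => //; exact: bddmeas_cst.
Qed.

(** The eigenvalues are 2, N times, and - 1, m N times. *)
Lemma two_valued_kernel (N m : nat) (eps mu : R) : exists V h,
  sign_kernel (fun k => N%:R * 2 ^+ k + (m * N)%:R * (-1) ^+ k) eps mu V h.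
Proof.
pose s : seq R := nseq N 2 ++ nseq (m * N) (-1).
have [V [h hV]] := sign_kernel_exists (fun i : 'I_(size s) => s`_i) eps mu.
exists V, h; move: hV; congr sign_kernel; apply/funext => k.
rewrite -(big_mkord xpredT (fun i => s`_i ^+ k)) -(big_nth 0 xpredT (fun x => x ^+ k)).
by rewrite big_cat !big_nseq !iter_addr !addr0 !mulr_natl.
Qed.

Section Consequences.
Variables (A : nat -> R) (eps mu : R) (V : T * T -> R) (h : T -> R).
Hypothesis hV : sign_kernel A eps mu V h.
Let bV := sk_bdd hV.
Let symV := sk_sym hV.
Local Notation mean := (mean unif).
Local Notation tau := (tau unif V).
Local Notation kapp := (kapp unif V).

Lemma sk_deg0 : mean (fun s => deg V s ^+ 2) = 0.
Proof.
rewrite (_ : (fun s => _) = fun=> 0) ?mean_cst//; apply/funext => s.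
rewrite (_ : deg V s = 0) ?expr0n//.
have := congr1 (fun F => F s) (sk_kapp1 hV 0 1); rewrite /kapp /= => E.
rewrite -[RHS]E /deg; congr (mean _); apply/funext => t.
by rewrite mulr1 (sk_sym hV).
Qed.

Lemma sk_mean_tau k : mean (tau k.+1) = A k.+1 * (1 + eps ^+ k.+1) + (mu ^+ k.+1 + (- mu) ^+ k.+1).
Proof.
pose a := A k.+1 * (1 + eps ^+ k.+1) + (mu ^+ k.+1 + (- mu) ^+ k.+1).
pose b := A k.+1 * (1 - eps ^+ k.+1).
rewrite (_ : tau k.+1 = fun x => a + b * h x); last first.
  by apply/funext => x; rewrite (sk_tau hV) /a /b; ring.
have bh := sk_bddh hV.
rewrite meanD; [|exact: bddmeas_cst|by apply: bddmeasM => //; exact: bddmeas_cst].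
by rewrite mean_cst meanZ// (sk_mean hV) mulr0 addr0.
Qed.

Lemma sk_kernel : is_kernel V.
Proof.
have [mV [M VM]] := bV; split; first exact: measurable_funTS.
  by exists M => z _; exact: VM.
by move=> x y _; exact: symV.
Qed.

Lemma sk_nonzero : 0 < A 2 * (1 + eps ^+ 2) + (mu ^+ 2 + (- mu) ^+ 2) -> nonzero V.
Proof.
rewrite -sk_mean_tau => h2 hz.
have := zero_ae bV (fun z _ => erefl (V z)) hz.
by rewrite -(@mean_tau_even _ _ _ unif V bV symV 1)// => E; rewrite E ltxx in h2.
Qed.

End Consequences.

Section Split.
Variables (A : nat -> R) (mu : R) (V : T * T -> R) (h : T -> R).
Hypothesis hV : sign_kernel A (-1) mu V h.
Local Notation mean := (mean unif).
Local Notation tau := (tau unif V).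
Local Notation kapp := (kapp unif V).

(** With eps = -1 the two halves cancel in even functions of h for odd k, and so
do mu and - mu: tau_k is a multiple of h and its mean is zero. *)
Lemma split_tau k : odd k -> tau k = fun x => 2 * A k * h x.
Proof.
case: k => // k ok; apply/funext => x; rewrite (sk_tau hV).
have E : (-1) ^+ k.+1 = -1 :> R by rewrite -signr_odd ok expr1.
rewrite [(- mu) ^+ _]exprNn E; ring.
Qed.

Lemma split_mean k : odd k -> mean (tau k) = 0.
Proof.
move=> ok; rewrite split_tau// meanZ; last exact: sk_bddh hV.
by rewrite (sk_mean hV) mulr0.
Qed.

Lemma split_mean2 j k : odd j -> odd k -> mean (fun s => tau j s * tau k s) = 4 * A j * A k.
Proof.
move=> oj ok; rewrite !split_tau//.
rewrite (_ : (fun s => _) = fun=> 4 * A j * A k) ?mean_cst//; apply/funext => x.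
by rewrite (_ : _ * _ = 4 * A j * A k * (h x * h x)); [rewrite (sk_sqr hV) mulr1|ring].
Qed.

Lemma split_kapp n j k : (0 < n)%N -> odd j -> odd k ->
  mean (fun s => tau j s * kapp n (tau k) s) = 4 * mu ^+ n * A j * A k.
Proof.
case: n => // n _ oj ok; rewrite !split_tau//.
have -> : kapp n.+1 (fun x => 2 * A k * h x) = fun x => 2 * A k * (mu ^+ n.+1 * h x).
  have := sk_kapp hV n; rewrite /kapp => E; apply/funext => x.
  rewrite -(congr1 (fun F => F x) E) -meanZ; last first.
    by apply: bddmeasM; [exact: bdd_pair1 (bdd_kpow _ (sk_bdd hV) _)|exact: sk_bddh hV].
  by congr (mean _); apply/funext => s; ring.
rewrite (_ : (fun s => _) = fun=> 4 * mu ^+ n.+1 * A j * A k) ?mean_cst//; apply/funext => x.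
by rewrite (_ : _ * _ = 4 * mu ^+ n.+1 * A j * A k * (h x * h x)); [rewrite (sk_sqr hV) mulr1|ring].
Qed.

End Split.

Section Unsplit.
Variables (A : nat -> R) (V : T * T -> R) (h : T -> R).
Hypothesis hV : sign_kernel A 1 0 V h.
Local Notation mean := (mean unif).
Local Notation tau := (tau unif V).
Local Notation kapp := (kapp unif V).

(** With eps = 1 and mu = 0 the halves agree and tau_k is constant. *)
Lemma unsplit_tau k : (0 < k)%N -> tau k = fun=> 2 * A k.
Proof.
case: k => // k _; apply/funext => x; rewrite (sk_tau hV) oppr0 !expr0n expr1n /=; ring.
Qed.

Lemma unsplit_mean k : (0 < k)%N -> mean (tau k) = 2 * A k.
Proof. by move=> k0; rewrite unsplit_tau// mean_cst. Qed.

Lemma unsplit_mean2 j k : (0 < j)%N -> (0 < k)%N -> mean (fun s => tau j s * tau k s) = 4 * A j * A k.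
Proof. by move=> j0 k0; rewrite !unsplit_tau// mean_cst; ring. Qed.

Lemma unsplit_kapp n j k : (0 < n)%N -> (0 < j)%N -> (0 < k)%N ->
  mean (fun s => tau j s * kapp n (tau k) s) = 0.
Proof.
case: n => // n _ j0 k0; rewrite !unsplit_tau// (sk_kapp1 hV).
by rewrite (_ : (fun s => _) = fun=> 0) ?mean_cst//; apply/funext => s; rewrite mulr0.
Qed.

End Unsplit.
End SignKernels.

Local Opaque mean tau kapp kpow cnt dens coeff deg nonzero.

(** * Signs of the coefficients *)

Section Arithmetic.
Local Open Scope ring_scope.

Lemma natr_mul_eq0 (R : realFieldType) (k : nat) (t : R) : k%:R * t = 0 -> t = 0 \/ k = 0%N.
Proof.
by move/eqP; rewrite mulf_eq0 pnatr_eq0 => /orP[] /eqP; [right|left].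
Qed.

(** Two nonnegative terms with sum zero.  In this lemma and the next ones n stands
for counts and t for means: t33 of tau_3 tau_3, t3 of tau_3, and so on, a letter u
marking disjoint unions; k stands for dumbbells and d for T_1, T_2, T_3. *)
Lemma combine_6 (R : realFieldType) (n33 nu33 : nat) (t33 t3 : R) : 0 <= t33 ->
  n33%:R * t33 + nu33%:R * (t3 * t3) = 0 -> (t33 = 0 \/ n33 = 0%N) /\ (t3 = 0 \/ nu33 = 0%N).
Proof.
move=> t33_ge0 c6; have nn k : 0 <= k%:R :> R by exact: ler0n.
have h1 : 0 <= n33%:R * t33 by exact: mulr_ge0.
have h2 : 0 <= nu33%:R * (t3 * t3) by rewrite mulr_ge0// -expr2 sqr_ge0.
split; first by apply: natr_mul_eq0; lra.
have [/eqP|->] : t3 * t3 = 0 \/ nu33 = 0%N by apply: natr_mul_eq0; lra.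
  by rewrite mulf_eq0 orbb => /eqP->; left.
by right.
Qed.

(** The terms with C_3 o C_5 and C_3 u C_5 vanish as soon as the coefficient 6
does; only the dumbbell remains. *)
Lemma combine_8 (R : realFieldType) (n33 nu33 n323 n35 nu35 : nat) (t33 t3 t5 t35 k323 : R) :
  0 <= t33 -> (t33 = 0 -> t3 = 0 /\ t35 = 0) ->
  (n33 = 0%N -> n35 = 0%N) -> (n33 = 0%N -> nu33 = 0%N -> nu35 = 0%N) ->
  n33%:R * t33 + nu33%:R * (t3 * t3) = 0 ->
  n323%:R * k323 + (n35%:R * t35 + nu35%:R * (t3 * t5)) = n323%:R * k323.
Proof.
move=> t33_ge0 z33 h35 hu35 /(combine_6 t33_ge0)[[/z33[-> ->]|h33] e].
  by rewrite !(mul0r, mulr0, addr0).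
rewrite (h35 h33); case: e => [->|/(hu35 h33) ->]; by rewrite !(mul0r, mulr0, addr0).
Qed.

(** Only the dumbbells with 10 edges and C_5 o C_5 may survive besides C_10 and
the square of t(C_5).  They form a quadratic form in V^2 tau_3 and tau_5 whose
discriminant is controlled when no dumbbell C_3 o P_2 o C_3 occurs; when one
occurs, the coefficient 8 makes V tau_3 zero. *)
Lemma combine_10 (R : realFieldType)
    (n33 nu33 n323 n343 n325 n37 nu37 n55 nu55 nT1 nT2 nT3 n10 : nat)
    (t33 t3 t5 t7 t37 t55 k323 k343 k325 d1 d2 d3 t10 : R) :
  0 <= t33 -> 0 <= t55 ->
  (t33 = 0 -> [/\ t3 = 0, t37 = 0, k323 = 0, d2 = 0 & d3 = 0]) ->
  (t3 = 0 -> d1 = 0) ->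
  (k323 = 0 -> k343 = 0 /\ k325 = 0) ->
  (forall x y z : R, 0 <= x -> 0 <= z -> y ^+ 2 <= 4 * x * z ->
     0 <= x * k343 + y * k325 + z * t55) ->
  (n33 = 0%N -> nT2 = 0%N /\ nT3 = 0%N) -> (nu33 = 0%N -> nT1 = 0%N) ->
  (n33 = 0%N -> n37 = 0%N) -> (n33 = 0%N -> nu33 = 0%N -> nu37 = 0%N) ->
  (n33 = 0%N -> n323 = 0%N -> (n325 ^ 2 <= 4 * n343 * n55)%N) ->
  n33%:R * t33 + nu33%:R * (t3 * t3) = 0 ->
  n323%:R * k323 = 0 ->
  n10%:R * t10 <= nT3%:R * d3 + (nT2%:R * d2 + (nT1%:R * d1 + (n343%:R * k343
    + (n325%:R * k325 + (n37%:R * t37 + (nu37%:R * (t3 * t7) + (n55%:R * t55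
    + (nu55%:R * (t5 * t5) + n10%:R * t10)))))))).
Proof.
move=> t33_ge0 t55_ge0 z33 z3 z323 quad hT23 hT1 h37 hu37 hc c6 c8.
have n55_ge0 : 0 <= n55%:R * t55 by rewrite mulr_ge0 ?ler0n.
have nu55_ge0 : 0 <= nu55%:R * (t5 * t5) by rewrite mulr_ge0 ?ler0n// -expr2 sqr_ge0.
have [e33 eu33] := combine_6 t33_ge0 c6.
have -> : nT1%:R * d1 = 0 by case: eu33 => [/z3|/hT1] ->; rewrite ?mul0r ?mulr0.
have [t330|h33] := e33.
  have [e1 e2 /z323[e3 e4] e5 e6] := z33 t330.
  rewrite e1 e2 e3 e4 e5 e6 !(mul0r, mulr0, addr0, add0r); lra.
have [-> ->] := hT23 h33.
have -> : nu37%:R * (t3 * t7) = 0.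
  by case: eu33 => [->|/(hu37 h33)->]; rewrite ?mul0r ?mulr0.
rewrite (h37 h33) !(mul0r, mulr0, addr0, add0r).
suff : 0 <= n343%:R * k343 + n325%:R * k325 + n55%:R * t55 by lra.
have [/z323[-> ->]|h323] := natr_mul_eq0 c8; first by rewrite !mulr0 !add0r.
by apply: quad; rewrite ?ler0n// -natrX -!natrM ler_nat; exact: hc.
Qed.

Lemma drop_last2 (R : pzRingType) (x y z : R) (k : nat) : k = 0%N -> x + (y + k%:R * z) = x + y.
Proof. by move=> ->; rewrite mul0r addr0. Qed.

End Arithmetic.

Section Signs.
Context (R : realType).
Local Open Scope ring_scope.
Local Notation T := (measurableTypeR R).
Local Notation unif := (@unif R).
Local Notation mean := (mean unif).

Lemma evens8 k : evens 8 k -> k \in [:: 2; 4; 6; 8]%N.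
Proof. by move=> /and3P[k0 k8 ok]; move: k0 k8 ok; do 9 (case: k => [//|k]). Qed.

Lemma evens10 k : evens 10 k -> [\/ k = 2, k = 4, k = 6 | k = 8 \/ k = 10]%N.
Proof.
move=> /and3P[k0 k8 ok]; have : k \in [:: 2; 4; 6; 8; 10]%N.
  by move: k0 k8 ok; do 11 (case: k => [//|k]).
by rewrite !inE => /orP[/eqP->|/or4P[] /eqP->];
  [constructor 1|constructor 2|constructor 3|constructor 4; left|constructor 4; right].
Qed.

Lemma evens_8_10 k : evens 8 k -> evens 10 k.
Proof. by move=> /evens8; rewrite !inE => /or4P[] /eqP->. Qed.

Section Kernel.
Variables (U V : T * T -> T) (D : seq graph).
Hypothesis bV : bddmeas (V : T * T -> R).
Hypothesis symV : forall x y, V (x, y) = V (y, x).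
Hypothesis UV : forall z, @unit_square R z -> U z = V z.
Local Notation c := (coeff D U).
Local Notation n := (cnt D).
Local Notation tau := (tau unif (V : T * T -> R)).
Local Notation kapp := (kapp unif (V : T * T -> R)).
Local Notation degree_zero := (mean (fun s => deg V s ^+ 2) = 0).

Let mean_sqr_ge0 (f : T -> R) : 0 <= mean (fun s => f s ^+ 2).
Proof. by apply: mean_ge0 => s; exact: sqr_ge0. Qed.

(** The second term of the coefficient 2 is a multiple of the square of the
edge density. *)
Lemma coeff_2_cases : (0 < n lP2)%N -> 0 < c 2 \/ degree_zero.
Proof.
move=> P2_gt0.
have [d0|d0] := eqVneq (mean (fun s => deg V s ^+ 2)) 0; [by right|left].
rewrite (coeff_2 bV symV UV); apply: ltr_pwDl.
  by rewrite mulr_gt0 ?ltr0n// lt_neqAle eq_sym d0 mean_sqr_ge0.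
by rewrite mulr_ge0 ?ler0n ?dens_K2K2_ge0.
Qed.

(** Otherwise mean_tau_down and ae_zero would make the kernel zero. *)
Lemma mean_tau_gt0 k : (2 <= k)%N -> nonzero U -> 0 < mean (tau (k + k)).
Proof.
move=> k2 nz; rewrite lt_neqAle mean_tau_even_ge0// ?andbT; last by lia.
apply/eqP => /esym h; apply: nz.
have := ae_zero bV symV (mean_tau_down bV symV k2 h).
by apply: filterS => z hz zs; rewrite UV// hz.
Qed.

Let b3 := bdd_tau unif bV 3.
Let b5 := bdd_tau unif bV 5.
Let b7 := bdd_tau unif bV 7.

Lemma sqr_mean (f g : T -> R) : mean (fun s => f s * f s) = 0 -> bddmeas f -> bddmeas g ->
  mean (fun s => f s * g s) = 0.
Proof. by move=> f0 bf bg; exact: mean_cauchy. Qed.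

Lemma mean_le0 (f : T -> R) : bddmeas f -> mean (fun s => f s * f s) = 0 -> mean f = 0.
Proof.
move=> bf f0; rewrite -[RHS](sqr_mean f0 bf (bddmeas_cst _ 1)).
by congr (mean _); apply/funext => s; rewrite mulr1.
Qed.

(** For x > 0, multiply by 4 x and complete the square. *)
Lemma mean_quadratic (x y z : R) (f g : T -> R) : bddmeas f -> bddmeas g ->
  0 <= x -> 0 <= z -> y ^+ 2 <= 4 * x * z ->
  0 <= x * mean (fun s => f s * f s) + y * mean (fun s => f s * g s)
       + z * mean (fun s => g s * g s).
Proof.
move=> bf bg x0 z0 xyz.
have gg : 0 <= mean (fun s => g s * g s) by exact: mean_sqr_ge0.
have [x00|xn0] := eqVneq x 0.
  have y0 : y = 0.
    by apply/eqP; rewrite -sqrf_eq0 eq_le sqr_ge0 andbT (le_trans xyz)// x00 mulr0 mul0r.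
  by rewrite x00 y0 !mul0r !add0r mulr_ge0.
have xp : 0 < x by rewrite lt_neqAle eq_sym xn0.
have b1 : bddmeas (fun s => f s * f s) by exact: bddmeasM.
have b2 : bddmeas (fun s => f s * g s) by exact: bddmeasM.
have b4 : bddmeas (fun s => g s * g s) by exact: bddmeasM.
have bc (a : R) (u : T -> R) : bddmeas u -> bddmeas (fun s => a * u s).
  by move=> bu; apply: bddmeasM => //; exact: bddmeas_cst.
have sq : 0 <= mean (fun s => (2 * x * f s + y * g s) ^+ 2) by [].
rewrite (_ : (fun s => _) = fun s => 4 * x ^+ 2 * (f s * f s) +
  (4 * x * y * (f s * g s) + y ^+ 2 * (g s * g s))) in sq; last by apply/funext => s; ring.
rewrite meanD ?meanD ?meanZ// in sq; try by [apply: bc|apply: bddmeasD; apply: bc].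
rewrite -(pmulr_rge0 _ (_ : 0 < 4 * x)); last by rewrite mulr_gt0.
set a := mean (fun s => f s * f s) in sq *; set b := mean (fun s => f s * g s) in sq *.
set d := mean (fun s => g s * g s) in sq gg *.
have : 0 <= (4 * x * z - y ^+ 2) * d by rewrite mulr_ge0// subr_ge0.
nra.
Qed.

(** Half of the powers are moved to the left factor by self-adjointness. *)
Lemma kapp_even (f g : T -> R) i : bddmeas f -> bddmeas g -> (0 < i)%N ->
  mean (fun s => f s * kapp (i + i) g s) = mean (fun s => kapp i f s * kapp i g s).
Proof.
by move=> bf bg i0; rewrite (kappD unif bV bg i0 i0) (kapp_adj unif bV symV i bf (bdd_kapp unif bV i bg)).
Qed.

Hypothesis n4 : n (lC 4) = 0%N.
Hypothesis d0 : degree_zero.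

Lemma c6_ge : (n (lC 6))%:R * mean (tau 6) <= c 6.
Proof.
rewrite (coeff_6 bV symV UV d0 n4) addrA lerDr.
apply: addr_ge0; apply: (mulr_ge0 (ler0n _ _)); first exact: mean_sqr_ge0.
by rewrite -expr2 sqr_ge0.
Qed.

Hypothesis n6 : n (lC 6) = 0%N.
Hypothesis n35 : n (lCC 3 3) = 0%N -> n (lCC 3 5) = 0%N.
Hypothesis nu35 : n (lCC 3 3) = 0%N -> n (lCuC 3 3) = 0%N -> n (lCuC 3 5) = 0%N.

Let bk i (f : T -> R) : bddmeas f -> bddmeas (kapp i f).
Proof. exact: bdd_kapp. Qed.

Let kapp_even3 : mean (fun s => tau 3 s * kapp 2 (tau 3) s) =
  mean (fun s => kapp 1 (tau 3) s * kapp 1 (tau 3) s).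
Proof. exact: (kapp_even b3 b3 (isT : (0 < 1)%N)). Qed.

Let kapp_even4 : mean (fun s => tau 3 s * kapp 4 (tau 3) s) =
  mean (fun s => kapp 2 (tau 3) s * kapp 2 (tau 3) s).
Proof. exact: (kapp_even b3 b3 (isT : (0 < 2)%N)). Qed.

Let kapp_35 : mean (fun s => tau 3 s * kapp 2 (tau 5) s) =
  mean (fun s => kapp 2 (tau 3) s * tau 5 s).
Proof. exact: (kapp_adj unif bV symV 2 b3 b5). Qed.

Let t33_ge0 : 0 <= mean (fun s => tau 3 s * tau 3 s).
Proof. exact: mean_sqr_ge0. Qed.

Let k323_ge0 : 0 <= mean (fun s => tau 3 s * kapp 2 (tau 3) s).
Proof. rewrite kapp_even3; exact: mean_sqr_ge0. Qed.

Let c6E := etrans (coeff_6 bV symV UV d0 n4) (drop_last2 _ _ _ n6).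

Lemma c8_eq : c 6 = 0 -> c 8 =
  (n (lCPC 3 2 3))%:R * mean (fun s => tau 3 s * kapp 2 (tau 3) s)
  + (n (lC 8))%:R * mean (tau 8).
Proof.
move=> /(etrans (esym c6E)) c60; rewrite (coeff_8 bV symV UV d0 n4 n6).
rewrite [X in _ + X]addrA addrA; congr (_ + _).
apply: (combine_8 _ _ _ t33_ge0 _ n35 nu35 c60).
by move=> t33; split; [exact: (mean_le0 b3 t33)|exact: (sqr_mean t33 b3 b5)].
Qed.

Lemma c8_ge : c 6 = 0 -> (n (lC 8))%:R * mean (tau 8) <= c 8.
Proof.
move=> c60; rewrite (c8_eq c60) lerDr; exact: (mulr_ge0 (ler0n _ _) k323_ge0).
Qed.

Hypothesis n8 : n (lC 8) = 0%N.
Hypothesis na : n (lCC 3 3) = 0%N -> n (lCC 3 7) = 0%N.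
Hypothesis nb : n (lCC 3 3) = 0%N -> n (lCuC 3 3) = 0%N -> n (lCuC 3 7) = 0%N.
Hypothesis nc : n (lCC 3 3) = 0%N -> n (lCPC 3 2 3) = 0%N ->
  (n (lCPC 3 2 5) ^ 2 <= 4 * n (lCPC 3 4 3) * n (lCC 5 5))%N.

Lemma c8_ge0 : c 6 = 0 -> 0 <= c 8.
Proof.
move=> c60; have := c8_ge c60; rewrite n8 (mul0r (mean (tau 8))); exact.
Qed.

Lemma c10_ge : c 6 = 0 -> c 8 = 0 -> (n (lC 10))%:R * mean (tau 10) <= c 10.
Proof.
move=> c60; rewrite (c8_eq c60) n8 (mul0r (mean (tau 8))) addr0 => c80.
move: c60 => /(etrans (esym c6E)) c60.
rewrite (coeff_10 bV symV UV d0 n4 n6 n8).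
apply: (combine_10 _ _ _ _ _ t33_ge0 _ _ _ _ _ _ _ na nb nc c60 c80).
- exact: mean_sqr_ge0.
- move=> t33; split; [exact: (mean_le0 b3 t33)|exact: (sqr_mean t33 b3 b7)
    |exact: (sqr_mean t33 b3 (bk 2 b3))|exact: (dens_T2_0 bV symV t33)
    |exact: (dens_T3_0 bV symV t33)].
- exact: (dens_T1_0 bV symV).
- move=> /(etrans (esym kapp_even3)) k0.
  have z (f : T -> R) : bddmeas f -> mean (fun s => kapp 2 (tau 3) s * f s) = 0.
    move=> bf; rewrite (kappD unif bV b3 (isT : (0 < 1)%N) (isT : (0 < 1)%N)).
    rewrite -(kapp_adj unif bV symV 1 (bk 1 b3) bf).
    exact: (sqr_mean k0 (bk 1 b3) (bk 1 bf)).
  split; first exact: (etrans kapp_even4 (z _ (bk 2 b3))).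
  exact: (etrans kapp_35 (z _ b5)).
- move=> x y z x0 z0 xyz.
  rewrite [X in x * X + _]kapp_even4 [X in _ + y * X + _]kapp_35.
  exact: (mean_quadratic (bk 2 b3) b5 x0 z0 xyz).
- move=> h33; split; [apply: (cnt_emb _ _ h33)|apply: (cnt_emb _ _ h33)]; by vm_compute.
- by move=> hu; apply: (cnt_emb _ _ hu); vm_compute.
Qed.

End Kernel.
End Signs.

(** * Coefficients of the sign kernels *)

Section ArithmeticOfWitnesses.
Local Open Scope ring_scope.

Lemma natr_mul_0 (R : pzRingType) (k : nat) (t : R) : k = 0%N \/ t = 0 -> k%:R * t = 0.
Proof. by case=> ->; rewrite ?mul0r ?mulr0. Qed.

Lemma sum_6 (R : comPzRingType) (n33 nu33 n6 : nat) (t m3 m6 t' m3' m6' : R) :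
  t = t' -> m3 = m3' -> m6 = m6' ->
  n33%:R * t + (nu33%:R * (m3 * m3) + n6%:R * m6) =
  n33%:R * t' + (nu33%:R * m3' ^+ 2 + n6%:R * m6').
Proof. by move=> -> -> ->. Qed.

Lemma sum_8 (R : pzRingType) (n323 n35 nu35 n8 : nat) (k t m3 m5 m8 k' t' m3' m5' m8' : R) :
  k = k' -> t = t' -> m3 = m3' -> m5 = m5' -> m8 = m8' ->
  n323%:R * k + (n35%:R * t + (nu35%:R * (m3 * m5) + n8%:R * m8)) =
  n323%:R * k' + (n35%:R * t' + (nu35%:R * (m3' * m5') + n8%:R * m8')).
Proof. by move=> -> -> -> -> ->. Qed.

Lemma sum_10 (R : comPzRingType) (nT3 nT2 nT1 n343 n325 n37 nu37 n55 nu55 n10 : nat)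
    (d3 d2 d1 k343 k325 t37 m3 m7 t55 m5 m10 k343' k325' t37' m3' m7' t55' m5' m10' : R) :
  nT3 = 0%N \/ d3 = 0 -> nT2 = 0%N \/ d2 = 0 -> nT1 = 0%N \/ d1 = 0 ->
  k343 = k343' -> k325 = k325' -> t37 = t37' -> m3 = m3' -> m7 = m7' -> t55 = t55' ->
  m5 = m5' -> m10 = m10' ->
  nT3%:R * d3 + (nT2%:R * d2 + (nT1%:R * d1 + (n343%:R * k343
    + (n325%:R * k325 + (n37%:R * t37 + (nu37%:R * (m3 * m7) + (n55%:R * t55
    + (nu55%:R * (m5 * m5) + n10%:R * m10)))))))) =
  n343%:R * k343' + (n325%:R * k325' + (n37%:R * t37' + (nu37%:R * (m3' * m7')
    + (n55%:R * t55' + (nu55%:R * m5' ^+ 2 + n10%:R * m10'))))).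
Proof.
by move=> /natr_mul_0-> /natr_mul_0-> /natr_mul_0-> -> -> -> -> -> -> -> ->; rewrite !add0r.
Qed.

(** The minimum of the quadratic polynomial, at y / (2 x), when x > 0, and any
large s otherwise. *)
Lemma quadratic_negative (R : realFieldType) (x y z : nat) : (4 * x * z < y ^ 2)%N ->
  exists2 s : R, 0 <= s & x%:R * s ^+ 2 - y%:R * s + z%:R < 0.
Proof.
move=> h; have y0 : (0 < y)%N by case: y h.
have [x0|x0] := posnP x.
  exists ((z%:R + 1) / y%:R); first by rewrite divr_ge0 ?addr_ge0 ?ler0n.
  by rewrite x0 mul0r mulrC divfK ?pnatr_eq0 -?lt0n//; lra.
have xp : 0 < x%:R :> R by rewrite ltr0n.
exists (y%:R / (2 * x%:R)); first by rewrite divr_ge0 ?mulr_ge0 ?ler0n.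
move: h; rewrite -(ltr_nat R) natrX !natrM => h.
rewrite (_ : _ + _ = (4 * x%:R * z%:R - y%:R ^+ 2) / (4 * x%:R)); last first.
  by field; rewrite pnatr_eq0 -lt0n.
by rewrite pmulr_llt0 ?invr_gt0 ?mulr_gt0// subr_lt0.
Qed.

Lemma large_nat (R : archiRealFieldType) (e b : R) : 0 < e ->
  exists2 N : nat, (0 < N)%N & b < N%:R * e.
Proof.
move=> e0; exists (Num.bound `|b / e|).+1 => //.
rewrite -ltr_pdivrMr// (le_lt_trans (ler_norm _))//.
by rewrite (lt_trans (archi_boundP (normr_ge0 _)))// ltr_nat.
Qed.

End ArithmeticOfWitnesses.

Section WitnessExpansions.
Context (R : realType).
Local Open Scope ring_scope.
Local Notation T := (measurableTypeR R).
Local Notation unif := (@unif R).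
Local Notation mean := (mean unif).
Variables (D : seq graph) (A : nat -> R) (mu : R) (V : T * T -> T) (h : T -> R).
Local Notation c := (coeff D V).
Local Notation n := (cnt D).
Local Notation tau := (tau unif (V : T * T -> R)).

Let VV (z : T * T) : @unit_square R z -> V z = V z.
Proof. by []. Qed.

Lemma sk_c2 eps : sign_kernel A eps mu V h -> c 2 = 0.
Proof. by move=> hV; apply: (coeff_2_0 (sk_bdd hV) (sk_sym hV) VV (sk_deg0 hV)). Qed.

Lemma sk_c4 eps : sign_kernel A eps mu V h -> n (lC 4) = 0%N -> c 4 = 0.
Proof.
move=> hV n4; apply: (etrans (coeff_4 (sk_bdd hV) (sk_sym hV) VV (sk_deg0 hV) D)).
by apply: natr_mul_0; left.
Qed.

Section Split.
Hypothesis hV : sign_kernel A (-1) mu V h.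
Let bV := sk_bdd hV.
Let symV := sk_sym hV.
Let d0 := sk_deg0 hV.

Lemma split_c6 : n (lC 4) = 0%N -> c 6 =
  (n (lCC 3 3))%:R * (4 * A 3 * A 3) + ((n (lCuC 3 3))%:R * 0 ^+ 2 +
  (n (lC 6))%:R * (A 6 * (1 + (-1) ^+ 6) + (mu ^+ 6 + (- mu) ^+ 6))).
Proof.
move=> n4; apply: (etrans (coeff_6 bV symV VV d0 n4) (sum_6 _ _ _ _ _ (sk_mean_tau hV 5))).
- exact: (split_mean2 hV).
- exact: (split_mean hV).
Qed.

Lemma split_c8 : n (lC 4) = 0%N -> n (lC 6) = 0%N -> c 8 =
  (n (lCPC 3 2 3))%:R * (4 * mu ^+ 2 * A 3 * A 3) + ((n (lCC 3 5))%:R * (4 * A 3 * A 5) +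
  ((n (lCuC 3 5))%:R * (0 * 0) + (n (lC 8))%:R *
   (A 8 * (1 + (-1) ^+ 8) + (mu ^+ 8 + (- mu) ^+ 8)))).
Proof.
move=> n4 n6; apply: (etrans (coeff_8 bV symV VV d0 n4 n6)
  (sum_8 _ _ _ _ _ _ _ _ (sk_mean_tau hV 7))).
- exact: (split_kapp hV).
- exact: (split_mean2 hV).
- exact: (split_mean hV).
- exact: (split_mean hV).
Qed.

(** The graphs T_3 and T_2 contain a bowtie, and T_1 has a triangle as a
component; either the counts or the densities are zero. *)
Lemma split_c10 : n (lC 4) = 0%N -> n (lC 6) = 0%N -> n (lC 8) = 0%N ->
  n (lCC 3 3) = 0%N \/ A 3 = 0 -> c 10 =
  (n (lCPC 3 4 3))%:R * (4 * mu ^+ 4 * A 3 * A 3) + ((n (lCPC 3 2 5))%:R * (4 * mu ^+ 2 * A 3 * A 5)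
   + ((n (lCC 3 7))%:R * (4 * A 3 * A 7) + ((n (lCuC 3 7))%:R * (0 * 0)
    + ((n (lCC 5 5))%:R * (4 * A 5 * A 5) + ((n (lCuC 5 5))%:R * 0 ^+ 2
    + (n (lC 10))%:R * (A 10 * (1 + (-1) ^+ 10) + (mu ^+ 10 + (- mu) ^+ 10))))))).
Proof.
move=> n4 n6 n8 h33.
have t33 : A 3 = 0 -> mean (fun s => tau 3 s * tau 3 s) = 0.
  move=> A0; rewrite (split_mean2 hV (isT : odd 3) (isT : odd 3)) A0; exact: mulr0.
apply: (etrans (coeff_10 bV symV VV d0 n4 n6 n8)
  (sum_10 _ _ _ _ _ _ _ _ _ _ _ _ _ _ _ _ _ (sk_mean_tau hV 9))).
- case: h33 => [h33|/t33 A0]; [left|right]; last exact: (dens_T3_0 bV symV A0).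
  by apply: (cnt_emb _ _ h33); vm_compute.
- case: h33 => [h33|/t33 A0]; [left|right]; last exact: (dens_T2_0 bV symV A0).
  by apply: (cnt_emb _ _ h33); vm_compute.
- right; apply: (dens_T1_0 bV symV); exact: (split_mean hV).
- exact: (split_kapp hV).
- exact: (split_kapp hV).
- exact: (split_mean2 hV).
- exact: (split_mean hV).
- exact: (split_mean hV).
- exact: (split_mean2 hV).
- exact: (split_mean hV).
Qed.

End Split.

Section Unsplit.
Hypothesis hV : sign_kernel A 1 0 V h.
Let bV := sk_bdd hV.
Let symV := sk_sym hV.
Let d0 := sk_deg0 hV.

Lemma unsplit_c6 : n (lC 4) = 0%N -> c 6 =
  (n (lCC 3 3))%:R * (4 * A 3 * A 3) + ((n (lCuC 3 3))%:R * (2 * A 3) ^+ 2 +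
  (n (lC 6))%:R * (2 * A 6)).
Proof.
move=> n4; apply: (etrans (coeff_6 bV symV VV d0 n4) (sum_6 _ _ _ _ _ _)).
- exact: (unsplit_mean2 hV).
- exact: (unsplit_mean hV).
- exact: (unsplit_mean hV).
Qed.

Lemma unsplit_c8 : n (lC 4) = 0%N -> n (lC 6) = 0%N -> c 8 =
  (n (lCPC 3 2 3))%:R * 0 + ((n (lCC 3 5))%:R * (4 * A 3 * A 5) +
  ((n (lCuC 3 5))%:R * ((2 * A 3) * (2 * A 5)) + (n (lC 8))%:R * (2 * A 8))).
Proof.
move=> n4 n6; apply: (etrans (coeff_8 bV symV VV d0 n4 n6)
  (sum_8 _ _ _ _ _ _ _ _ _)).
- exact: (unsplit_kapp hV).
- exact: (unsplit_mean2 hV).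
- exact: (unsplit_mean hV).
- exact: (unsplit_mean hV).
- exact: (unsplit_mean hV).
Qed.

Lemma unsplit_c10 : n (lC 4) = 0%N -> n (lC 6) = 0%N -> n (lC 8) = 0%N ->
  n (lCC 3 3) = 0%N -> n (lCuC 3 3) = 0%N -> c 10 =
  (n (lCPC 3 4 3))%:R * 0 + ((n (lCPC 3 2 5))%:R * 0
   + ((n (lCC 3 7))%:R * (4 * A 3 * A 7) + ((n (lCuC 3 7))%:R * ((2 * A 3) * (2 * A 7))
    + ((n (lCC 5 5))%:R * (4 * A 5 * A 5) + ((n (lCuC 5 5))%:R * (2 * A 5) ^+ 2
    + (n (lC 10))%:R * (2 * A 10)))))).
Proof.
move=> n4 n6 n8 h33 hu33.
apply: (etrans (coeff_10 bV symV VV d0 n4 n6 n8)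
  (sum_10 _ _ _ _ _ _ _ _ _ _ _ _ _ _ _ _ _ _)).
- by left; apply: (cnt_emb _ _ h33); vm_compute.
- by left; apply: (cnt_emb _ _ h33); vm_compute.
- by left; apply: (cnt_emb _ _ hu33); vm_compute.
- exact: (unsplit_kapp hV).
- exact: (unsplit_kapp hV).
- exact: (unsplit_mean2 hV).
- exact: (unsplit_mean hV).
- exact: (unsplit_mean hV).
- exact: (unsplit_mean2 hV).
- exact: (unsplit_mean hV).
- exact: (unsplit_mean hV).
Qed.

End Unsplit.
End WitnessExpansions.

(** * Classification of the deck *)

Section Classification.
Context (R : realType).
Local Open Scope ring_scope.
Local Notation T := (measurableTypeR R).
Variable D : seq graph.
Hypothesis hD : is_deck 10 D.
Local Notation n := (cnt D).
Implicit Type U : T * T -> T.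

Lemma subdeck_eq0 U k : evens 8 k -> (coeff (subdeck 8 D) U k = 0) <-> (coeff D U k = 0).
Proof.
move=> /and3P[_ k8 _]; have [e e0 ->] := coeff_sign U hD k8; split=> [|->]; last exact: mulr0.
by move/eqP; rewrite mulf_eq0 gt_eqF//= => /eqP.
Qed.

Lemma first_nonzero_8_10 U k : first_nonzero 8 (subdeck 8 D) U k -> first_nonzero 10 D U k.
Proof.
move=> [ek ck hk]; split; first exact: evens_8_10.
  by move=> /(subdeck_eq0 U ek).
move=> j /and3P[j0 _ oj] jk; have ej : evens 8 j.
  by apply/and3P; split => //; move/and3P: ek => [_ k8 _]; lia.
by apply/(subdeck_eq0 U ej)/hk.
Qed.

Lemma first_positive_8_10 U : first_positive 8 (subdeck 8 D) U -> first_positive 10 D U.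
Proof.
move=> [k fk ck]; exists k; first exact: first_nonzero_8_10.
have [/and3P[_ k8 _] _ _] := fk; have [e e0 E] := coeff_sign U hD k8.
by move: ck; rewrite E pmulr_rgt0.
Qed.

Lemma first_negative_8_10 U : first_negative 8 (subdeck 8 D) U -> first_negative 10 D U.
Proof.
move=> [k fk ck]; exists k; first exact: first_nonzero_8_10.
have [/and3P[_ k8 _] _ _] := fk; have [e e0 E] := coeff_sign U hD k8.
by move: ck; rewrite E pmulr_rlt0.
Qed.

Lemma classIII_nonneg U k : class_III R 8 (subdeck 8 D) -> is_kernel U -> evens 8 k ->
  (forall j, evens 8 j -> (j < k)%N -> coeff D U j = 0) -> 0 <= coeff D U k.
Proof.
move=> [_ h3] kU ek hk; have [hz|[k' [ek' ck' hk'] pk']] := h3 U kU.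
  by rewrite (iffLR (subdeck_eq0 U ek) (hz k ek)).
have [kk'|k'k|kk'] := ltngtP k k'.
- by rewrite (iffLR (subdeck_eq0 U ek) (hk' k ek kk')).
- by case: ck'; apply: (iffRL (subdeck_eq0 U ek')); exact: hk.
- have /and3P[_ k8 _] := ek'; have [e e0 E] := coeff_sign U hD k8.
  by move: pk'; rewrite E pmulr_rgt0// kk' => /ltW.
Qed.

Section ClassIII.
Hypothesis P2_gt0 : (0 < n lP2)%N.
Hypothesis h3 : class_III R 8 (subdeck 8 D).

Lemma classIII_kernel : exists U V : T * T -> T,
  [/\ bddmeas (V : T * T -> R), forall x y, V (x, y) = V (y, x),
      forall z, @unit_square R z -> U z = V z,
      mean (@unif R) (fun s => deg V s ^+ 2) = 0 &
      nonzero U /\ forall k, evens 8 k -> coeff D U k = 0].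
Proof.
have [[U [kU nU zU]] _] := h3; have [V [bV symV UV]] := kernel_extend kU.
have cU k : evens 8 k -> coeff D U k = 0.
  by move=> ek; exact: (iffLR (subdeck_eq0 U ek) (zU k ek)).
have [|d0] := coeff_2_cases bV symV UV P2_gt0; first by rewrite (cU 2%N)// ltxx.
by exists U, V.
Qed.

Lemma classIII_n4 : n (lC 4) = 0%N.
Proof.
have [U [V [bV symV UV d0 [nU cU]]]] := classIII_kernel.
have [//|n4] := posnP (n (lC 4)).
have := etrans (esym (coeff_4 bV symV UV d0 D)) (cU 4%N isT).
case/natr_mul_eq0 => // t0.
by have := mean_tau_gt0 bV symV UV (isT : (2 <= 2)%N) nU; rewrite [mean _ _]t0 ltxx.
Qed.

Lemma classIII_n6 : n (lC 6) = 0%N.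
Proof.
have [U [V [bV symV UV d0 [nU cU]]]] := classIII_kernel.
have [//|n6] := posnP (n (lC 6)).
have := c6_ge bV symV UV classIII_n4 d0; rewrite (cU 6%N isT).
have := mean_tau_gt0 bV symV UV (isT : (2 <= 3)%N) nU.
move=> t0 h; have : 0 < (n (lC 6))%:R * mean (@unif R) (tau (@unif R) (V : T * T -> R) 6).
  by apply: mulr_gt0 => //; rewrite ltr0n.
by rewrite ltNge h.
Qed.

Let n4 := classIII_n4.
Let n6 := classIII_n6.

Lemma witness_nonneg_8 A eps mu (V : T * T -> T) h : sign_kernel A eps mu V h ->
  coeff D V 6 = 0 -> 0 <= coeff D V 8.
Proof.
move=> hV c6; apply: classIII_nonneg => //; first exact: (sk_kernel hV).
move=> j /evens8; rewrite !inE => /or4P[] /eqP-> // _.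
- exact: (sk_c2 _ hV).
- exact: (sk_c4 hV).
Qed.

(** Eigenvalues 2 and - 1 with multiplicities N and 16 N have power sums - 8 N,
16 N and 272 N for k = 3, 5, 8.  In the split kernel the coefficient 8 is
- 512 N^2 times the count of C_3 o C_5, plus 544 N times that of C_8. *)
Lemma classIII_n35 : n (lCC 3 3) = 0%N -> n (lCC 3 5) = 0%N.
Proof.
move=> n33; have [//|n35] := posnP (n (lCC 3 5)); exfalso.
(* N = 2 s(C_8) + 1 makes 512 N exceed 544 s(C_8) *)
have [V [h hV]] := two_valued_kernel (2 * n (lC 8) + 1) 16 (-1) (0 : R).
have c6 : coeff D V 6 = 0.
  by rewrite (split_c6 hV n4) n33 n6; ring.
have := witness_nonneg_8 hV c6; rewrite (split_c8 hV n4 n6).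
move: n35; move: (n (lCC 3 5)) (n (lC 8)) (n (lCPC 3 2 3)) (n (lCuC 3 5)) => p q a b.
rewrite -(ler_nat R) !(natrM, natrD) => p1; have q0 : 0 <= q%:R :> R by [].
move: (p%:R) (q%:R) (a%:R) (b%:R) p1 q0 => {p q a b} p q a b p1 q0.
suff : 0 < (2 * q + 1) * (512 * p * (2 * q + 1) - 544 * q) by lra.
by apply: mulr_gt0; nra.
Qed.

(** The same eigenvalues with constant tau_k, so that t(C_3) t(C_5) < 0. *)
Lemma classIII_nu35 : n (lCC 3 3) = 0%N -> n (lCuC 3 3) = 0%N -> n (lCuC 3 5) = 0%N.
Proof.
move=> n33 nu33; have [//|nu35] := posnP (n (lCuC 3 5)); exfalso.
have [V [h hV]] := two_valued_kernel (2 * n (lC 8) + 1) 16 1 (0 : R).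
have c6 : coeff D V 6 = 0.
  by rewrite (unsplit_c6 hV n4) n33 nu33 n6; ring.
have := witness_nonneg_8 hV c6; rewrite (unsplit_c8 hV n4 n6).
rewrite (classIII_n35 n33).
move: nu35; move: (n (lC 8)) (n (lCPC 3 2 3)) (n (lCuC 3 5)) => q a p.
rewrite -(ler_nat R) !(natrM, natrD) => p1; have q0 : 0 <= q%:R :> R by [].
move: (p%:R) (q%:R) (a%:R) p1 q0 => {p q a} p q a p1 q0.
suff : 0 < (2 * q + 1) * (512 * p * (2 * q + 1) - 544 * q) by lra.
by apply: mulr_gt0; nra.
Qed.

Lemma classIII_n8 : n (lC 8) = 0%N.
Proof.
have [U [V [bV symV UV d0 [nU cU]]]] := classIII_kernel.
have [//|n8] := posnP (n (lC 8)).
have := c8_ge bV symV UV n4 d0 n6 classIII_n35 classIII_nu35 (cU 6%N isT).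
rewrite (cU 8%N isT) leNgt => /negP[]; apply: mulr_gt0; first by rewrite ltr0n.
exact: (mean_tau_gt0 bV symV UV (isT : (2 <= 4)%N) nU).
Qed.

Let n8 := classIII_n8.

Lemma witness_classII A eps mu (V : T * T -> T) h : sign_kernel A eps mu V h ->
  0 < A 2 * (1 + eps ^+ 2) + (mu ^+ 2 + (- mu) ^+ 2) ->
  coeff D V 6 = 0 -> coeff D V 8 = 0 -> coeff D V 10 < 0 -> class_II R 10 D.
Proof.
move=> hV nz c6 c8 c10; exists V; split; [exact: (sk_kernel hV)|exact: (sk_nonzero hV)|].
exists 10%N => //; split=> //; first by move=> c0; rewrite c0 ltxx in c10.
move=> j /evens10[|||[]] -> // _.
- exact: (sk_c2 _ hV).
- exact: (sk_c4 hV).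
Qed.

Section NoBowtie.
Hypothesis n33 : n (lCC 3 3) = 0%N.
Let n35 := classIII_n35 n33.

(** With multiplicities N and 32 N the power sums for k = 3, 5, 7, 10 are
- 24 N, 0, 96 N and 1056 N: the terms with tau_5 disappear and the one of
C_3 o C_7 is negative and quadratic in N. *)
Lemma classII_a : (0 < n (lCC 3 7))%N -> class_II R 10 D.
Proof.
move=> n37; (* N = s(C_10) + 1 makes 9216 N exceed 2112 s(C_10) *)
have [V [h hV]] := two_valued_kernel (n (lC 10) + 1) 32 (-1) (0 : R).
apply: (witness_classII hV).
- rewrite natrM natrD; have : 0 <= (n (lC 10))%:R :> R by [].
  move: (n (lC 10))%:R => q q0; lra.
- by rewrite (split_c6 hV n4) n33 n6; ring.
- by rewrite (split_c8 hV n4 n6) n35 n8; ring.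
rewrite (split_c10 hV n4 n6 n8 (or_introl n33)).
move: n37; move: (n (lCPC 3 4 3)) (n (lCPC 3 2 5)) (n (lCC 3 7)) (n (lCuC 3 7)) (n (lCC 5 5))
  (n (lCuC 5 5)) (n (lC 10)) => a b p d e f q.
rewrite -(ler_nat R) !(natrM, natrD) => p1; have q0 : 0 <= q%:R :> R by [].
move: (a%:R) (b%:R) (p%:R) (d%:R) (e%:R) (f%:R) (q%:R) p1 q0 => {a b p d e f q} a b p d e f q p1 q0.
suff : 0 < (q + 1) * (9216 * p * (q + 1) - 2112 * q) by lra.
by apply: mulr_gt0; nra.
Qed.

Lemma classII_b : n (lCuC 3 3) = 0%N -> (0 < n (lCuC 3 7))%N -> class_II R 10 D.
Proof.
move=> nu33; have [n37 nu37|/classII_a//] := posnP (n (lCC 3 7)).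
have [V [h hV]] := two_valued_kernel (n (lC 10) + 1) 32 1 (0 : R).
apply: (witness_classII hV).
- rewrite natrM natrD; have : 0 <= (n (lC 10))%:R :> R by [].
  move: (n (lC 10))%:R => q q0; lra.
- by rewrite (unsplit_c6 hV n4) n33 nu33 n6; ring.
- by rewrite (unsplit_c8 hV n4 n6) n35 (classIII_nu35 n33 nu33) n8; ring.
rewrite (unsplit_c10 hV n4 n6 n8 n33 nu33) n37.
move: nu37; move: (n (lCPC 3 4 3)) (n (lCPC 3 2 5)) (n (lCuC 3 7)) (n (lCC 5 5))
  (n (lCuC 5 5)) (n (lC 10)) => a b p e f q.
rewrite -(ler_nat R) !(natrM, natrD) => p1; have q0 : 0 <= q%:R :> R by [].
move: (a%:R) (b%:R) (p%:R) (e%:R) (f%:R) (q%:R) p1 q0 => {a b p e f q} a b p e f q p1 q0.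
suff : 0 < (q + 1) * (9216 * p * (q + 1) - 2112 * q) by lra.
by apply: mulr_gt0; nra.
Qed.

(** With multiplicities N and 16 N the power sums for k = 3, 5 are - 8 N and
16 N.  If mu ^+ 2 = 2 s, the two dumbbells and C_5 o C_5 contribute 1024 N^2
times x s^2 - y s + z, which is negative for a suitable s. *)
Lemma classII_c : n (lCPC 3 2 3) = 0%N ->
  (4 * n (lCPC 3 4 3) * n (lCC 5 5) < n (lCPC 3 2 5) ^ 2)%N -> class_II R 10 D.
Proof.
move=> n323 /(quadratic_negative R)[s s0 Q0].
pose mu := Num.sqrt (2 * s); have mu2 : mu ^+ 2 = 2 * s by rewrite sqr_sqrtr// mulr_ge0.
have mu10 : 0 <= 2 * mu ^+ 10 by rewrite mulr_ge0// exprn_even_ge0.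
move: Q0; set Q := _ + _; rewrite -oppr_gt0 => Q0.
(* 2080 N is twice the power sum of order 10, and 2 mu ^+ 10 comes from the
   eigenvalues mu and - mu *)
have [N N0 hN] := large_nat ((n (lC 10))%:R * (2080 + 2 * mu ^+ 10)) Q0.
have [V [h hV]] := two_valued_kernel N 16 (-1) mu.
apply: (witness_classII hV).
- rewrite natrM; have : 0 < N%:R :> R by rewrite ltr0n.
  move: N%:R => {N0 hN hV} N N0; nra.
- by rewrite (split_c6 hV n4) n33 n6; ring.
- by rewrite (split_c8 hV n4 n6) n323 n35 n8; ring.
rewrite (split_c10 hV n4 n6 n8 (or_introl n33)).
rewrite [mu ^+ 4](_ : _ = 4 * s ^+ 2); last by rewrite (exprM mu 2 2) mu2; ring.
rewrite mu2 [(- mu) ^+ 10]exprNn; move: mu10 hN; move: (mu ^+ 10) => m m0.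
move: N0 Q0; rewrite /Q {Q mu mu2 hV}.
move: (n (lCPC 3 4 3)) (n (lCPC 3 2 5)) (n (lCC 3 7)) (n (lCuC 3 7)) (n (lCC 5 5))
  (n (lCuC 5 5)) (n (lC 10)) => x y p d z f q.
rewrite -(ler_nat R) !(natrM, natrD) => N1 Q0.
have q0 : 0 <= q%:R :> R by []. have p0 : 0 <= p%:R :> R by [].
move: (x%:R) (y%:R) (p%:R) (d%:R) (z%:R) (f%:R) (q%:R) N%:R N1 Q0 q0 p0.
move=> {x y p d z f q} x y p d z f q {}N N1 Q0 q0 p0 hN.
have : 0 <= q * m * (N - 1) by rewrite !mulr_ge0// ?subr_ge0//; lra.
have : 0 <= p * N * N by rewrite !mulr_ge0//; lra.
have : q * (2080 + 2 * m) * N < N * (- (x * s ^+ 2 - y * s + z)) * N.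
  by rewrite ltr_pM2r//; lra.
nra.
Qed.

End NoBowtie.

Section NoWitness.
Hypothesis na : n (lCC 3 3) = 0%N -> n (lCC 3 7) = 0%N.
Hypothesis nb : n (lCC 3 3) = 0%N -> n (lCuC 3 3) = 0%N -> n (lCuC 3 7) = 0%N.
Hypothesis nc : n (lCC 3 3) = 0%N -> n (lCPC 3 2 3) = 0%N ->
  (n (lCPC 3 2 5) ^ 2 <= 4 * n (lCPC 3 4 3) * n (lCC 5 5))%N.

(** The sign pattern of the coefficients when none of the bad configurations
occurs; t is the density of C_10. *)
Let signs U : is_kernel U -> first_positive 10 D U \/
  [/\ forall k, evens 8 k -> coeff D U k = 0 &
    exists2 t : R, (nonzero U -> 0 < t) /\ 0 <= t & (n (lC 10))%:R * t <= coeff D U 10].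
Proof.
move=> kU; have [V [bV symV UV]] := kernel_extend kU.
have first k : evens 10 k -> (forall j, evens 10 j -> (j < k)%N -> coeff D U j = 0) ->
    0 < coeff D U k -> first_positive 10 D U.
  by move=> ek hk ck; exists k => //; split=> // c0; rewrite c0 ltxx in ck.
have [c2|d0] := coeff_2_cases bV symV UV P2_gt0.
  by left; apply: (first 2%N) => // j /evens10[|||[]] ->.
have c2 := coeff_2_0 bV symV UV d0 D.
have c4 : coeff D U 4 = 0.
  by apply: (etrans (coeff_4 bV symV UV d0 D)); apply: natr_mul_0; left.
have := c6_ge bV symV UV n4 d0; rewrite n6 (mul0r (mean _ _)) le_eqVlt.
move=> /orP[/eqP/esym c6|c6]; last first.
  by left; apply: (first 6%N) => // j /evens10[|||[]] ->.
have := c8_ge0 bV symV UV n4 d0 n6 classIII_n35 classIII_nu35 n8 c6; rewrite le_eqVlt.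
move=> /orP[/eqP/esym c8|c8]; last first.
  by left; apply: (first 8%N) => // j /evens10[|||[]] ->.
have c10 := c10_ge bV symV UV n4 d0 n6 classIII_n35 classIII_nu35 n8 na nb nc c6 c8.
right; split; first by move=> k /evens8; rewrite !inE => /or4P[] /eqP->.
eexists; last exact: c10.
split; first exact: (mean_tau_gt0 bV symV UV (isT : (2 <= 5)%N)).
exact: (@mean_tau_even_ge0 _ _ _ (@unif R) V bV symV 5).
Qed.

Let first_10 U : (forall k, evens 8 k -> coeff D U k = 0) -> 0 < coeff D U 10 ->
  first_positive 10 D U.
Proof.
move=> c8 c10; exists 10%N => //; split=> //; first by move=> c0; rewrite c0 ltxx in c10.
by move=> j /evens10[|||[]] -> // _; exact: c8.
Qed.

Lemma classI_C10 : (0 < n (lC 10))%N -> class_I R 10 D.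
Proof.
move=> n10 U kU nU; have [//|[c8 [t [/(_ nU) t0 _] ct]]] := signs kU.
by apply: first_10 => //; apply: lt_le_trans ct; rewrite mulr_gt0// ltr0n.
Qed.

(** For the converse existence statement, the kernel with eigenvalues 1 and - 1
only has all odd tau_k equal to zero, and the even cycles do not occur. *)
Lemma classIII_C10 : n (lC 10) = 0%N -> class_III R 10 D.
Proof.
move=> n10; split.
  have [V [h hV]] := two_valued_kernel 0 0 (-1) (1 : R).
  exists V; split; [exact: (sk_kernel hV)|apply: (sk_nonzero hV)|].
    by rewrite muln0; lra.
  move=> j /evens10[|||[]] ->.
  - exact: (sk_c2 _ hV).
  - exact: (sk_c4 hV).
  - by rewrite (split_c6 hV n4) n6; ring.
  - by rewrite (split_c8 hV n4 n6) n8; ring.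
  - rewrite (split_c10 hV n4 n6 n8) ?n10; first by ring.
    by right; ring.
move=> U kU; have [|[c8 [t [_ t0] ct]]] := signs kU; first by right.
have := ct; rewrite n10 mul0r le_eqVlt => /orP[/eqP/esym c10|c10]; last first.
  by right; exact: first_10.
by left=> j /evens10[|||[]] -> //; exact: c8.
Qed.

End NoWitness.
End ClassIII.
End Classification.

Theorem theorem23 (R : realType) (D : seq graph)
    (hD : is_deck 10 D) (hP2 : 0 < subgraph_count D (Path 2)) :
  (class_I R 8 (subdeck 8 D) -> class_I R 10 D) /\
  (class_II R 8 (subdeck 8 D) -> class_II R 10 D) /\
  (class_III R 8 (subdeck 8 D) ->
    let cond_a :=
      subgraph_count D (CC 3 3) = 0 /\ 0 < subgraph_count D (CC 3 7) in
    let cond_b :=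
      subgraph_count D (CC 3 3) = 0 /\
      subgraph_count D (gunion (Cycle 3) (Cycle 3)) = 0 /\
      0 < subgraph_count D (gunion (Cycle 3) (Cycle 7)) in
    let cond_c :=
      subgraph_count D (CC 3 3) = 0 /\
      subgraph_count D (CPC 3 2 3) = 0 /\
      4 * subgraph_count D (CPC 3 4 3) * subgraph_count D (CC 5 5)
        < subgraph_count D (CPC 3 2 5) ^ 2 in
    (cond_a \/ cond_b \/ cond_c -> class_II R 10 D) /\
    (~ (cond_a \/ cond_b \/ cond_c) ->
      (0 < subgraph_count D (Cycle 10) -> class_I R 10 D) /\
      (subgraph_count D (Cycle 10) = 0 -> class_III R 10 D))).
Proof.
have cnt_CC k l h (w : wf (lCC k l)) (w0 : lCC k l != [::]) :=
  cnt_subgraph_count D w w0 (represents_CC h).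
have cnt_CuC k l h (w : wf (lCuC k l)) (w0 : lCuC k l != [::]) :=
  cnt_subgraph_count D w w0 (represents_CuC h).
have cnt_CPC k m l h (w : wf (lCPC k m l)) (w0 : lCPC k m l != [::]) :=
  cnt_subgraph_count D w w0 (represents_CPC h).
have cnt_C := cnt_subgraph_count D _ _ (represents_C (isT : 10 \in [:: 4; 6; 8; 10])).
rewrite (cnt_subgraph_count D _ _ represents_P2) // in hP2.
rewrite (cnt_CC 3 3) // (cnt_CC 3 7) // (cnt_CC 5 5) // (cnt_CuC 3 3) // (cnt_CuC 3 7) //.
rewrite (cnt_CPC 3 2 3) // (cnt_CPC 3 4 3) // (cnt_CPC 3 2 5) // cnt_C //.
split; first by move=> h U kU nU; apply: first_positive_8_10 => //; exact: h.
split.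
  by move=> [U [kU nU fU]]; exists U; split => //; exact: first_negative_8_10.
move=> h3 cond_a cond_b cond_c; split.
  case=> [[n33 n37]|[[n33 [nu33 nu37]]|[n33 [n323 quad]]]].
  - exact: (classII_a hD hP2 h3 n33 n37).
  - exact: (classII_b hD hP2 h3 n33 nu33 nu37).
  - exact: (classII_c hD hP2 h3 n33 n323 quad).
move=> none.
have na : cnt D (lCC 3 3) = 0 -> cnt D (lCC 3 7) = 0.
  by move=> n33; have [//|n37] := posnP (cnt D (lCC 3 7)); case: none; left.
have nb : cnt D (lCC 3 3) = 0 -> cnt D (lCuC 3 3) = 0 -> cnt D (lCuC 3 7) = 0.
  move=> n33 nu33; have [//|nu37] := posnP (cnt D (lCuC 3 7)).
  by case: none; right; left.
have nc : cnt D (lCC 3 3) = 0 -> cnt D (lCPC 3 2 3) = 0 ->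
    cnt D (lCPC 3 2 5) ^ 2 <= 4 * cnt D (lCPC 3 4 3) * cnt D (lCC 5 5).
  move=> n33 n323; rewrite leqNgt; apply/negP => quad.
  by case: none; right; right.
split=> n10; first exact: (classI_C10 hD hP2 h3 na nb nc n10).
exact: (classIII_C10 hD hP2 h3 na nb nc n10).
Qed.
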